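(* Let $\mathcal{A}$ be a unital $*$-subalgebra of a unital $C^*$-algebra $A$ such that $\mathcal{A}$ and all the matrix algebras $M_m(\mathcal{A})$, $m\ge2$, are closed under holomorphic functional calculus. Let $h\in\mathrm{GL}_m^+(\mathcal{A})$ and $u\in\mathrm{GL}_m(\mathcal{A})$ be compatible with each other and each self-compatible. Assume further that $u$ and $u^*$ are compatible with each other. Then $$\det(u^*hu)=\det(u^*u)\det(h).$$
   Context: $\mathrm{GL}_m(\mathcal{A})$ is the group of invertible elements of $M_m(\mathcal{A})$ and $\mathrm{GL}_m^+(\mathcal{A})$ the set of its positive elements (positivity in the $C^*$-algebra $M_m(A)$); $\mathcal{A}^{++}$ is the set of positive invertible elements of $\mathcal{A}$. The adjoint of $u=(u_{ij})$ is $u^*=(u_{ji}^* )$. The determinant $\det:\mathrm{GL}_m^+(\mathcal{A})\to\mathcal{A}^{++}$ is defined by $\det(h)=\exp(\mathrm{Tr}[\log h])$, where $\log h\in M_m(\mathcal{A})$ and $\exp$ are given by holomorphic functional calculus and $\mathrm{Tr}[a]=\sum_ia_{ii}\in\mathcal{A}$ for $a=(a_{ij})\in M_m(\mathcal{A})$. Matrices $a=(a_{ij})\in M_p(\mathcal{A})$ and $b=(b_{kl})\in M_q(\mathcal{A})$ are compatible when each entry of $a$ commutes with every entry of $b$; a matrix is self-compatible when it is compatible with itself. *)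

(* Defs.v *)
From HB Require Import structures.
From mathcomp Require Import all_boot all_order all_algebra complex.
From mathcomp Require Import all_classical all_reals all_analysis.

Set Implicit Arguments.
Unset Strict Implicit.
Unset Printing Implicit Defensive.

Import Order.TTheory GRing.Theory Num.Theory.
Import numFieldNormedType.Exports.

Local Open Scope classical_set_scope.
Local Open Scope complex_scope.
Local Open Scope ring_scope.

(* No continuity axiom is included: the topology only serves to take limits in
   a C*-algebra A and in M_m(A), where the operations are continuous. *)
#[short(type="topAlgType")]
HB.structure Definition TopAlgebra (K : numDomainType) :=
  {B of PreTopologicalLmodule K B & GRing.Algebra K B}.

HB.instance Definition _ (R : rcfType) := GRing.ComAlgebra.copy R[i] R[i]^o.
HB.instance Definition _ (R : rcfType) := NormedModule.copy R[i] R[i]^o.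

(* Norms of R[i]-modules take their values in R[i]; there, x <= y means that
   y - x is a nonnegative real number.
   The algebra operations are fields of a record over a Banach space, because
   Hierarchy Builder has no join of NormedModule and Algebra. *)
Record cstarAlg (R : realType) := CStarAlg {
  cstar_space : completeNormedModType R[i];
  cstar_one : cstar_space;
  cstar_mul : cstar_space -> cstar_space -> cstar_space;
  cstar_star : cstar_space -> cstar_space;
  cstar_mulA : associative cstar_mul;
  cstar_mul1l : left_id cstar_one cstar_mul;
  cstar_mul1r : right_id cstar_one cstar_mul;
  cstar_mulDl : left_distributive cstar_mul +%R;
  cstar_mulDr : right_distributive cstar_mul +%R;
  cstar_one_neq0 : cstar_one != 0;
  cstar_scaleAl : forall (c : R[i]) x y,
    c *: cstar_mul x y = cstar_mul (c *: x) y;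
  cstar_scaleAr : forall (c : R[i]) x y,
    c *: cstar_mul x y = cstar_mul x (c *: y);
  cstar_starD : forall x y,
    cstar_star (x + y) = cstar_star x + cstar_star y;
  cstar_starZ : forall (c : R[i]) x, cstar_star (c *: x) = c^* *: cstar_star x;
  cstar_starM : forall x y,
    cstar_star (cstar_mul x y) = cstar_mul (cstar_star y) (cstar_star x);
  cstar_starK : involutive cstar_star;
  cstar_normM : forall x y, `|cstar_mul x y| <= `|x| * `|y| :> R[i];
  cstar_normC : forall x, `|cstar_mul (cstar_star x) x| = `|x| ^+ 2 :> R[i]
}.

Definition cstar_sort (R : realType) (A : cstarAlg R) : Type := cstar_space A.
Coercion cstar_sort : cstarAlg >-> Sortclass.

HB.instance Definition _ (R : realType) (A : cstarAlg R) :=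
  CompleteNormedModule.on (cstar_sort A).
HB.instance Definition _ (R : realType) (A : cstarAlg R) :=
  GRing.Zmodule_isNzRing.Build (cstar_sort A) (@cstar_mulA R A)
    (@cstar_mul1l R A) (@cstar_mul1r R A) (@cstar_mulDl R A) (@cstar_mulDr R A)
    (@cstar_one_neq0 R A).
HB.instance Definition _ (R : realType) (A : cstarAlg R) :=
  GRing.Lmodule_isLalgebra.Build R[i] (cstar_sort A) (@cstar_scaleAl R A).
HB.instance Definition _ (R : realType) (A : cstarAlg R) :=
  GRing.Lalgebra_isAlgebra.Build R[i] (cstar_sort A) (@cstar_scaleAr R A).

Definition star (R : realType) (A : cstarAlg R) (a : A) : A := cstar_star a.


Section RieszCalculus.
Variable R : realType.
Local Notation C := R[i].

(* For continuous g, the integral of g along the oriented segment from p to q,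
   as the limit of its Riemann sums over regular subdivisions. *)
Definition segment_integral (V : topAlgType C) (g : C -> V) (p q : C) : V :=
  xget 0 [set v : V |
    (fun n : nat => \sum_(k < n.+1)
       ((q - p) / n.+1%:R) *: g (p + k%:R / n.+1%:R * (q - p))) @ \oo --> v].

(* A contour is a finite family of closed polygons, each given by the cyclic
   sequence of its vertices. *)
Definition contour := seq (seq C).

Definition contour_edges (G : contour) : seq (C * C) :=
  flatten [seq zip s (rot 1 s) | s <- G].

Definition contour_support (G : contour) : set C :=
  [set z | exists2 e, e \in contour_edges G &
           exists2 t : R, 0 <= t <= 1 & z = e.1 + t%:C * (e.2 - e.1)].

Definition contour_integral (V : topAlgType C) (G : contour) (g : C -> V) : V :=
  \sum_(e <- contour_edges G) segment_integral g e.1 e.2.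

Definition two_pi_i : C := 0 +i* (2 * pi).

Definition winding (G : contour) (z : C) : C :=
  two_pi_i^-1 * contour_integral G (fun w => (w - z)^-1 : C).

Definition surrounds (G : contour) (K U : set C) : Prop :=
  [/\ contour_support G `<=` U `\` K,
      forall z, K z -> winding G z = 1 &
      forall z, ~ U z -> winding G z = 0].

Definition holomorphic_on (U : set C) (f : C -> C) : Prop :=
  open U /\ forall z, U z -> derivable f z 1.

Section Spectrum.
Variable B : topAlgType C.
Implicit Types b c : B.

Definition inverse_of b c : Prop := b * c = 1 /\ c * b = 1.

Definition spectrum b : set C :=
  [set z | ~ exists c, inverse_of (z%:A - b) c].

Definition resolvent b (z : C) : B := xget 0 [set c | inverse_of (z%:A - b) c].

(* f(b) = (2 pi i)^-1 \int_G f(z) (z - b)^-1 dz, for a contour G surrounding the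
   spectrum of b in an open set on which f is holomorphic *)
Definition is_hfc (f : C -> C) b c : Prop :=
  exists U G, [/\ holomorphic_on U f, spectrum b `<=` U,
    surrounds G (spectrum b) U &
    c = two_pi_i^-1 *: contour_integral G (fun z => f z *: resolvent b z)].

Definition hfc (f : C -> C) b : B := xget 0 [set c | is_hfc f b c].

Definition closed_under_hfc (S : set B) : Prop :=
  forall b (f : C -> C) (U : set C), S b -> holomorphic_on U f ->
    spectrum b `<=` U -> S (hfc f b).

End Spectrum.

Definition cexp (z : C) : C :=
  (expR (complex.Re z))%:C * (cos (complex.Im z) +i* sin (complex.Im z)).

(* the principal branch: |Arg z| < pi off the half-line z <= 0, and
   tan (Arg z / 2) = Im z / (|z| + Re z) *)
Definition clog (z : C) : C :=
  let r := complex.Re `|z| in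
  ln r +i* (2 * atan (complex.Im z / (r + complex.Re z))).

End RieszCalculus.

(* M_(n+1)(A) as a complex algebra with the topology of entrywise convergence,
   which is that of its C*-norm; the library only makes 'M[A]_n.+1 an A-module.
   Sizes are successors because algebras are nontrivial rings. *)
Definition mxalg (R : realType) (A : cstarAlg R) (n : nat) : Type := 'M[A]_n.+1.

Section MatrixAlgebra.
Variables (R : realType) (A : cstarAlg R) (n : nat).
Local Notation M := (mxalg A n).

HB.instance Definition _ := GRing.NzRing.on M.
HB.instance Definition _ := PointedTopological.on M.

Definition mxalg_scale (c : R[i]) (a : M) : M := \matrix_(i, j) (c *: a i j).

Fact mxalg_scaleA c d a :
  mxalg_scale c (mxalg_scale d a) = mxalg_scale (c * d) a.
Proof. by apply/matrixP => i j; rewrite !mxE scalerA. Qed.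

Fact mxalg_scale1 : left_id 1 mxalg_scale.
Proof. by move=> a; apply/matrixP => i j; rewrite !mxE scale1r. Qed.

Fact mxalg_scaleDr : right_distributive mxalg_scale +%R.
Proof. by move=> c a b; apply/matrixP => i j; rewrite !mxE scalerDr. Qed.

Fact mxalg_scaleDl a : {morph mxalg_scale^~ a : c d / c + d}.
Proof. by move=> c d; apply/matrixP => i j; rewrite !mxE scalerDl. Qed.

HB.instance Definition _ := GRing.Zmodule_isLmodule.Build R[i] M
  mxalg_scaleA mxalg_scale1 mxalg_scaleDr mxalg_scaleDl.

Fact mxalg_scaleAl (c : R[i]) (a b : M) : c *: (a * b) = (c *: a) * b.
Proof.
apply/matrixP => i j; rewrite !mxE scaler_sumr; apply: eq_bigr => k _.
by rewrite !mxE scalerAl.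
Qed.

HB.instance Definition _ :=
  GRing.Lmodule_isLalgebra.Build R[i] M mxalg_scaleAl.

Fact mxalg_scaleAr (c : R[i]) (a b : M) : c *: (a * b) = a * (c *: b).
Proof.
apply/matrixP => i j; rewrite !mxE scaler_sumr; apply: eq_bigr => k _.
by rewrite !mxE scalerAr.
Qed.

HB.instance Definition _ :=
  GRing.Lalgebra_isAlgebra.Build R[i] M mxalg_scaleAr.

End MatrixAlgebra.

Section Determinant.
Variables (R : realType) (A : cstarAlg R).

Record star_subalgebra (S : set A) : Prop := StarSubalgebra {
  star_subalgebra1 : S 1;
  star_subalgebraD : forall a b, S a -> S b -> S (a + b);
  star_subalgebraZ : forall (c : R[i]) a, S a -> S (c *: a);
  star_subalgebraM : forall a b, S a -> S b -> S (a * b);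
  star_subalgebra_star : forall a, S a -> S (star a)
}.

Definition mx_over (S : set A) (n : nat) : set (mxalg A n) :=
  [set a | forall i j, S (a i j)].

Definition mxstar (n : nat) (u : mxalg A n) : mxalg A n :=
  \matrix_(i, j) star (u j i).

Definition mxpositive (n : nat) (h : mxalg A n) : Prop :=
  mxstar h = h /\ spectrum h `<=` [set z | 0 <= z].

Definition GL (S : set A) (n : nat) : set (mxalg A n) :=
  [set u | mx_over S u /\ exists2 v, mx_over S v & inverse_of u v].

Definition GLpos (S : set A) (n : nat) : set (mxalg A n) :=
  [set h | GL S h /\ mxpositive h].

Definition mxdet (n : nat) (h : mxalg A n) : A :=
  hfc (@cexp R) (\tr (hfc (@clog R) h)).

Definition compatible (p q : nat) (a : mxalg A p) (b : mxalg A q) : Prop :=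
  forall i j k l, a i j * b k l = b k l * a i j.

End Determinant.

(* Main.v *)
(* All entries of h, u and u^* commute with each other, and hence so do the
   elements of their bicommutant, a commutative subring closed under stars and
   inverses. Over it the usual determinant Det makes sense and is multiplicative, so
   that it suffices to show det(h) = Det(h) for matrices h over it with positive
   spectrum, and that u^* h u and u^* u are such matrices.

   Along the path h_t = 1 + t (h - 1), the integrals L_t of log(1 + t (z - 1)) against
   the resolvent of h satisfy L_t' = X_t := (h - 1) h_t^-1 and L_1 = log h, while
   Det(1 + d W) = 1 + d Tr W + O(d^2) gives Det(h_t)' = Det(h_t) Tr(X_t). Both
   Det(h_t) and exp(Tr L_t) solve the same linear equation, whence
   Det(h) = exp(Tr(log h)). The exponential of the functional calculus is
   lim (1 + b/n)^n. All of this rests on the integral of the resolvent along any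
   contour surrounding the spectrum being 2 pi i, which is a consequence of
   Liouville's theorem.

   For the positivity, 1 + w^* w is inverted by rank one updates; this makes the
   spectrum of Hermitian matrices real and that of w^* w positive. Finally
   u^* h u = (k u)^* (k u) with k = exp(log(h) / 2). *)
From HB Require Import structures.
Require Import Defs.
From mathcomp Require Import all_boot all_order all_algebra complex.
From mathcomp Require Import fingroup perm.
From mathcomp Require Import all_classical all_reals all_analysis.
From mathcomp Require Import ring lra.

Set Implicit Arguments.
Unset Strict Implicit.
Unset Printing Implicit Defensive.

Import Order.TTheory GRing.Theory Num.Theory.
Import numFieldNormedType.Exports.

Local Open Scope classical_set_scope.
Local Open Scope ring_scope.

(** * Complex exponential and logarithm *)

(** [hfc] selects by [xget] one of the values given by all admissible open sets and contours, and
    nothing is known of a contour beyond its support and its winding numbers. Hence contours are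
    never deformed into each other: every identity is derived on the contour at hand, and each
    integral is found from a primitive, from the winding numbers or from Liouville's theorem.

    Derivatives are replaced throughout by estimates |f s - f t - (s - t) g t| <= K (s - t)^2 with K
    uniform in s and t, and limits by errors K / n. The fundamental theorem of calculus,
    differentiation under the integral and uniqueness for linear equations then reduce to finite
    sums with explicit bounds, at the price of carrying constants along.

    The path from 1 to h circumvents two obstacles: the functional calculus is not known to be
    multiplicative, and log (u^* h u) has no simple expression in terms of log h. *)

Section Modulus.
Variable R : realType.
Local Notation C := R[i].
Local Open Scope complex_scope.
Implicit Types (z w : C) (x y : R).

(* The norm of the library on [C] takes its values in [C]; [modc] is its real part. *)
Definition modc z : R := Normc.normc z.

Lemma complex_ext z w :
  complex.Re z = complex.Re w -> complex.Im z = complex.Im w -> z = w.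
Proof. by case: z w => [a b] [c d] /= -> ->. Qed.

Lemma normc_modc z : `|z| = (modc z)%:C.
Proof. by []. Qed.

Lemma modc_ge0 z : 0 <= modc z.
Proof. by case: z => a b; rewrite /modc /= sqrtr_ge0. Qed.

Lemma modc0 : modc 0 = 0.
Proof. exact: Normc.normc0. Qed.

Lemma modc1 : modc 1 = 1.
Proof. exact: Normc.normc1. Qed.

Lemma modc_eq0 z : modc z = 0 -> z = 0.
Proof. exact: Normc.eq0_normc. Qed.

Lemma modc_gt0 z : z != 0 -> 0 < modc z.
Proof.
by rewrite lt_def modc_ge0 andbT; apply: contra_neq => /modc_eq0.
Qed.

Lemma modcM z w : modc (z * w) = modc z * modc w.
Proof. exact: Normc.normcM. Qed.

Lemma modcD z w : modc (z + w) <= modc z + modc w.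
Proof. exact: le_normcD. Qed.

Lemma modcN z : modc (- z) = modc z.
Proof. exact: normcN. Qed.

Lemma modcB z w : modc (z - w) = modc (w - z).
Proof. by rewrite -modcN opprB. Qed.

Lemma modcV z : modc z^-1 = (modc z)^-1.
Proof. exact: Normc.normcV. Qed.

Lemma modcX z n : modc (z ^+ n) = modc z ^+ n.
Proof. by elim: n => [|n IH]; rewrite ?expr0 ?modc1 // !exprS modcM IH. Qed.

Lemma modcE x y : modc (x +i* y) = Num.sqrt (x ^+ 2 + y ^+ 2).
Proof. by []. Qed.

Lemma modcR x : modc x%:C = `|x|.
Proof. by rewrite modcE expr0n addr0 sqrtr_sqr. Qed.

Lemma natrC n : n%:R = (n%:R : R)%:C :> C.
Proof. by rewrite rmorph_nat. Qed.

Lemma modc_nat n : modc n%:R = n%:R.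
Proof. by rewrite natrC modcR ger0_norm. Qed.

Lemma modc_sqr z : modc z ^+ 2 = complex.Re z ^+ 2 + complex.Im z ^+ 2.
Proof. by case: z => a b; rewrite modcE sqr_sqrtr ?addr_ge0 ?sqr_ge0. Qed.

Lemma Re_le_modc z : `|complex.Re z| <= modc z.
Proof.
rewrite -(ler_pXn2r (ltn0Sn 1)) ?nnegrE ?modc_ge0 // modc_sqr.
by rewrite real_normK ?num_real // lerDl sqr_ge0.
Qed.

Lemma Im_le_modc z : `|complex.Im z| <= modc z.
Proof.
rewrite -(ler_pXn2r (ltn0Sn 1)) ?nnegrE ?modc_ge0 // modc_sqr.
by rewrite real_normK ?num_real // lerDr sqr_ge0.
Qed.

Lemma modc_le_ReIm x y : modc (x +i* y) <= `|x| + `|y|.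
Proof.
have -> : x +i* y = x%:C + 'i%C * y%:C by rewrite [LHS]complexE.
by rewrite (le_trans (modcD _ _)) // modcM !modcR modcE expr0n expr1n add0r sqrtr1 mul1r.
Qed.

Lemma modc_lip z w : `|modc z - modc w| <= modc (z - w).
Proof.
rewrite ler_norml; apply/andP; split.
  by rewrite lerBrDr addrC lerBlDr addrC modcB -[X in modc X <= _](subrK z) modcD.
by rewrite lerBlDr -[X in modc X <= _](subrK w) modcD.
Qed.

End Modulus.

Arguments modc : simpl never.

Section RealEstimates.
Variable R : realType.
Implicit Types (x y : R).

Lemma lipschitz_of_derive (f df : R -> R) (K a b : R) :
  (forall x : R, is_derive x (1 : R) f (df x)) -> (forall x,
    Num.min a b <= x <= Num.max a b -> `|df x| <= K) ->
  `|f b - f a| <= K * `|b - a|.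
Proof.
move=> fd; wlog ab : a b / a <= b => [hw hb|hb].
  have [/hw|/ltW /hw h] := leP a b; first exact.
  by rewrite distrC (distrC b); apply: h => x; rewrite minC maxC; apply: hb.
have cf : {within `[a, b], continuous f}.
  apply: continuous_subspaceT => x; apply: differentiable_continuous.
  by apply/derivable1_diffP; case: (fd x).
have [c cab ->] := MVT_segment ab (fun x _ => fd x) cf.
rewrite normrM ler_wpM2r // hb // (min_idPl ab) (max_idPr ab).
by rewrite in_itv in cab.
Qed.

Lemma norm_le_between0 x y : Num.min 0 x <= y <= Num.max 0 x -> `|y| <= `|x|.
Proof.
have h1 := ler_norm x; have h2 := ler_norm (- x); rewrite normrN in h2.
rewrite ler_norml le_max ge_min => /andP[/orP[h3|h3] /orP[h4|h4]].
all: by apply/andP; split; lra.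
Qed.

Lemma norm_sin_le x : `|sin x| <= `|x|.
Proof.
have := @lipschitz_of_derive (sin : R -> R) cos 1 0 x.
rewrite sin0 !subr0 mul1r; apply => // y _; exact: cos_max.
Qed.

Lemma norm_cosB1_le x : `|cos x - 1| <= x ^+ 2.
Proof.
have := @lipschitz_of_derive (cos : R -> R) (fun x => - sin x) `|x| 0 x.
rewrite cos0 subr0 -expr2 real_normK ?num_real //; apply => // y hy.
by rewrite normrN (le_trans (norm_sin_le _)) // norm_le_between0.
Qed.

End RealEstimates.

Section ComplexExp.
Variable R : realType.
Local Notation C := R[i].
Local Open Scope complex_scope.
Implicit Types (z w d : C) (x y : R).

Lemma expR_mul1B_le x : (1 - x) * expR x <= 1.
Proof.
rewrite -[leRHS](expRxMexpNx_1 x) mulrC ler_wpM2l ?expR_ge0 //.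
exact: expR_ge1Dx.
Qed.

Lemma norm_expRB1_le x : `|expR x - 1| <= `|x| * expR `|x|.
Proof.
have h2 := expR_mul1B_le x.
have h3 := expR_ge1Dx x; have h4 := expR_gt0 x.
have [x0|x0] := leP 0 x.
  rewrite ger0_norm; first by rewrite ?(ger0_norm x0); lra.
  by lra.
rewrite ltr0_norm ?subr_lt0 ?expR_lt1 // (ltr0_norm x0).
have : 1 <= expR (- x) by rewrite -expR0 ler_expR; lra.
nra.
Qed.

Lemma norm_expRB1B_le x : `|expR x - 1 - x| <= x ^+ 2 * expR `|x|.
Proof.
have h3 := expR_ge1Dx x; have h4 := norm_expRB1_le x.
rewrite ger0_norm; last by lra.
have h2 := expR_mul1B_le x.
(* Rearranging (1 - x) e^x <= 1 gives e^x - 1 - x <= x (e^x - 1). *)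
apply: (@le_trans _ _ (x * (expR x - 1))); first by lra.
apply: (le_trans (ler_norm _)); rewrite normrM.
apply: (@le_trans _ _ (`|x| * (`|x| * expR `|x|))); first by rewrite ler_wpM2l.
by rewrite mulrA -expr2 real_normK ?num_real.
Qed.

Lemma cexpD z w : cexp (z + w) = cexp z * cexp w.
Proof.
case: z => a b; case: w => c d; rewrite /cexp /= expRD cosD sinD.
apply: complex_ext => /=; ring.
Qed.

Lemma cexp0 : cexp 0 = 1 :> C.
Proof. by rewrite /cexp /= expR0 cos0 sin0 mul1r. Qed.

Lemma modc_cexp z : modc (cexp z) = expR (complex.Re z).
Proof.
by rewrite /cexp modcM modcR modcE cos2Dsin2 sqrtr1 mulr1 ger0_norm ?expR_ge0.
Qed.

Lemma modc_cexp_le z : modc (cexp z) <= expR (modc z).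
Proof.
by rewrite modc_cexp ler_expR (le_trans (ler_norm _)) ?Re_le_modc.
Qed.

Lemma norm_sinB_le x : `|sin x - x| <= x ^+ 2.
Proof.
pose f (y : R) := sin y - y.
have fd (y : R) : is_derive y (1 : R) f (cos y - 1) by exact: is_deriveB.
have := @lipschitz_of_derive R f (fun y => cos y - 1) `|x| 0 x fd.
rewrite /f sin0 !subr0 -expr2 real_normK ?num_real //; apply => y hy.
rewrite -cos0; have := @lipschitz_of_derive R (cos : R -> R) (fun x => - sin x) 1 0 y.
rewrite mul1r subr0 => /(_ _ _)/le_trans; apply.
  by move=> *; rewrite normrN sin_max.
exact: norm_le_between0.
Qed.

Lemma modc_cexpB1B_le d : modc (cexp d - 1 - d) <= 4 * modc d ^+ 2 * expR (modc d).
Proof.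
case: d => a b; set d := a +i* b.
have ha : `|a| <= modc d := Re_le_modc d.
have hb : `|b| <= modc d := Im_le_modc d.
have m0 := modc_ge0 d.
have e1 : expR `|a| <= expR (modc d) by rewrite ler_expR.
have e2 : expR a <= expR (modc d) by rewrite ler_expR (le_trans (ler_norm _)).
have a2 : a ^+ 2 <= modc d ^+ 2 by rewrite -(real_normK (num_real a)) lerXn2r ?nnegrE.
have b2 : b ^+ 2 <= modc d ^+ 2 by rewrite -(real_normK (num_real b)) lerXn2r ?nnegrE.
(* With d = a + i b, each of the three terms is of second order; they contribute 1, 2 and 1 to the
   constant 4. *)
have -> : cexp d - 1 - d = (expR a - 1 - a)%:C
  + (expR a)%:C * ((cos b - 1) +i* (sin b - b)) + (0 +i* (b * (expR a - 1))).
  by rewrite /cexp /d; apply: complex_ext => /=; ring.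
rewrite (le_trans (modcD _ _)) //.
have -> : 4 * modc d ^+ 2 * expR (modc d) = (modc d ^+ 2 * expR (modc d)
  + (expR (modc d) * (modc d ^+ 2 + modc d ^+ 2))) + modc d * (modc d * expR (modc d)) by ring.
apply: lerD; first apply: (le_trans (modcD _ _)); first apply: lerD.
- by rewrite modcR (le_trans (norm_expRB1B_le _)) // ler_pM ?sqr_ge0 ?expR_ge0.
- rewrite modcM modcR ger0_norm ?expR_ge0 // ler_pM ?expR_ge0 ?modc_ge0 //.
  rewrite (le_trans (modc_le_ReIm _ _)) // lerD //.
    exact: le_trans (norm_cosB1_le _) _.
  exact: le_trans (norm_sinB_le _) _.
- rewrite modcE expr0n add0r sqrtr_sqr normrM ler_pM //.
  by rewrite (le_trans (norm_expRB1_le _)) // ler_pM ?expR_ge0.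
Qed.

Lemma norm_expn_sub_le z w n (M : R) : modc z <= M -> modc w <= M ->
  modc (z ^+ n.+1 - w ^+ n.+1) <= n.+1%:R * M ^+ n * modc (z - w).
Proof.
move=> zM wM; have M0 : 0 <= M := le_trans (modc_ge0 z) zM.
elim: n => [|n IH]; first by rewrite !expr1 expr0 !mul1r.
have -> : z ^+ n.+2 - w ^+ n.+2 = z * (z ^+ n.+1 - w ^+ n.+1) + (z - w) * w ^+ n.+1.
  by rewrite !(exprS _ n.+1); ring.
rewrite (le_trans (modcD _ _)) // !modcM.
have -> : n.+2%:R * M ^+ n.+1 * modc (z - w) = M * (n.+1%:R * M ^+ n * modc (z - w))
  + modc (z - w) * M ^+ n.+1.
  by rewrite exprS -(natr1 n.+1); ring.
apply: lerD; first by rewrite ler_pM ?modc_ge0.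
by rewrite ler_wpM2l ?modc_ge0 // modcX lerXn2r ?nnegrE ?modc_ge0.
Qed.

Lemma cexpX z n : cexp z ^+ n = cexp (n%:R * z).
Proof.
elim: n => [|n IH]; first by rewrite mul0r cexp0.
by rewrite exprS IH -cexpD -natr1 mulrDl mul1r addrC.
Qed.

(** With y = z / (n + 1), both 1 + y and e^y have modulus at most e^(M / (n + 1)) and differ by O(1
    / (n + 1)^2). Passing to the power n + 1 costs only a factor (n + 1) e^M. *)
Lemma cexp_compound z n (M : R) : modc z <= M ->
  modc ((1 + n.+1%:R^-1 * z) ^+ n.+1 - cexp z) <= 4 * M ^+ 2 * expR (2 * M) / n.+1%:R.
Proof.
move=> zM; have M0 : 0 <= M := le_trans (modc_ge0 z) zM.
pose y : C := n.+1%:R^-1 * z.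
have n0 : 0 < n.+1%:R :> R by [].
have yM : modc y <= M / n.+1%:R.
  by rewrite /y modcM modcV modc_nat mulrC ler_wpM2r // invr_ge0.
have -> : cexp z = cexp y ^+ n.+1 by rewrite cexpX mulrA divff ?mul1r ?pnatr_eq0.
pose E := expR (M / n.+1%:R).
have E1 : 1 <= E by rewrite -expR0 ler_expR divr_ge0.
have b1 : modc (1 + y) <= E.
  rewrite (le_trans (modcD _ _)) // modc1 (le_trans _ (expR_ge1Dx _)) //.
  by rewrite lerD2l.
have b2 : modc (cexp y) <= E by rewrite (le_trans (modc_cexp_le _)) // ler_expR.
rewrite (le_trans (norm_expn_sub_le _ b1 b2)) //.
have En : E ^+ n <= expR M.
  rewrite (@le_trans _ _ (E ^+ n.+1)) // ?ler_weXn2l //.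
  by rewrite /E -expRM_natl mulrCA divff ?mulr1 ?pnatr_eq0.
have b3 : modc (1 + y - cexp y) <= 4 * (M / n.+1%:R) ^+ 2 * expR M.
  rewrite modcB opprD addrA (le_trans (modc_cexpB1B_le _)) //.
  have h : modc y <= M / n.+1%:R by [].
  rewrite -mulrA -[leRHS]mulrA ler_wpM2l // ler_pM ?sqr_ge0 ?expR_ge0 //.
    by rewrite lerXn2r ?nnegrE ?modc_ge0 // divr_ge0.
  by rewrite ler_expR (le_trans h) // ler_pdivrMr // ler_peMr // ler1n.
apply: (@le_trans _ _ (n.+1%:R * expR M * (4 * (M / n.+1%:R) ^+ 2 * expR M))).
  apply: ler_pM; rewrite ?modc_ge0 //; first by rewrite mulr_ge0 // exprn_ge0 // expR_ge0.
  by rewrite ler_wpM2l.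
have -> : expR (2 * M) = expR M * expR M by rewrite -expRD; congr expR; ring.
by rewrite le_eqVlt; apply/orP; left; apply/eqP; move: n0; move: (n.+1%:R : R) => k k0; field; lra.
Qed.

End ComplexExp.

Section ComplexLog.
Variable R : realType.
Local Notation C := R[i].
Local Open Scope complex_scope.
Implicit Types (z w : C) (x y : R).

(* [slit z] vanishes exactly on the cut [z <= 0] of [clog], and is the
   denominator in the half-angle formula defining it. *)
Definition slit z : R := modc z + complex.Re z.

Lemma slit_ge0 z : 0 <= slit z.
Proof. by have := Re_le_modc z; rewrite ler_norml /slit => /andP[]; lra. Qed.

Lemma slit_modc_gt0 z : 0 < slit z -> 0 < modc z.
Proof. by have := Re_le_modc z; rewrite ler_norml /slit => /andP[]; lra. Qed.

Lemma slit_le z : slit z <= 2 * modc z.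
Proof. by have := Re_le_modc z; rewrite ler_norml /slit => /andP[]; lra. Qed.

Lemma clogE z : clog z =
  ln (modc z) +i* (2 * atan (complex.Im z / slit z)).
Proof. by []. Qed.

Lemma clog1 : clog 1 = 0 :> C.
Proof. by rewrite clogE modc1 ln1 /= mul0r atan0 mulr0. Qed.

Lemma cos2_atan x : cos (atan x) ^+ 2 = (1 + x ^+ 2)^-1.
Proof. by rewrite cos_atan exprVn sqr_sqrtr // addr_ge0 ?sqr_ge0. Qed.

Lemma sin_atan_cos x : sin (atan x) = x * cos (atan x).
Proof.
have h : cos (atan x) != 0.
  rewrite -sqrf_eq0 cos2_atan invr_eq0 gt_eqF // ltr_pwDl ?sqr_ge0 //.
by rewrite -{2}(atanK x) /tan -mulrA mulVf ?mulr1.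
Qed.

Lemma cexp_clog z : 0 < slit z -> cexp (clog z) = z.
Proof.
move=> s0; have m0 := slit_modc_gt0 s0; have := modc_sqr z.
rewrite clogE /cexp /= lnK //; set q := _ / _.
have -> : 2 * atan q = atan q *+ 2 by rewrite mulr_natl.
rewrite cos_mulr2n sin_mulr2n sin_atan_cos.
have -> : cos (atan q) * (q * cos (atan q)) *+ 2 = 2 * q * cos (atan q) ^+ 2.
  by rewrite -mulr_natl; ring.
rewrite cos2_atan; move: s0 m0; rewrite {}/q /slit.
move: (modc z) => r; case: z => x y /= s0 m0 e.
(* This is 1 + tan^2 of the half angle; it follows from (r + x)^2 + y^2 = 2 r (r + x). *)
have e2 : 1 + (y / (r + x)) ^+ 2 = 2 * r / (r + x).
  rewrite -[LHS]/(1 + (y / (r + x)) ^+ 2).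
  have -> : 2 * r / (r + x) = (2 * r * (r + x)) / (r + x) ^+ 2 by field; lra.
  have -> : 2 * r * (r + x) = (r + x) ^+ 2 + y ^+ 2 by rewrite mulrDr; nra.
  by field; lra.
rewrite e2; apply: complex_ext => /=.
  by rewrite mul0r subr0 -mulr_natl; field; lra.
by rewrite mul0r addr0; field; lra.
Qed.

Lemma ln_lip x y (c : R) : 0 < c -> c <= x -> c <= y -> `|ln x - ln y| <= `|x - y| / c.
Proof.
move=> c0; wlog : x y / y <= x => [hw cx cy|yx cx cy].
  have [/hw|/ltW /hw h] := leP y x; first exact.
  by rewrite distrC (distrC x); apply: h.
have y0 : 0 < y by lra.
have x0 : 0 < x by lra.
rewrite ger0_norm ?subr_ge0 ?ler_ln ?posrE // ger0_norm ?subr_ge0 //.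
rewrite -ln_div ?posrE //.
have -> : x / y = 1 + (x - y) / y by field; lra.
rewrite (le_trans (le_ln1Dx _)) //.
  by rewrite (@lt_le_trans _ _ 0) // divr_ge0 ?subr_ge0 // ltW.
by rewrite ler_wpM2l ?subr_ge0 // lef_pV2.
Qed.

Lemma atan_lip x y : `|atan x - atan y| <= `|x - y|.
Proof.
have := @lipschitz_of_derive R (atan : R -> R) (fun x => (1 + x ^+ 2)^-1) 1 y x.
rewrite mul1r; apply => // z _.
have : 1 <= 1 + z ^+ 2 by rewrite lerDl sqr_ge0.
by move=> h; rewrite ger0_norm ?invr_ge0 ?invf_le1; lra.
Qed.

Lemma slit_lip z w : `|slit z - slit w| <= 2 * modc (z - w).
Proof.
have hR : `|complex.Re z - complex.Re w| <= modc (z - w).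
  by have := Re_le_modc (z - w); case: (z); case: (w).
have -> : slit z - slit w = (modc z - modc w) + (complex.Re z - complex.Re w).
  by rewrite /slit; ring.
by rewrite (le_trans (ler_normD _ _)) // mulr2n mulrDl mul1r lerD // modc_lip.
Qed.

(** As [slit] is at most twice the modulus, the moduli are at least c / 2, whence 2 / c for the real
    part. The other terms come from twice the quotient [Im / slit], [atan] being 1-Lipschitz. *)
Lemma clog_lip z w (c M : R) : 0 < c -> c <= slit z -> c <= slit w -> modc z <= M -> modc w <= M ->
  modc (clog z - clog w) <= (2 / c + (2 / c + 4 * M / c ^+ 2)) * modc (z - w).
Proof.
move=> c0 sz sw zM wM; rewrite !clogE.
have -> : forall a b e f : R, (a +i* b) - (e +i* f) = (a - e) +i* (b - f) by [].
have dz := slit_le z; have dw := slit_le w.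
rewrite (le_trans (modc_le_ReIm _ _)) // [leRHS]mulrDl lerD //.
  rewrite (le_trans (@ln_lip _ _ (c / 2) _ _ _)) //; try lra.
  rewrite invf_div mulrC ler_wpM2l ?divr_ge0 //; last exact: modc_lip.
  exact: ltW.
rewrite -mulrBr normrM ger0_norm // (le_trans (ler_wpM2l _ (atan_lip _ _))) //.
set m := modc (z - w).
have hI : `|complex.Im z - complex.Im w| <= m.
  by have := Im_le_modc (z - w); rewrite /m; case: (z); case: (w).
have s : `|slit z - slit w| <= 2 * m := slit_lip z w; have hi := Im_le_modc z.
have -> : complex.Im z / slit z - complex.Im w / slit w =
  (complex.Im z - complex.Im w) / slit w - complex.Im z * (slit z - slit w) / (slit z * slit w).
  by field; lra.
have -> : (2 / c + 4 * M / c ^+ 2) * m = 2 * (m / c + M * (2 * m) / (c * c)) by field; lra.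
rewrite ler_wpM2l // (le_trans (ler_normB _ _)) // lerD //.
  rewrite normrM ler_pM // normfV ger0_norm ?slit_ge0 // lef_pV2 ?posrE //; lra.
rewrite !normrM ler_pM ?mulr_ge0 //.
  by rewrite ler_pM // (le_trans hi).
rewrite normfV normrM !ger0_norm ?slit_ge0 // lef_pV2 ?posrE ?mulr_gt0 //; try lra.
by rewrite ler_pM // ltW.
Qed.

(** The logarithm is not differentiated: for d = log w - log z one has (w - z) / z = e^d - 1, so the
    remainder is that of the exponential at d, and d = O(w - z) by [clog_lip]. *)
Lemma clog_taylor (c M : R) : 0 < c -> exists K, forall z w,
  c <= slit z -> c <= slit w -> modc z <= M -> modc w <= M ->
  modc (clog w - clog z - (w - z) / z) <= K * modc (w - z) ^+ 2.
Proof.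
move=> c0; set L := 2 / c + (2 / c + 4 * M / c ^+ 2).
exists (4 * L ^+ 2 * expR (L * (2 * M))) => z w sz sw zM wM.
have M0 : 0 <= M := le_trans (modc_ge0 z) zM.
have L0 : 0 <= L.
  have c1 := ltW c0; by rewrite !addr_ge0 ?divr_ge0 ?mulr_ge0 ?sqr_ge0.
have hd := clog_lip c0 sw sz wM zM; set d := clog w - clog z in hd *.
have z0 : z != 0 by apply: contraTneq (sz) => ->; rewrite /slit modc0 /= addr0 -ltNge.
have e : (w - z) / z = cexp d - 1.
  have -> : w = cexp d * z.
    by rewrite -[X in _ * X]cexp_clog -?cexpD ?subrK ?cexp_clog //; lra.
  by field.
have -> : d - (w - z) / z = - (cexp d - 1 - d) by rewrite e; ring.
rewrite modcN (le_trans (modc_cexpB1B_le _)) //.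
have hd2 : modc d <= L * (2 * M).
  rewrite (le_trans hd) // ler_wpM2l // (le_trans (modcD _ _)) // modcN; lra.
rewrite [leRHS]mulrAC -[4 * L ^+ 2 * _]mulrA -exprMn.
apply: ler_pM; rewrite ?expR_ge0 ?ler_expR ?mulr_ge0 ?modc_ge0 //.
by rewrite ler_wpM2l // lerXn2r ?nnegrE ?modc_ge0 ?mulr_ge0 ?modc_ge0.
Qed.

End ComplexLog.

Section Derivability.
Variable R : realType.
Local Notation C := R[i].
Local Open Scope complex_scope.
Implicit Types (z w : C) (f : C -> C).

Lemma posC_real (e : C) : 0 < e -> exists2 r : R, 0 < r & e = r%:C.
Proof.
case: e => a b; rewrite ltcE /= => /andP[/eqP b0 a0].
by exists a => //; rewrite b0.
Qed.

Lemma nbhsC_modc z (P : set C) : nbhs z P <->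
  exists2 e : R, 0 < e & forall w, modc (w - z) < e -> P w.
Proof.
split=> [/nbhs_ballP[e /= e0 eP]|[e e0 eP]].
  have [r r0 er] := posC_real e0; exists r => // w wz; apply: eP.
  by rewrite -ball_normE /= er normc_modc ltcR modcB.
apply/nbhs_ballP; exists e%:C => /=; first by rewrite ltcR.
by move=> w; rewrite -ball_normE /= normc_modc ltcR modcB => /eP.
Qed.

Lemma derivable_taylor f z (d : C) (e K : R) : 0 < e ->
  (forall w, modc (w - z) < e ->
     modc (f w - f z - (w - z) * d) <= K * modc (w - z) ^+ 2) ->
  derivable f z 1.
Proof.
move=> e0 fK; apply/cvg_ex; exists d; apply/cvgrPdist_lt => _ /posC_real[r r0 ->].
near=> h.
have h0 : h != 0 by near: h; exact: nbhs_dnbhs_neq.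
have hr : modc h < Num.min e (r / (`|K| + 1)).
  rewrite -ltcR -normc_modc; near: h; apply: dnbhs0_lt.
  by rewrite ltcR lt_min e0 divr_gt0.
move: hr; rewrite lt_min => /andP[he hr].
rewrite normc_modc ltcR.
have -> : d - h^-1 *: (f (h *: 1 + z) - f z) = - (h^-1 * (f (h + z) - f z - (h + z - z) * d)).
  rewrite addrK; have -> : h *: (1 : C) = h by exact: mulr1.
  by rewrite -[h^-1 *: _]/(h^-1 * _); field.
rewrite modcN modcM modcV.
have m0 : 0 < modc h by exact: modc_gt0.
have := fK (h + z); rewrite addrK => /(_ he) fh.
rewrite mulrC ltr_pdivrMr // (le_lt_trans fh) //.
rewrite expr2 mulrA ltr_pM2r //.
rewrite ltr_pdivlMr // in hr.
rewrite (le_lt_trans _ hr) // mulrC; apply: ler_wpM2l; first exact: ltW.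
by rewrite (le_trans (ler_norm _)) // lerDl.
Unshelve. all: by end_near.
Qed.

Lemma derivable_modc f z : derivable f z 1 -> forall e : R, 0 < e ->
  exists2 d : R, 0 < d & forall w, modc (w - z) < d -> modc (f w - f z) < e.
Proof.
move=> /derivable1_diffP/differentiable_continuous fz e e0.
have /cvgrPdist_lt/(_ e%:C) := fz; rewrite ltcR => /(_ e0)/nbhsC_modc[d d0 dP].
by exists d => // w /dP; rewrite normc_modc ltcR modcB.
Qed.

Lemma derivable_cexp z : derivable (@cexp R) z 1.
Proof.
apply: (@derivable_taylor _ _ (cexp z) 1 (modc (cexp z) * (4 * expR 1))) => // w w1.
have -> : cexp w - cexp z - (w - z) * cexp z = cexp z * (cexp (w - z) - 1 - (w - z)).
  have -> : cexp w = cexp (w - z) * cexp z by rewrite -cexpD subrK.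
  by ring.
rewrite modcM -mulrA ler_wpM2l ?modc_ge0 // (le_trans (modc_cexpB1B_le _)) //.
by rewrite mulrAC ler_wpM2r ?sqr_ge0 // ler_wpM2l // ler_expR ltW.
Qed.

Lemma derivable_clog z : 0 < complex.Re z -> derivable (@clog R) z 1.
Proof.
move=> z0; have m := Re_le_modc z.
have [K hK] := @clog_taylor R (complex.Re z / 2) (2 * modc z) ltac:(lra).
have zm : complex.Re z <= modc z by rewrite (le_trans (ler_norm _)).
apply: (@derivable_taylor _ _ z^-1 (complex.Re z / 2) K) => [|w wz]; first lra.
have := Re_le_modc (w - z); have -> : complex.Re (w - z) = complex.Re w - complex.Re z.
  by case: (w); case: (z).
rewrite ler_norml => /andP[h1 h2].
have h3 := modc_lip w z; rewrite ler_norml in h3; have /andP[h4 h5] := h3.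
have := modc_ge0 w.
by move=> w0; apply: hK; rewrite /slit; lra.
Qed.

(* Hence a set on which [clog] is holomorphic in the sense of [is_hfc] avoids the
   cut. *)
Lemma slit_derivable_clog z : derivable (@clog R) z 1 -> 0 < slit z.
Proof.
move=> /derivable_modc/(_ 1 ltr01)[d d0 dP].
rewrite lt_def slit_ge0 andbT; apply: contraPneq dP => s0 dP.
have mz : modc z = - complex.Re z by apply/eqP; rewrite -addr_eq0 -s0.
have iz : complex.Im z = 0.
  have := modc_sqr z; rewrite mz sqrrN => /eqP.
  by rewrite addrC -subr_eq subrr eq_sym sqrf_eq0 => /eqP.
(* At 0, [ln] varies by 3 between d / 2 and e^-3 d / 2, whereas both values should lie within 1 of
   the value at 0. *)
have [r0|r0] := eqVneq (modc z) 0.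
  have z0 : z = 0 by exact: modc_eq0.
  have h t : 0 < t -> t < d -> `|ln t - ln 0| < 1.
    move=> t0 td; have := dP t%:C; rewrite z0 subr0 modcR gtr0_norm // => /(_ td).
    rewrite !clogE modcR modc0 gtr0_norm // => /(le_lt_trans (Re_le_modc _)).
    by rewrite /=.
  have h1 := h (d / 2) ltac:(lra) ltac:(lra).
  have e3 : expR (-3) < 1 :> R by rewrite expR_lt1; lra.
  have e30 := expR_gt0 (-3 : R).
  have h2 := h (d / 2 * expR (-3)) ltac:(nra) ltac:(nra).
  rewrite lnM ?posrE // ?divr_gt0 // expRK in h2.
  move: h1 h2; rewrite !ltr_norml => /andP[? ?] /andP[? ?]; lra.
have r1 : 0 < modc z by rewrite lt_def r0 modc_ge0.
(* The point w = - |z| + i s lies just above the cut. As s <= |w| + |z|, |w| - |z| = s^2 / (|w| +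
   |z|) <= s, so the half angle at w is at least pi / 4. The argument thus jumps by at least pi / 2
   >= 1 from its value 0 at z. *)
pose s := Num.min (d / 2) (modc z).
have s1 : 0 < s by rewrite /s lt_min r1 andbT; lra.
have sd : s <= d / 2 by rewrite /s ge_min lexx.
have sr : s <= modc z by rewrite /s ge_min lexx orbT.
pose w : C := - modc z +i* s.
have := dP w.
have -> : w - z = 0 +i* s.
  have ez : z = - modc z +i* 0 by rewrite mz opprK; case: (z) iz => x y /= ->.
  rewrite {1}ez /w; apply/eqP; rewrite eq_complex /=.
  by rewrite subrr subr0 !eqxx.
rewrite modcE expr0n add0r sqrtr_sqr gtr0_norm //.
move=> /(_ ltac:(lra)) /(le_lt_trans (Im_le_modc _)).
rewrite !clogE iz mul0r atan0 mulr0 /= subr0.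
have := modc_sqr w; rewrite /slit /= => m2.
have mw : modc z < modc w.
  rewrite -(ltr_pXn2r (ltn0Sn 1)) ?nnegrE ?modc_ge0 // m2 sqrrN ltrDl.
  by rewrite exprn_gt0.
have q1 : 1 <= s / (modc w - modc z).
  rewrite ler_pdivlMr ?mul1r ?subr_gt0 // -(ler_pM2r (_ : 0 < modc w + modc z)); last lra.
  by rewrite -subr_sqr m2 sqrrN addrAC subrr add0r expr2 ler_wpM2l ?ltW //; lra.
have := @le_atan R _ _ q1; rewrite atan1 => a1.
have := pi_ge2 R => p2; rewrite ltr_norml => /andP[_]; lra.
Qed.

End Derivability.

(** * Norms and limits *)

Section NormedSequences.
Variable R : realType.
Local Notation C := R[i].
Local Open Scope complex_scope.

Definition rnorm (V : normedModType C) (x : V) : R := complex.Re `|x|.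

Lemma norm_rnorm (V : normedModType C) (x : V) : `|x| = (rnorm x)%:C.
Proof. by rewrite RRe_real // realE normr_ge0. Qed.

Lemma cvgn_rnormP (V : normedModType C) (u : nat -> V) v :
  u @ \oo --> v <-> forall e : R, 0 < e ->
    exists N, forall n, (N <= n)%N -> rnorm (u n - v) <= e.
Proof.
split=> [/cvgrPdist_le uv e e0|uv].
  have /uv[N _ NP] : 0 < e%:C by rewrite ltcR.
  by exists N => n /NP /=; rewrite distrC norm_rnorm lecR.
apply/cvgrPdist_le => _ /posC_real[e e0 ->].
have [N NP] := uv e e0; exists N => // n /NP /=.
by rewrite distrC norm_rnorm lecR.
Qed.

Lemma cauchyn_rnormP (V : completeNormedModType C) (u : nat -> V) :
  (forall e : R, 0 < e -> exists N, forall m n, (N <= m)%N -> (N <= n)%N ->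
     rnorm (u m - u n) <= e) ->
  exists v : V, u @ \oo --> v.
Proof.
move=> uC; suff /cvg_ex : [cvg (u @ \oo) in V] by [].
apply: cauchy_cvg; apply/cauchy_ballP => _ /posC_real[e e0 ->].
have [|N NP] := uC (e / 2); first by rewrite divr_gt0.
pose T := [set x | exists2 n, (N <= n)%N & x = u n].
exists (T, T) => /=; first by split; exists N => // n Nn; exists n.
move=> [_ _] /= [/= [m Nm ->] [n Nn ->]]; rewrite -ball_normE /= norm_rnorm ltcR.
by rewrite (le_lt_trans (NP _ _ Nm Nn)) // ltr_pdivrMr // ltr_pMr // ltr1n.
Qed.

End NormedSequences.

(* [topAlgType] has no continuity axiom: all that is used of a topology is that it
   is that of a complete submultiplicative real norm, not normalized at [1]. *)
Record bnorm (R : realType) (B : topAlgType R[i]) := BNorm {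
  nrm :> B -> R;
  nrmD : forall x y, nrm (x + y) <= nrm x + nrm y;
  nrmZ : forall (c : R[i]) x, nrm (c *: x) = modc c * nrm x;
  nrmM : forall x y, nrm (x * y) <= nrm x * nrm y;
  nrm_eq0 : forall x, nrm x = 0 -> x = 0;
  nrm_cvgP : forall (u : nat -> B) v, u @ \oo --> v <->
    forall e : R, 0 < e -> exists N, forall n, (N <= n)%N -> nrm (u n - v) <= e;
  nrm_complete : forall u : nat -> B,
    (forall e : R, 0 < e -> exists N, forall m n, (N <= m)%N -> (N <= n)%N ->
       nrm (u m - u n) <= e) -> exists v : B, u @ \oo --> v
}.

Section BNormInstances.
Variables (R : realType).
Local Notation C := R[i].
Local Open Scope complex_scope.

Lemma modc_complete (u : nat -> C) :
  (forall e : R, 0 < e -> exists N, forall m n, (N <= m)%N -> (N <= n)%N ->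
     modc (u m - u n) <= e) -> exists v : C, u @ \oo --> v.
Proof.
move=> uC.
have cv (f : C -> R) : (forall z w, `|f z - f w| <= modc (z - w)) ->
    exists l : R, forall e, 0 < e -> exists N, forall n, (N <= n)%N -> `|f (u n) - l| <= e.
  move=> fl; suff /cvg_ex[l ul] : cvg (f (u n) @[n --> \oo]).
    exists l => e e0; have [N _ NP] := (cvgrPdist_le _ _).1 ul e e0.
    by exists N => n /NP /=; rewrite distrC.
  apply: R_complete; apply/cauchy_ballP => e e0.
  have [|N NP] := uC (e / 2); first by rewrite divr_gt0.
  pose T := [set x | exists2 n, (N <= n)%N & x = f (u n)].
  exists (T, T) => /=; first by split; exists N => // n Nn; exists n.
  move=> [_ _] /= [/= [m Nm ->] [n Nn ->]]; rewrite -ball_normE /=.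
  by rewrite (le_lt_trans (fl _ _)) // (le_lt_trans (NP _ _ Nm Nn)) // ltr_pdivrMr //
    ltr_pMr // ltr1n.
have [z w|a ua] := cv (@complex.Re R).
  by apply: le_trans (Re_le_modc _); case: z; case: w.
have [z w|b ub] := cv (@complex.Im R).
  by apply: le_trans (Im_le_modc _); case: z; case: w.
exists (a +i* b); apply/cvgn_rnormP => e e0.
have [|M MP] := ua (e / 2); first by rewrite divr_gt0.
have [|N NP] := ub (e / 2); first by rewrite divr_gt0.
exists (maxn M N) => n; rewrite geq_max => /andP[/MP + /NP].
move: (u n) => [x y] /= xa yb.
rewrite -[rnorm _]/(modc ((x - a) +i* (y - b))) (le_trans (modc_le_ReIm _ _)) //; lra.
Qed.

Definition modc_bnorm : bnorm C.
Proof.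
apply: (@BNorm R C (@modc R)).
- exact: modcD.
- exact: modcM.
- by move=> x y; rewrite modcM.
- exact: modc_eq0.
- exact: (@cvgn_rnormP R C).
- exact: modc_complete.
Defined.

Variable A : cstarAlg R.
Implicit Types x y : A.

Definition anorm x : R := @rnorm R (cstar_space A) x.

Lemma anorm_ge0 x : 0 <= anorm x.
Proof. by rewrite -lecR -norm_rnorm normr_ge0. Qed.

Lemma anormD x y : anorm (x + y) <= anorm x + anorm y.
Proof.
by have := ler_normD (x : cstar_space A) y;
  rewrite !(@norm_rnorm R (cstar_space A)) -rmorphD lecR. Qed.

Lemma anormZ (c : C) x : anorm (c *: x) = modc c * anorm x.
Proof.
apply: (@complexI R); rewrite rmorphM /= -normc_modc.
by rewrite -!(@norm_rnorm R (cstar_space A)) -normrZ.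
Qed.

Lemma anormM x y : anorm (x * y) <= anorm x * anorm y.
Proof.
by have := cstar_normM (x : cstar_space A) y;
  rewrite !(@norm_rnorm R (cstar_space A)) -rmorphM lecR.
Qed.

Lemma anorm_eq0 x : anorm x = 0 -> x = 0.
Proof. by move=> h; apply/normr0_eq0; rewrite (@norm_rnorm R (cstar_space A)) -/(anorm x) h. Qed.

Lemma anorm_star x : anorm (star x * x) = anorm x ^+ 2.
Proof.
apply: (@complexI R); rewrite rmorphXn /= -!(@norm_rnorm R (cstar_space A)).
exact: cstar_normC.
Qed.

Definition anorm_bnorm : bnorm A.
Proof.
apply: (@BNorm R A anorm).
- exact: anormD.
- exact: anormZ.
- exact: anormM.
- exact: anorm_eq0.
- exact: (@cvgn_rnormP R (cstar_space A)).
- exact: (@cauchyn_rnormP R (cstar_space A)).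
Defined.

Variable n : nat.
Local Notation M := (mxalg A n).

(** Not the C*-norm of the matrix algebra, but submultiplicative and inducing the entrywise
    topology. Its value at 1 is the size of the matrices, hence the factors [nu 1] in later
    bounds. *)
Definition mxnorm (a : M) : R := \sum_i \sum_j anorm (a i j).

Lemma mxnorm_entry (a : M) i j : anorm (a i j) <= mxnorm a.
Proof.
rewrite /mxnorm (bigD1 i) //= (bigD1 j) //= -addrA lerDl addr_ge0 //.
  by rewrite sumr_ge0 // => *; exact: anorm_ge0.
by rewrite sumr_ge0 // => *; rewrite sumr_ge0 // => *; exact: anorm_ge0.
Qed.

Lemma anorm_sum I (r : seq I) (P : pred I) (F : I -> A) :
  anorm (\sum_(i <- r | P i) F i) <= \sum_(i <- r | P i) anorm (F i).
Proof.
elim/big_ind2: _ => // [|a b c d ac bd]; first by rewrite /anorm /rnorm normr0.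
by rewrite (le_trans (anormD _ _)) // lerD.
Qed.

Lemma mxnormM (a b : M) : mxnorm (a * b) <= mxnorm a * mxnorm b.
Proof.
rewrite /mxnorm mulr_suml; apply: ler_sum => i _.
apply: (@le_trans _ _ (\sum_j \sum_k anorm (a i k) * anorm (b k j))).
  apply: ler_sum => j _; rewrite !mxE (le_trans (anorm_sum _ _ _)) //.
  by apply: ler_sum => k _; exact: anormM.
rewrite exchange_big /= mulr_suml; apply: ler_sum => k _.
rewrite -mulr_sumr ler_wpM2l ?anorm_ge0 //.
rewrite [leRHS](bigD1 k) //= lerDl sumr_ge0 // => *.
by rewrite sumr_ge0 // => *; exact: anorm_ge0.
Qed.

Lemma mx_cvgP (u : nat -> M) (v : M) : u @ \oo --> v <->
  forall i j, (fun k => u k i j : cstar_space A) @ \oo --> (v i j : cstar_space A).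
Proof.
split=> [uv i j|uv].
  apply/cvg_entourageP => E entE.
  have H := (@cvg_mx_entourageP (cstar_space A) _ _ (u x @[x --> \oo]) _ v).1 uv E entE.
  have H2 : \forall k \near \oo, forall i j, (v i j, u k i j) \in E by exact: H.
  suff H3 : \forall k \near \oo, E (v i j, u k i j) by exact: H3.
  by apply: filterS H2 => k /(_ i j); rewrite inE.
apply/(@cvg_mx_entourageP (cstar_space A) _ _ (u x @[x --> \oo]) _ v) => E entE.
have h i j : \forall k \near \oo, E (v i j, u k i j).
  by have /(_ _ E entE) := (cvg_entourageP _ _).1 (uv i j).
have h2 : \forall k \near \oo, forall p : 'I_n.+1 * 'I_n.+1, E (v p.1 p.2, u k p.1 p.2).
  by apply: filter_forall => -[i j]; exact: h.
suff H3 : \forall k \near \oo, forall i j, (v i j, u k i j) \in E by exact: H3.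
by apply: filterS h2 => k h2 i j; rewrite inE; exact: (h2 (i, j)).
Qed.

Lemma mxnormD (a b : M) : mxnorm (a + b) <= mxnorm a + mxnorm b.
Proof.
rewrite /mxnorm -big_split; apply: ler_sum => i _.
by rewrite -big_split; apply: ler_sum => j _; rewrite mxE anormD.
Qed.

Lemma mxnormZ (c : C) (a : M) : mxnorm (c *: a) = modc c * mxnorm a.
Proof.
rewrite /mxnorm mulr_sumr; apply: eq_bigr => i _.
by rewrite mulr_sumr; apply: eq_bigr => j _; rewrite mxE anormZ.
Qed.

Lemma mxnorm_eq0 (a : M) : mxnorm a = 0 -> a = 0.
Proof.
move=> a0; apply/matrixP => i j; rewrite mxE; apply: anorm_eq0.
by apply/eqP; rewrite eq_le anorm_ge0 andbT -a0 mxnorm_entry.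
Qed.

Lemma mxnorm_cvgP (u : nat -> M) (v : M) : u @ \oo --> v <->
  forall e : R, 0 < e -> exists N, forall k, (N <= k)%N -> mxnorm (u k - v) <= e.
Proof.
rewrite mx_cvgP; split=> [uv e e0|uv i j].
  have d0 : 0 < e / (n.+1 * n.+1)%:R by rewrite divr_gt0.
  have /choice[N NP] : forall p : 'I_n.+1 * 'I_n.+1, exists N, forall k,
      (N <= k)%N -> anorm (u k p.1 p.2 - v p.1 p.2) <= e / (n.+1 * n.+1)%:R.
    by move=> p; have /cvgn_rnormP/(_ _ d0) := uv p.1 p.2.
  exists (\max_p N p)%N => k Nk.
  have -> : e = \sum_(i < n.+1) \sum_(j < n.+1) (e / (n.+1 * n.+1)%:R).
    by rewrite !sumr_const !card_ord -mulrnA -[RHS]mulr_natr divfK //.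
  apply: ler_sum => i _; apply: ler_sum => j _; rewrite !mxE.
  apply: (NP (i, j)); rewrite (leq_trans _ Nk) //.
  exact: (@leq_bigmax _ N (i, j)).
apply/(@cvgn_rnormP R (cstar_space A)) => e /uv[N NP]; exists N => k /NP.
by apply: le_trans; rewrite (le_trans _ (mxnorm_entry _ i j)) // !mxE.
Qed.

Lemma mxnorm_complete (u : nat -> M) :
  (forall e : R, 0 < e -> exists N, forall k l, (N <= k)%N -> (N <= l)%N ->
     mxnorm (u k - u l) <= e) -> exists v : M, u @ \oo --> v.
Proof.
move=> uC.
have /choice[v vP] : forall p : 'I_n.+1 * 'I_n.+1, exists v : A,
    (fun k => u k p.1 p.2 : cstar_space A) @ \oo --> (v : cstar_space A).
  move=> p; apply: (@cauchyn_rnormP R (cstar_space A)) => e /uC[N NP].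
  exists N => k l Nk Nl; rewrite (le_trans _ (NP _ _ Nk Nl)) //.
  by rewrite (le_trans _ (mxnorm_entry _ p.1 p.2)) // !mxE.
exists (\matrix_(i, j) v (i, j)); apply/mx_cvgP => i j; rewrite mxE.
exact: (vP (i, j)).
Qed.

Definition mxnorm_bnorm : bnorm M :=
  @BNorm R M mxnorm mxnormD mxnormZ mxnormM mxnorm_eq0 mxnorm_cvgP mxnorm_complete.

End BNormInstances.

Arguments mxnorm : simpl never.

Section BanachAlgebra.
Variables (R : realType) (B : topAlgType R[i]) (nu : bnorm B).
Implicit Types (x y b : B).

Lemma nu0 : nu 0 = 0.
Proof. by rewrite -(scale0r 0) nrmZ modc0 mul0r. Qed.

Lemma nuN x : nu (- x) = nu x.
Proof. by rewrite -scaleN1r nrmZ modcN modc1 mul1r. Qed.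

Lemma nuB x y : nu (x - y) = nu (y - x).
Proof. by rewrite -nuN opprB. Qed.

Lemma nu_ge0 x : 0 <= nu x.
Proof.
have := nrmD nu x (- x); rewrite nuN subrr nu0 -mulr2n.
by rewrite pmulrn_lge0.
Qed.

Lemma nu_subD x y z : nu (x - z) <= nu (x - y) + nu (y - z).
Proof. by rewrite (le_trans _ (nrmD _ _ _)) // addrA subrK. Qed.

Lemma nu_sum I (r : seq I) (P : pred I) (F : I -> B) :
  nu (\sum_(i <- r | P i) F i) <= \sum_(i <- r | P i) nu (F i).
Proof.
elim/big_ind2: _ => // [|a b c d ac bd]; first by rewrite nu0.
by rewrite (le_trans (nrmD _ _ _)) // lerD.
Qed.

(* With a speed of convergence [1/n], exchanging limits is a matter of
   inequalities. *)
Definition rate (u : nat -> B) v :=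
  exists K : R, forall n, nu (u n - v) <= K / n.+1%:R.

Lemma archi_inv (K e : R) : 0 < e -> exists N, forall n, (N <= n)%N -> K / n.+1%:R <= e.
Proof.
move=> e0; exists (Num.bound (K / e)) => n Nn.
rewrite ler_pdivrMr // -ler_pdivrMl // mulrC.
have [K0|K0] := leP (K / e) 0; first by rewrite (le_trans K0).
rewrite (le_trans (ltW (archi_boundP (ltW K0)))) // ler_nat.
by rewrite (leq_trans Nn).
Qed.

Lemma le0_of_rate (a K : R) : (forall n, a <= K / n.+1%:R) -> a <= 0.
Proof.
move=> aK; rewrite leNgt; apply/negP => a0.
have [N NP] := @archi_inv K (a / 2) ltac:(lra).
have := le_trans (aK N) (NP N (leqnn _)); lra.
Qed.

Lemma rate_cvg u v : rate u v -> u @ \oo --> v.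
Proof.
move=> [K uK]; apply/(nrm_cvgP nu) => e /(@archi_inv K)[N NP].
by exists N => n /NP; apply: le_trans.
Qed.

Lemma cvgB_unique (u : nat -> B) (v w : B) : u @ \oo --> v -> u @ \oo --> w -> v = w.
Proof.
move=> /(nrm_cvgP nu) uv /(nrm_cvgP nu) uw.
apply/eqP; rewrite -subr_eq0; apply/eqP; apply: (@nrm_eq0 _ _ nu).
apply/eqP; rewrite eq_le nu_ge0 andbT leNgt; apply/negP => h.
have [M MP] := uv (nu (v - w) / 3) ltac:(lra).
have [N NP] := uw (nu (v - w) / 3) ltac:(lra).
have := nu_subD v (u (maxn M N)) w; rewrite (nuB v (u _)).
have := MP _ (leq_maxl M N); have := NP _ (leq_maxr M N); lra.
Qed.

Lemma rate_unique u v w : rate u v -> rate u w -> v = w.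
Proof. by move=> /rate_cvg uv /rate_cvg uw; exact: cvgB_unique uv uw. Qed.

Lemma rate_complete (u : nat -> B) (K : R) :
  (forall m n, nu (u m - u n) <= K / m.+1%:R + K / n.+1%:R) ->
  exists v, rate u v.
Proof.
move=> uK; have [e e0|v uv] := @nrm_complete _ _ nu u.
  have [N NP] := @archi_inv K (e / 2) ltac:(lra).
  exists N => m n /NP hm /NP hn.
  by rewrite (le_trans (uK m n)) // [leRHS](splitr e) lerD.
exists v; exists K => m; rewrite -subr_le0.
(* Going through [u k] with k >= n and nu (u k - v) <= 1 / (n + 1), the excess over K / (m + 1) is
   at most (K + 1) / (n + 1). *)
apply: (@le0_of_rate _ (K + 1)) => n.
have n0 : 0 < n.+1%:R^-1 :> R by rewrite invr_gt0.
have [N NP] := (nrm_cvgP nu u v).1 uv n.+1%:R^-1 n0.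
pose k := maxn N n.
have hk : k.+1%:R^-1 <= n.+1%:R^-1 :> R.
  by rewrite lef_pV2 ?posrE // ler_nat ltnS leq_maxr.
have K0 : 0 <= K.
  have := le_trans (nu_ge0 _) (uK 0 0); rewrite divr1; lra.
have h1 : K / k.+1%:R <= K / n.+1%:R := ler_wpM2l K0 hk.
rewrite mulrDl mul1r lerBlDr (le_trans (nu_subD (u m) (u k) v)) //.
rewrite (le_trans (lerD (uK m k) (NP k (leq_maxl _ _)))) //.
move: h1; move: (K / m.+1%:R) (K / k.+1%:R) (K / n.+1%:R) (n.+1%:R^-1).
by move=> a b c d; lra.
Qed.

Lemma rate_const v : rate (fun=> v) v.
Proof. by exists 0 => n; rewrite subrr nu0 mul0r. Qed.

Lemma rateD u u' v v' : rate u v -> rate u' v' -> rate (fun n => u n + u' n) (v + v').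
Proof.
move=> [K uK] [K' uK']; exists (K + K') => n; rewrite opprD addrACA mulrDl.
by rewrite (le_trans (nrmD _ _ _)) // lerD.
Qed.

End BanachAlgebra.

Section Compactness.
Variable R : realType.
Local Notation C := R[i].

(** The common source of uniform constants, on contours, squares and paths. Requiring [P] to persist
    as M grows lets finitely many local constants be replaced by a larger one; lower bounds are
    encoded as M^-1. *)
Lemma compact_unif (g : R -> R -> C) (L : R) (P : R -> C -> Prop) :
  (forall s t s' t', 0 <= s <= 1 -> 0 <= t <= 1 -> 0 <= s' <= 1 -> 0 <= t' <= 1 ->
     modc (g s t - g s' t') <= L * (`|s - s'| + `|t - t'|)) ->
  (forall M M' z, P M z -> M <= M' -> P M' z) ->
  (forall s t, 0 <= s <= 1 -> 0 <= t <= 1 -> exists M, exists2 d : R, 0 < d &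
     forall w, modc (w - g s t) < d -> P M w) ->
  exists M, forall s t, 0 <= s <= 1 -> 0 <= t <= 1 -> P M (g s t).
Proof.
move=> gL Pmono Ploc.
have cpt : compact (`[0, 1]%classic `*` `[0, 1]%classic : set (R * R)).
  by apply: compact_setX; exact: segment_compact.
have /compact_near_coveringP/(_ R (pinfty_nbhs R)
  (fun M x => 0 <= x.1 <= 1 -> 0 <= x.2 <= 1 -> P M (g x.1 x.2))) := cpt.
case.
  move=> [s t] [/=]; rewrite !in_itv /= => s01 t01.
  have [M [d d0 dP]] := Ploc _ _ s01 t01.
  (* A displacement below e in both parameters moves [g] by less than d; adding 1 covers L = 0. *)
  pose e := d / (2 * (`|L| + 1)).
  have L0 := normr_ge0 L.
  have e0 : 0 < e by rewrite divr_gt0 //; lra.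
  exists (ball (s, t) e, [set M' | M < M']).
    by split; [exact: nbhsx_ballx | exists M; split => //; rewrite num_real].
  move=> [[s' t'] M'] [[/= bs bt] /= MM'] s1 t1.
  apply: Pmono (ltW MM'); apply: dP.
  rewrite (le_lt_trans (gL _ _ _ _ s1 t1 s01 t01)) //.
  rewrite -ball_normE /= distrC in bs; rewrite -ball_normE /= distrC in bt.
  have ee : d = (`|L| + 1) * (e + e) by rewrite /e; field; lra.
  rewrite ee (@le_lt_trans _ _ ((`|L| + 1) * (`|s' - s| + `|t' - t|))) //.
    by rewrite ler_wpM2r ?addr_ge0 // (le_trans (ler_norm L)) // lerDl.
  by rewrite ltr_pM2l //; lra.
move=> M [_ MP]; exists (M + 1) => s t s01 t01.
by apply: (MP (M + 1) _ (s, t)); rewrite ?ltrDl //=; split; rewrite /= in_itv.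
Qed.

End Compactness.

(** * Fixed points, inverses and resolvents *)

Section BanachCalculus.
Variables (R : realType) (B : topAlgType R[i]) (nu : bnorm B).
Implicit Types (x y b c : B).

(* A function with zero derivative is constant: summing over n steps of length
   1/n leaves an error K/n. *)
Lemma const_of_quadratic (f : R -> B) (K : R) :
  (forall s t, 0 <= s <= 1 -> 0 <= t <= 1 -> nu (f s - f t) <= K * (s - t) ^+ 2) ->
  f 1 = f 0.
Proof.
move=> fK; apply/eqP; rewrite -subr_eq0; apply/eqP; apply: (nrm_eq0 (b := nu)).
apply/eqP; rewrite eq_le nu_ge0 andbT; apply: (@le0_of_rate _ _ K) => n.
pose g k := f (k%:R / n.+1%:R).
have n0 : n.+1%:R != 0 :> R by rewrite pnatr_eq0.
have -> : f 1 - f 0 = \sum_(0 <= k < n.+1) (g k.+1 - g k).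
  by rewrite telescope_sumr // /g divff // mul0r.
rewrite (le_trans (nu_sum _ _ _ _)) //.
apply: (@le_trans _ _ (\sum_(0 <= k < n.+1) K * n.+1%:R^-1 ^+ 2)).
  rewrite !big_mkord; apply: ler_sum => k _.
  have in01 m : (m <= n.+1)%N -> 0 <= (m%:R / n.+1%:R : R) <= 1.
    by move=> mn; rewrite divr_ge0 //= ler_pdivrMr ?mul1r ?ler_nat // ltr0n.
  rewrite (le_trans (fK _ _ (in01 _ _) (in01 _ _))) //; first by rewrite ltnW.
  by rewrite -mulrBl -natrB // subSn // subnn mul1r.
rewrite big_mkord sumr_const card_ord -[leLHS]mulr_natr.
by move: n0; move: (n.+1%:R : R) => a a0; rewrite (_ : _ * a = K / a) //; field.
Qed.

(** The right-hand side is 1 - s times a sum of n + 1 powers, each at least s^n. This weakens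
    geometric convergence to the speed 1 / n. *)
Lemma expn_le_rate (s : R) n : 0 <= s <= 1 -> n.+1%:R * (1 - s) * s ^+ n <= 1 - s ^+ n.+1.
Proof.
move=> /andP[s0 s1]; elim: n => [|n IH]; first by rewrite expr0 expr1 mul1r mulr1.
have e0 : 0 <= s ^+ n.+1 by rewrite exprn_ge0.
have e1 : s ^+ n.+1 <= 1 by rewrite exprn_ile1.
have := ler_wpM2l s0 IH.
have -> : s * (n.+1%:R * (1 - s) * s ^+ n) = n.+1%:R * (1 - s) * s ^+ n.+1.
  by rewrite exprS; ring.
rewrite -natr1 (exprS s n.+1) mulrDl mul1r mulrDl.
by move: e0 e1; move: (s ^+ n.+1) => a e0 e1 h; nra.
Qed.

(** The iterates from 0 stay in the ball and are Cauchy at geometric speed, which [expn_le_rate]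
    brings to the form expected by [rate_complete]. Used for inverses and for square roots. *)
Lemma contraction_fixpoint (F : B -> B) (r s : R) : 0 <= r -> 0 <= s < 1 ->
  (forall y, nu y <= r -> nu (F y) <= r) ->
  (forall y z, nu y <= r -> nu z <= r -> nu (F y - F z) <= s * nu (y - z)) ->
  exists2 y, nu y <= r & F y = y.
Proof.
move=> r0 /andP[s0 s1] Fr Fs; pose u n := iter n F 0.
have ur n : nu (u n) <= r by elim: n => [|n IH] /=; rewrite ?nu0 //; exact: Fr.
have uk n k : nu (u (n + k)%N - u n) <= s ^+ n * (2 * r).
  elim: n => [|n IH].
    rewrite add0n expr0 mul1r /= subr0 (le_trans (ur k)) //; lra.
  rewrite addSn exprS -mulrA (le_trans (Fs _ _ (ur _) (ur _))) //.
  by rewrite ler_wpM2l.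
pose K := 2 * r / (1 - s).
have sK n : s ^+ n * (2 * r) <= K / n.+1%:R.
  have := @expn_le_rate s n; rewrite s0 ltW //= => /(_ isT) h.
  have n0 : 0 < n.+1%:R :> R by [].
  rewrite /K ler_pdivlMr // ler_pdivlMr; last lra.
  have h1 : 0 <= s ^+ n.+1 by rewrite exprn_ge0.
  move: h h1 n0; move: (n.+1%:R) (s ^+ n) (s ^+ n.+1) => a p q h h1 n0.
  have : (a * (1 - s) * p) * (2 * r) <= 1 * (2 * r) by apply: ler_wpM2r; lra.
  lra.
have K0 n : 0 <= K / n.+1%:R by rewrite !divr_ge0 ?mulr_ge0 //; lra.
have [|v [M uv]] := @rate_complete _ _ nu u K.
  move=> m n; have [mn|nm] := leqP m n.
    rewrite nuB -(subnKC mn) (le_trans (uk _ _)) // (le_trans (sK _)) //.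
    by rewrite lerDl.
  by rewrite -(subnKC (ltnW nm)) (le_trans (uk _ _)) // (le_trans (sK _)) // lerDr.
have vr : nu v <= r.
  rewrite -subr_le0; apply: (@le0_of_rate _ _ M) => n.
  have := nu_subD nu v (u n) 0; rewrite !subr0 (nuB nu v (u n)).
  by have := uv n; have := ur n; move: (M / n.+1%:R) => a; lra.
exists v => //; apply/eqP; rewrite -subr_eq0; apply/eqP; apply: (nrm_eq0 (b := nu)).
apply/eqP; rewrite eq_le nu_ge0 andbT; apply: (@le0_of_rate _ _ (`|M| + `|M|)) => n.
have hM k : (n <= k)%N -> nu (u k - v) <= `|M| / n.+1%:R.
  move=> nk; rewrite (le_trans (uv k)) // (@le_trans _ _ (`|M| / k.+1%:R)) //.
    by rewrite ler_wpM2r ?ler_norm // invr_ge0.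
  by rewrite ler_wpM2l // lef_pV2 ?posrE // ler_nat ltnS.
have := nu_subD nu (F v) (u n.+1) v; have := Fs v (u n) vr (ur n).
have := hM n (leqnn _); have := hM n.+1 (leqnSn _); rewrite (nuB nu v (u n)) mulrDl.
have := nu_ge0 nu (u n - v).
move: (`|M| / n.+1%:R) => a h1 h2 h3 h4 h5.
have : s * nu (u n - v) <= 1 * nu (u n - v) by rewrite ler_wpM2r // ltW.
rewrite -/(u n.+1) in h4; lra.
Qed.

Lemma inverse_unique b c d : inverse_of b c -> inverse_of b d -> c = d.
Proof. by move=> [_ cb] [bd _]; rewrite -(mulr1 c) -bd mulrA cb mul1r. Qed.

(** Fixed points of y -> 1 + x y and z -> 1 + z x are a right and a left inverse, hence equal. The
    radius r solves nu 1 + nu x * r = r, which makes the ball stable. *)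
Lemma neumann x : nu x < 1 ->
  exists2 y, inverse_of (1 - x) y & nu y <= nu 1 / (1 - nu x).
Proof.
move=> x1; have n0 := nu_ge0 nu x; have n1 := nu_ge0 nu 1.
pose r := nu 1 / (1 - nu x).
have r0 : 0 <= r by rewrite divr_ge0 //; lra.
have re : nu 1 + nu x * r = r by rewrite /r; field; lra.
have s01 : 0 <= nu x < 1 by rewrite n0.
have [||y yr yE] := @contraction_fixpoint (fun y => 1 + x * y) r (nu x) r0 s01.
- move=> y yr; rewrite (le_trans (nrmD _ _ _)) // -re lerD2l.
  by rewrite (le_trans (nrmM _ _ _)) // ler_wpM2l.
- move=> y z _ _; rewrite opprD addrACA subrr add0r -mulrBr; exact: nrmM.
have [||z _ zE] := @contraction_fixpoint (fun y => 1 + y * x) r (nu x) r0 s01.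
- move=> z zr; rewrite (le_trans (nrmD _ _ _)) // -re lerD2l.
  by rewrite (le_trans (nrmM _ _ _)) // mulrC ler_wpM2l.
- move=> a d _ _; rewrite opprD addrACA subrr add0r -mulrBl mulrC; exact: nrmM.
have h1 : (1 - x) * y = 1 by rewrite mulrBl mul1r -{1}yE addrK.
have h2 : z * (1 - x) = 1 by rewrite mulrBr mulr1 -{1}zE addrK.
have zy : z = y by rewrite -(mulr1 z) -h1 mulrA h2 mul1r.
by exists y => //; split=> //; rewrite -zy.
Qed.

Lemma inverse_perturb b c d : inverse_of b c -> nu (c * d) <= 1 / 2 ->
  exists2 y, inverse_of (b - d) y & nu y <= 2 * nu 1 * nu c.
Proof.
move=> [bc cb] cd.
have [|y [h1 h2] yn] := @neumann (c * d); first lra.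
have e : b - d = b * (1 - c * d) by rewrite mulrBr mulr1 mulrA bc mul1r.
exists (y * c).
  split; first by rewrite e -mulrA (mulrA (1 - _)) h1 mul1r.
  by rewrite e -mulrA (mulrA c) cb mul1r.
rewrite (le_trans (nrmM _ _ _)) // ler_wpM2r ?nu_ge0 // (le_trans yn) //.
have n1 := nu_ge0 nu 1.
rewrite ler_pdivrMr; last lra.
have : nu 1 * (2 * nu (c * d)) <= nu 1 * 1 by rewrite ler_wpM2l //; lra.
lra.
Qed.

Section Resolvent.
Variable b : B.

Local Notation Rs := (resolvent b).

Lemma resolventP z : ~ spectrum b z -> inverse_of (z%:A - b) (Rs z).
Proof.
move=> /contrapT[c hc]; rewrite /resolvent; case: xgetP => [y _ //|/(_ c)].
by [].
Qed.

Lemma resolvent_eq z c : inverse_of (z%:A - b) c -> ~ spectrum b z /\ Rs z = c.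
Proof.
move=> hc; have h : ~ spectrum b z by move=> /(_ (ex_intro _ c hc)).
by split=> //; exact: inverse_unique (resolventP h) hc.
Qed.

Lemma resolvent_identity z w : ~ spectrum b z -> ~ spectrum b w ->
  Rs z - Rs w = (w - z) *: (Rs z * Rs w).
Proof.
move=> /resolventP[_ hz] /resolventP[hw _].
have -> : Rs z - Rs w = Rs z * ((w%:A - b) - (z%:A - b)) * Rs w.
  by rewrite mulrBr mulrBl -[Rs z * (w%:A - b) * _]mulrA hw hz mul1r mulr1.
by rewrite opprB addrA subrK -scalerBl -scalerAr mulr1 scalerAl.
Qed.

Lemma resolvent_local z : ~ spectrum b z -> exists M, exists2 d : R, 0 < d &
  forall w, modc (w - z) < d -> ~ spectrum b w /\ nu (Rs w) <= M.
Proof.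
move=> sz; have hz := resolventP sz.
pose d := (2 * (nu (Rs z) + 1))^-1; have n0 := nu_ge0 nu (Rs z).
exists (2 * nu 1 * nu (Rs z)), d => [|w wz]; first by rewrite invr_gt0; lra.
have [|y] := @inverse_perturb _ _ ((z - w)%:A) hz.
  rewrite -scalerAr mulr1 nrmZ modcB (@le_trans _ _ (d * (nu (Rs z) + 1))) //.
    by apply: ler_pM; rewrite ?modc_ge0 //; lra.
  by rewrite (_ : d * _ = 1 / 2) // /d; field; lra.
have -> : z%:A - b - (z - w)%:A = w%:A - b.
  by rewrite addrAC -scalerBl subKr.
by move=> /resolvent_eq[h1 ->].
Qed.

Lemma resolvent_large z : 0 < modc z -> 2 * nu b <= modc z ->
  ~ spectrum b z /\ nu (Rs z) <= 2 * nu 1 ^+ 2 / modc z.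
Proof.
move=> z0 bz.
have zn : z != 0 by apply: contraTneq z0 => ->; rewrite modc0 ltxx.
have hz : inverse_of (z%:A) (z^-1%:A : B).
  by split; rewrite -scalerAl mul1r scalerA (divff, mulVf) // scale1r.
have [|y] := @inverse_perturb _ _ b hz.
  rewrite -scalerAl nrmZ modcV mul1r [leLHS]mulrC ler_pdivrMr //.
  by rewrite mul1r; lra.
rewrite nrmZ modcV => /resolvent_eq[h1 ->] /le_trans h; split=> //; apply: h.
by rewrite (_ : 2 * nu 1 * _ = 2 * nu 1 ^+ 2 / modc z) //; ring.
Qed.

End Resolvent.
End BanachCalculus.

(** * Contour integrals *)

Section Integrals.
Variables (R : realType) (B : topAlgType R[i]) (nu : bnorm B).
Local Notation C := R[i].
Local Open Scope complex_scope.
Implicit Types (g F : C -> B) (p q z w : C) (es : seq (C * C)).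

Definition onseg p q : set C :=
  [set z | exists2 t : R, 0 <= t <= 1 & z = p + t%:C * (q - p)].

Definition rsum g p q (n : nat) : B :=
  \sum_(k < n.+1) ((q - p) / n.+1%:R) *: g (p + k%:R / n.+1%:R * (q - p)).

Lemma onseg_frac p q k n : (k <= n.+1)%N -> onseg p q (p + k%:R / n.+1%:R * (q - p)).
Proof.
move=> kn; exists (k%:R / n.+1%:R); last by rewrite rmorphM fmorphV !natrC.
by rewrite divr_ge0 //= ler_pdivrMr ?mul1r ?ler_nat // ltr0n.
Qed.

Lemma sum_blocks (V : zmodType) (F : nat -> V) N M :
  \sum_(j < N * M) F j = \sum_(k < N) \sum_(i < M) F (k * M + i)%N.
Proof.
elim: N => [|N IH]; first by rewrite mul0n !big_ord0.
rewrite big_ord_recr /= -IH -(big_mkord xpredT F) -(big_mkord xpredT F).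
rewrite mulSn addnC (big_cat_nat _ (n := (N * M)%N)) ?leq_addr //=; congr (_ + _).
rewrite -{1}(add0n (N * M)%N) big_addn addnC addnK big_mkord.
by apply: eq_bigr => i _; rewrite addnC.
Qed.

(** The finer sum splits into m + 1 blocks of n + 1 points, each at distance at most |q - p| / (m +
    1) from the start of its block. Two arbitrary sums are then compared through their common
    refinement; [.-1] appears because [rsum] at n has n + 1 pieces. *)
Lemma rsum_refine g p q (L : R) m n :
  (forall z w, onseg p q z -> onseg p q w -> nu (g z - g w) <= L * modc (z - w)) ->
  nu (rsum g p q (m.+1 * n.+1).-1 - rsum g p q m) <= `|L| * modc (q - p) ^+ 2 / m.+1%:R.
Proof.
move=> gL; rewrite /rsum prednK //.
rewrite (sum_blocks (fun k => ((q - p) / (m.+1 * n.+1)%:R) *: g (p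
  + k%:R / (m.+1 * n.+1)%:R * (q - p)))).
have m0 : m.+1%:R != 0 :> C by rewrite pnatr_eq0.
have n0 : n.+1%:R != 0 :> C by rewrite pnatr_eq0.
have nR : n.+1%:R != 0 :> R by rewrite pnatr_eq0.
have mR : m.+1%:R != 0 :> R by rewrite pnatr_eq0.
rewrite -sumrB.
pose K : R := modc (q - p) / (m.+1%:R * n.+1%:R) * (`|L| * (modc (q - p) / m.+1%:R)).
apply: (@le_trans _ _ (\sum_(k < m.+1) \sum_(i < n.+1) K)); last first.
  rewrite !sumr_const !card_ord -mulrnA -[leLHS]mulr_natr natrM /K.
  move: nR mR; move: (m.+1%:R : R) (n.+1%:R : R) => a c c0 a0.
  by rewrite [X in X <= _](_ : _ = `|L| * modc (q - p) ^+ 2 / a) //; field; rewrite a0 c0.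
apply: (le_trans (nu_sum nu _ _ _)); apply: ler_sum => k _.
have -> : ((q - p) / m.+1%:R) *: g (p + k%:R / m.+1%:R * (q - p)) =
   \sum_(i < n.+1) ((q - p) / (m.+1 * n.+1)%:R) *: g (p + k%:R / m.+1%:R * (q - p)).
  rewrite sumr_const card_ord -[RHS]scaler_nat scalerA natrM; congr (_ *: _).
  by move: m0 n0; move: (m.+1%:R : C) (n.+1%:R : C) => a c a0 c0; field; apply/andP.
rewrite -sumrB; apply: (le_trans (nu_sum nu _ _ _)); apply: ler_sum => i _.
rewrite -scalerBr nrmZ modcM modcV natrM modcM !modc_nat.
have kin : (k * n.+1 + i <= m.+1 * n.+1)%N.
  by rewrite (@leq_trans (k.+1 * n.+1)) ?leq_mul2r ?ltn_ord // mulSn addnC leq_add2r ltnW.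
rewrite /K ler_wpM2l ?divr_ge0 ?modc_ge0 ?mulr_ge0 //.
have on1 : onseg p q (p + (k * n.+1 + i)%:R / (m.+1%:R * n.+1%:R) * (q - p)).
  have := @onseg_frac p q _ _ (_ : (k * n.+1 + i <= (m.+1 * n.+1).-1.+1)%N).
  by rewrite prednK // natrM; apply.
have on2 := onseg_frac p q (ltnW (ltn_ord k)).
rewrite (le_trans (gL _ _ on1 on2)) //.
rewrite (le_trans (ler_wpM2r (modc_ge0 _) (ler_norm L))) // ler_wpM2l //.
have -> : p + (k * n.+1 + i)%:R / (m.+1%:R * n.+1%:R) * (q - p) - (p + k%:R / m.+1%:R * (q - p)) =
   (i%:R / n.+1%:R) * ((q - p) / m.+1%:R).
  rewrite natrD natrM; move: m0 n0; move: (m.+1%:R : C) (n.+1%:R : C) => a c a0 c0.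
  by field; apply/andP.
rewrite !modcM !modcV !modc_nat.
rewrite -[leRHS]mul1r ler_wpM2r ?divr_ge0 ?modc_ge0 // ler_pdivrMr ?ltr0n // mul1r.
by rewrite ler_nat ltnW.
Qed.

Lemma rsum_ex g p q (L : R) :
  (forall z w, onseg p q z -> onseg p q w -> nu (g z - g w) <= L * modc (z - w)) ->
  exists v, rate nu (rsum g p q) v.
Proof.
move=> gL; apply: (@rate_complete _ _ nu _ (`|L| * modc (q - p) ^+ 2)) => m n.
rewrite (le_trans (nu_subD nu _ (rsum g p q (m.+1 * n.+1).-1) _)) // lerD //.
  by rewrite nuB rsum_refine.
by rewrite mulnC rsum_refine.
Qed.

(** The increments of [F] telescope, and n + 1 Taylor errors of order 1 / (n + 1)^2 leave the rate 1
    / (n + 1). Convergence of the sums comes for free, without a Lipschitz bound on [g]. *)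
Lemma rsum_ftc F g p q (K : R) :
  (forall z w, onseg p q z -> onseg p q w ->
     nu (F w - F z - (w - z) *: g z) <= K * modc (w - z) ^+ 2) ->
  rate nu (rsum g p q) (F q - F p).
Proof.
move=> FK; exists (K * modc (q - p) ^+ 2) => n.
have n0 : n.+1%:R != 0 :> C by rewrite pnatr_eq0.
have nR : n.+1%:R != 0 :> R by rewrite pnatr_eq0.
pose y (k : nat) := p + k%:R / n.+1%:R * (q - p).
have -> : F q - F p = \sum_(k < n.+1) (F (y k.+1) - F (y k)).
  rewrite -(big_mkord xpredT (fun k => F (y k.+1) - F (y k))).
  rewrite (telescope_sumr (F \o y)) //= /y divff // mul0r mul0r addr0 mul1r.
  by rewrite (addrC p) subrK.
rewrite -sumrB; apply: (le_trans (nu_sum nu _ _ _)).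
apply: (@le_trans _ _ (\sum_(k < n.+1) K * (modc (q - p) / n.+1%:R) ^+ 2)); last first.
  rewrite sumr_const card_ord -[leLHS]mulr_natr.
  move: nR; move: (n.+1%:R : R) => a a0.
  by rewrite (_ : _ * a = K * modc (q - p) ^+ 2 / a) //; field.
apply: ler_sum => k _; rewrite nuB.
have yk : y k.+1 - y k = (q - p) / n.+1%:R.
  by rewrite /y -natr1; move: n0; move: (n.+1%:R : C) => a a0; field.
have := FK (y k) (y k.+1) (onseg_frac p q (ltnW (ltn_ord k))) (onseg_frac p q (ltn_ord k)).
by rewrite yk modcM modcV modc_nat.
Qed.

Definition edge_sum g es n := \sum_(e <- es) rsum g e.1 e.2 n.
(** For [es := contour_edges G] this is [contour_integral G g] by conversion; plain lists of edges
    allow induction. *)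
Definition edge_int g es : B := \sum_(e <- es) segment_integral g e.1 e.2.
Definition on_edges es : set C :=
  [set z | exists2 e, e \in es & onseg e.1 e.2 z].
Definition edge_length es : R := \sum_(e <- es) modc (e.2 - e.1).

(** A bound along each edge separately: enough for Riemann sums, and stable under products since
    edges are bounded. *)
Definition lip_edges g es := exists L : R, forall e, e \in es ->
  forall z w, onseg e.1 e.2 z -> onseg e.1 e.2 w -> nu (g z - g w) <= L * modc (z - w).

Lemma segment_integral_rate g p q v : rate nu (rsum g p q) v -> segment_integral g p q = v.
Proof.
move=> gv; rewrite /segment_integral; case: xgetP => [x _ gx|/(_ v)].
  exact: cvgB_unique gx (rate_cvg gv).
by case; exact: (rate_cvg gv).
Qed.

Lemma edge_int_rate_seg g es :
  (forall e, e \in es -> exists v, rate nu (rsum g e.1 e.2) v) ->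
  rate nu (edge_sum g es) (edge_int g es).
Proof.
elim: es => [|e es IH] h.
  by exists 0 => n; rewrite /edge_sum /edge_int !big_nil subrr nu0 mul0r.
have [v hv] := h e (mem_head _ _).
have [K hK] := rateD hv (IH (fun e' he' => h e' (@mem_behead _ (e :: es) e' he'))).
exists K => n; rewrite /edge_sum /edge_int !big_cons (segment_integral_rate hv).
exact: hK.
Qed.

Lemma edge_int_rate g es : lip_edges g es -> rate nu (edge_sum g es) (edge_int g es).
Proof. by move=> [L gL]; apply: edge_int_rate_seg => e /gL; exact: rsum_ex. Qed.

Lemma edge_int_ftc F g es (K : R) :
  (forall e, e \in es -> forall z w, onseg e.1 e.2 z -> onseg e.1 e.2 w ->
     nu (F w - F z - (w - z) *: g z) <= K * modc (w - z) ^+ 2) ->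
  edge_int g es = \sum_(e <- es) (F e.2 - F e.1).
Proof.
move=> FK; rewrite /edge_int big_seq [RHS]big_seq; apply: eq_bigr => e /FK.
by move=> /rsum_ftc /segment_integral_rate.
Qed.

Lemma onseg_dist p q z : onseg p q z -> modc (z - p) <= modc (q - p).
Proof.
move=> [t /andP[t0 t1] ->]; rewrite addrC addKr modcM modcR ger0_norm //.
by rewrite ler_piMl ?modc_ge0.
Qed.

Lemma onsegl p q : onseg p q p.
Proof. by exists 0; rewrite ?lexx ?ler01 // mul0r addr0. Qed.

Lemma lip_edges_bounded g es : lip_edges g es ->
  exists M, forall z, on_edges es z -> nu (g z) <= M.
Proof.
move=> [L gL].
exists (\sum_(e <- es) (nu (g e.1) + `|L| * modc (e.2 - e.1))) => z [e ees ze].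
apply: (@le_trans _ _ (nu (g e.1) + `|L| * modc (e.2 - e.1))).
  have := nu_subD nu (g z) (g e.1) 0; rewrite !subr0 => /le_trans; apply.
  rewrite addrC lerD2l (le_trans (gL _ ees _ _ ze (onsegl _ _))) //.
  by rewrite (le_trans (ler_wpM2r (modc_ge0 _) (ler_norm L))) // ler_wpM2l // onseg_dist.
rewrite (big_rem e) //= lerDl sumr_ge0 // => e' _.
by rewrite addr_ge0 ?nu_ge0 ?mulr_ge0 ?modc_ge0.
Qed.

Lemma edge_sum_bound g es (M : R) n : (forall z, on_edges es z -> nu (g z) <= M) ->
  nu (edge_sum g es n) <= edge_length es * M.
Proof.
move=> gM; rewrite /edge_length mulr_suml; apply: (le_trans (nu_sum nu _ _ _)).
rewrite big_seq [leRHS]big_seq; apply: ler_sum => e ees.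
apply: (le_trans (nu_sum nu _ _ _)).
apply: (@le_trans _ _ (\sum_(k < n.+1) modc (e.2 - e.1) / n.+1%:R * M)).
  apply: ler_sum => k _; rewrite nrmZ modcM modcV modc_nat ler_wpM2l //.
    by rewrite divr_ge0 ?modc_ge0.
  by apply: gM; exists e => //; apply: onseg_frac; exact: ltnW.
rewrite sumr_const card_ord -[leLHS]mulr_natr.
have nR : n.+1%:R != 0 :> R by rewrite pnatr_eq0.
move: nR; move: (n.+1%:R : R) => a a0.
by rewrite (_ : _ * a = modc (e.2 - e.1) * M) //; field.
Qed.

Lemma edge_int_bound g es (M : R) : lip_edges g es ->
  (forall z, on_edges es z -> nu (g z) <= M) ->
  nu (edge_int g es) <= edge_length es * M.
Proof.
move=> /edge_int_rate[K gK] gM; rewrite -subr_le0.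
apply: (@le0_of_rate _ _ K) => n; have := gK n; rewrite nuB.
have := nu_subD nu (edge_int g es) (edge_sum g es n) 0; rewrite !subr0.
have := edge_sum_bound n gM; move: (K / _) => a; lra.
Qed.

Lemma edge_intP g es v : lip_edges g es -> rate nu (edge_sum g es) v -> edge_int g es = v.
Proof. by move=> /edge_int_rate h1 h2; exact: rate_unique h1 h2. Qed.

Lemma eq_edge_int g g' es : (forall z, on_edges es z -> g z = g' z) ->
  edge_int g es = edge_int g' es.
Proof.
move=> gg; rewrite /edge_int big_seq [RHS]big_seq; apply: eq_bigr => e ees.
rewrite /segment_integral; congr (xget _ _); apply/funext => v.
change ((rsum g e.1 e.2 @ \oo --> v) = (rsum g' e.1 e.2 @ \oo --> v)).
suff -> : rsum g e.1 e.2 = rsum g' e.1 e.2 by [].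
by apply/funext => n; apply: eq_bigr => k _; rewrite gg //; exists e => //;
  apply: onseg_frac; exact: ltnW.
Qed.

Lemma lip_edgesD g g' es : lip_edges g es -> lip_edges g' es ->
  lip_edges (fun z => g z + g' z) es.
Proof.
move=> [L gL] [L' gL']; exists (L + L') => e ees z w ez ew.
rewrite opprD addrACA mulrDl (le_trans (nrmD _ _ _)) // lerD //; [exact: (gL e)|exact: (gL' e)].
Qed.

Lemma edge_intD g g' es : lip_edges g es -> lip_edges g' es ->
  edge_int (fun z => g z + g' z) es = edge_int g es + edge_int g' es.
Proof.
move=> h1 h2; apply: edge_intP; first exact: lip_edgesD.
have [K hK] := rateD (edge_int_rate h1) (edge_int_rate h2).
exists K => n; rewrite (le_trans _ (hK n)) // le_eqVlt; apply/orP; left; apply/eqP.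
congr (nu (_ - _)); rewrite /edge_sum -big_split; apply: eq_bigr => e _ /=.
by rewrite /rsum -big_split; apply: eq_bigr => k _; rewrite scalerDr.
Qed.

Lemma lip_edges_cst (c : B) es : lip_edges (fun=> c) es.
Proof. by exists 0 => *; rewrite subrr nu0 mul0r. Qed.

End Integrals.

(** The end points of the edges of a polygon are its vertices rotated by one, a permutation of the
    starting points. With [edge_int_ftc], integrands that have a primitive integrate to 0. *)
Lemma contour_closed (R : realType) (V : zmodType) (F : R[i] -> V) (G : contour R) :
  \sum_(e <- contour_edges G) (F e.2 - F e.1) = 0.
Proof.
rewrite /contour_edges big_flatten big_map big1 // => s _.
rewrite sumrB.
have sz : size s = size (rot 1 s) by rewrite size_rot.
have -> : \sum_(e <- zip s (rot 1 s)) F e.2 = \sum_(z <- rot 1 s) F z.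
  transitivity (\sum_(z <- unzip2 (zip s (rot 1 s))) F z); first by rewrite big_map.
  by rewrite unzip2_zip ?sz.
have -> : \sum_(e <- zip s (rot 1 s)) F e.1 = \sum_(z <- s) F z.
  transitivity (\sum_(z <- unzip1 (zip s (rot 1 s))) F z); first by rewrite big_map.
  by rewrite unzip1_zip ?sz.
by rewrite (perm_big s) ?perm_rot ?subrr.
Qed.

Section LinearIntegrals.
Variables (R : realType) (B B' : topAlgType R[i]) (nu : bnorm B) (nu' : bnorm B').
Local Notation C := R[i].
Variables (phi : B -> B') (K : R).
Hypothesis phiD : forall x y, phi (x + y) = phi x + phi y.
Hypothesis phiZ : forall (c : C) x, phi (c *: x) = c *: phi x.
Hypothesis phiK : forall x, nu' (phi x) <= K * nu x.
Implicit Types (g : C -> B) (es : seq (C * C)).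

Let phi0 : phi 0 = 0. Proof. by rewrite -(scale0r 0) phiZ scale0r. Qed.

Let phiB x y : phi (x - y) = phi x - phi y.
Proof. by rewrite phiD -scaleN1r phiZ scaleN1r. Qed.

Lemma lip_edges_map g es : lip_edges nu g es -> lip_edges nu' (fun z => phi (g z)) es.
Proof.
move=> [L gL]; exists (`|K| * L) => e ees z w ez ew.
rewrite -phiB (le_trans (phiK _)) // -mulrA.
rewrite (le_trans (ler_wpM2r (nu_ge0 _ _) (ler_norm K))) // ler_wpM2l //.
exact: (gL e).
Qed.

(** Bounded linear maps pass through Riemann sums. The instances are scaling, multiplication on
    either side, and c -> c x from scalars to the algebra. *)
Lemma edge_int_map g es : lip_edges nu g es ->
  edge_int (fun z => phi (g z)) es = phi (edge_int g es).
Proof.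
move=> gL; apply: (edge_intP (nu := nu')); first exact: lip_edges_map.
have [M hM] := edge_int_rate gL; exists (`|K| * M) => n.
have phis I (r : seq I) (F : I -> B) : phi (\sum_(i <- r) F i) = \sum_(i <- r) phi (F i).
  by elim: r => [|i r IH]; rewrite ?big_nil ?phi0 // !big_cons phiD IH.
have -> : edge_sum (fun z => phi (g z)) es n = phi (edge_sum g es n).
  by rewrite phis; apply: eq_bigr => e _; rewrite phis; apply: eq_bigr => k _; rewrite phiZ.
rewrite -phiB (le_trans (phiK _)) // -mulrA.
by rewrite (le_trans (ler_wpM2r (nu_ge0 _ _) (ler_norm K))) // ler_wpM2l.
Qed.

End LinearIntegrals.

Section MoreIntegrals.
Variables (R : realType) (B : topAlgType R[i]) (nu : bnorm B).
Local Notation C := R[i].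
Local Open Scope complex_scope.
Local Notation mu := (modc_bnorm R).
Implicit Types (g : C -> B) (f : C -> C) (es : seq (C * C)) (x : B).

Lemma lip_edgesZ (c : C) g es : lip_edges nu g es -> lip_edges nu (fun z => c *: g z) es.
Proof.
apply: (@lip_edges_map _ _ _ nu nu ( *:%R c) (modc c)) => [x y|d x|x].
- exact: scalerDr.
- by rewrite !scalerA mulrC.
- by rewrite nrmZ.
Qed.

Lemma edge_intZ (c : C) g es : lip_edges nu g es ->
  edge_int (fun z => c *: g z) es = c *: edge_int g es.
Proof.
apply: (@edge_int_map _ _ _ nu nu ( *:%R c) (modc c)) => [x y|d x|x].
- exact: scalerDr.
- by rewrite !scalerA mulrC.
- by rewrite nrmZ.
Qed.

Lemma lip_edgesB g g' es : lip_edges nu g es -> lip_edges nu g' es ->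
  lip_edges nu (fun z => g z - g' z) es.
Proof.
move=> h1 h2; have := lip_edgesD h1 (lip_edgesZ (-1) h2).
have -> // : (fun z => g z + -1 *: g' z) = (fun z => g z - g' z).
by apply/funext => z; rewrite scaleN1r.
Qed.

Lemma edge_intB g g' es : lip_edges nu g es -> lip_edges nu g' es ->
  edge_int (fun z => g z - g' z) es = edge_int g es - edge_int g' es.
Proof.
move=> h1 h2; rewrite -scaleN1r -edge_intZ // -(edge_intD h1 (lip_edgesZ (-1) h2)).
by apply: eq_edge_int => z _; rewrite scaleN1r.
Qed.

Lemma lip_edges_mull x g es : lip_edges nu g es -> lip_edges nu (fun z => x * g z) es.
Proof.
apply: (@lip_edges_map _ _ _ nu nu ( *%R x) (nu x)) => [y z|d y|y].
- exact: mulrDr.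
- by rewrite scalerAr.
- exact: nrmM.
Qed.

Lemma edge_int_mull x g es : lip_edges nu g es ->
  edge_int (fun z => x * g z) es = x * edge_int g es.
Proof.
apply: (@edge_int_map _ _ _ nu nu ( *%R x) (nu x)) => [y z|d y|y].
- exact: mulrDr.
- by rewrite scalerAr.
- exact: nrmM.
Qed.

Lemma lip_edges_scalar x f es : lip_edges mu f es -> lip_edges nu (fun z => f z *: x) es.
Proof.
apply: (@lip_edges_map _ _ _ mu nu (fun c => c *: x) (nu x)) => [y z|d y|y].
- exact: scalerDl.
- by rewrite -scalerA.
- by rewrite nrmZ mulrC.
Qed.

Lemma edge_int_scalar x f es : lip_edges mu f es ->
  edge_int (fun z => f z *: x) es = edge_int f es *: x.
Proof.
apply: (@edge_int_map _ _ _ mu nu (fun c => c *: x) (nu x)) => [y z|d y|y].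
- exact: scalerDl.
- by rewrite -scalerA.
- by rewrite nrmZ mulrC.
Qed.

Lemma lip_edges_scale f g es : lip_edges mu f es -> lip_edges nu g es ->
  lip_edges nu (fun z => f z *: g z) es.
Proof.
move=> hf hg; have [Mf hMf] := lip_edges_bounded hf.
have [Mg hMg] := lip_edges_bounded hg.
move: hf hg => [Lf hLf] [Lg hLg]; exists (Mf * Lg + Lf * Mg) => e ees z w ez ew.
have -> : f z *: g z - f w *: g w = f z *: (g z - g w) + (f z - f w) *: g w.
  by rewrite scalerBr scalerBl addrA subrK.
have oz : on_edges es z by exists e.
have ow : on_edges es w by exists e.
rewrite (le_trans (nrmD _ _ _)) // mulrDl !nrmZ lerD //.
  rewrite -mulrA ler_pM ?modc_ge0 ?nu_ge0 //; first exact: hMf.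
  exact: (hLg e).
rewrite mulrAC ler_pM ?modc_ge0 ?nu_ge0 //; first exact: (hLf e).
exact: hMg.
Qed.

Lemma lip_edges_id es : lip_edges mu id es.
Proof. by exists 1 => *; rewrite mul1r. Qed.

Lemma edges_unif es (P : R -> C -> Prop) :
  (forall M M' z, P M z -> M <= M' -> P M' z) ->
  (forall z, on_edges es z -> exists M, exists2 d : R, 0 < d &
     forall w, modc (w - z) < d -> P M w) ->
  exists M, forall z, on_edges es z -> P M z.
Proof.
move=> Pm; elim: es => [|e es IH] Pl; first by exists 0 => z [].
have [|M hM] := IH; first by move=> z [e' h1 h2]; apply: Pl; exists e' => //; rewrite inE h1 orbT.
have [||s t s01 _|M' hM'] := @compact_unif R (fun s _ =>
  e.1 + s%:C * (e.2 - e.1)) (modc (e.2 - e.1)) P.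
- move=> s t s' t' _ _ _ _; rewrite opprD addrACA subrr add0r -mulrBl -rmorphB modcM modcR mulrC.
  by rewrite ler_wpM2l ?modc_ge0 // lerDl.
- exact: Pm.
- by apply: Pl; exists e; rewrite ?mem_head //; exists s.
exists (Num.max M M') => z [e']; rewrite inE => /orP[/eqP -> [s s01 ->]|h1 h2].
  by apply: Pm (hM' s 0 s01 _) _; rewrite ?lexx ?ler01 // le_max lexx orbT.
by apply: Pm (hM z _) _; [exists e' | rewrite le_max lexx].
Qed.

Lemma edges_dist es (a : C) : ~ on_edges es a -> exists2 d : R, 0 < d &
  forall z, on_edges es z -> d <= modc (z - a).
Proof.
(* The distance is bounded below by M^-1, a condition that persists as M grows. *)
move=> na; have [|z oz|M hM] := @edges_unif es (fun M z => 0 < M /\ M^-1 <= modc (z - a)).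
- move=> M M' z [M0 hM] MM'; have M'0 := lt_le_trans M0 MM'; split=> //.
  by rewrite (le_trans _ hM) // lef_pV2.
- have za : 0 < modc (z - a).
    by apply: modc_gt0; rewrite subr_eq0; apply: contra_notN na => /eqP <-.
  exists (2 / modc (z - a)), (modc (z - a) / 2) => [|w wz]; first by rewrite divr_gt0.
  split; first by rewrite divr_gt0.
  rewrite invf_div; have := modcD (z - w) (w - a); rewrite addrA subrK modcB; lra.
case: (pselect (exists z, on_edges es z)) => [[z0 /hM[M0 _]]|ne].
  by exists M^-1 => [|z /hM[]//]; rewrite invr_gt0.
by exists 1 => // z oz; case: ne; exists z.
Qed.

Lemma lip_edges_invf f es (d : R) : 0 < d ->
  (forall z, on_edges es z -> d <= modc (f z)) -> lip_edges mu f es ->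
  lip_edges mu (fun z => (f z)^-1) es.
Proof.
move=> d0 dP [L fL]; exists (`|L| / d ^+ 2) => e ees z w ez ew.
have dz : d <= modc (f z) by apply: dP; exists e.
have dw : d <= modc (f w) by apply: dP; exists e.
have nz : f z != 0 by apply: contraTneq dz => ->; rewrite modc0 -ltNge.
have nw : f w != 0 by apply: contraTneq dw => ->; rewrite modc0 -ltNge.
have -> : (f z)^-1 - (f w)^-1 = - (f z - f w) / (f z * f w) by field; rewrite nz nw.
have dzw : d ^+ 2 <= modc (f z) * modc (f w) by rewrite expr2 ler_pM // ltW.
rewrite /= modcM modcN modcV modcM mulrAC; apply: ler_pM;
  rewrite ?modc_ge0 ?invr_ge0 ?mulr_ge0 ?modc_ge0 //.
  by rewrite (le_trans (fL e ees z w ez ew)) // ler_wpM2r ?modc_ge0 ?ler_norm.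
by rewrite lef_pV2 ?posrE ?exprn_gt0 // (lt_le_trans _ dzw) ?exprn_gt0.
Qed.

Lemma lip_edges_inv es (a : C) (d : R) : 0 < d ->
  (forall z, on_edges es z -> d <= modc (z - a)) -> lip_edges mu (fun z => (z - a)^-1) es.
Proof.
move=> d0 dP; apply: (lip_edges_invf d0 dP); exists 1 => e _ z w _ _.
by rewrite mul1r opprB addrA subrK.
Qed.

(** Compactness bounds the resolvent on the edges, and the resolvent identity turns this bound into
    a Lipschitz constant. *)
Lemma lip_edges_resolvent es b : (forall z, on_edges es z -> ~ spectrum b z) ->
  lip_edges nu (resolvent b) es.
Proof.
move=> sb.
have [M hM] : exists M, forall z, on_edges es z -> nu (resolvent b z) <= M.
  apply: edges_unif => [M M' z hM|z /sb/(resolvent_local nu)[M [d d0 dP]]]; first exact: le_trans.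
  by exists M, d => // w /dP[].
exists (M * M) => e ees z w ez ew.
have oz : on_edges es z by exists e.
have ow : on_edges es w by exists e.
rewrite resolvent_identity; [|exact: sb|exact: sb].
rewrite nrmZ modcB mulrC ler_wpM2r ?modc_ge0 //.
by rewrite (le_trans (nrmM _ _ _)) // ler_pM ?nu_ge0 ?hM.
Qed.

End MoreIntegrals.

(** * Winding numbers *)

Section Winding.
Variable R : realType.
Local Notation C := R[i].
Local Open Scope complex_scope.
Local Notation mu := (modc_bnorm R).
Implicit Types (G : contour R) (es : seq (C * C)) (a b c z w : C).

Lemma two_pi_i_neq0 : two_pi_i R != 0.
Proof. by rewrite eq_complex /= negb_and orbC mulf_neq0 // gt_eqF ?pi_gt0. Qed.

Lemma modc_sub_neq0 (d : R) z a : 0 < d -> d <= modc (z - a) -> z - a != 0.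
Proof. by move=> d0 dz; apply: contraTneq dz => ->; rewrite modc0 -ltNge. Qed.

Lemma contour_inv_sqr G a (d : R) : 0 < d ->
  (forall z, on_edges (contour_edges G) z -> d <= modc (z - a)) ->
  edge_int (fun z => (z - a)^-1 ^+ 2 : C) (contour_edges G) = 0.
Proof.
move=> d0 dP.
rewrite (@edge_int_ftc _ _ mu (fun z => - (z - a)^-1) _ _ (d ^- 3)).
  exact: (contour_closed (fun z => - (z - a)^-1) G).
move=> e ees z w ez ew.
have dz : d <= modc (z - a) by apply: dP; exists e.
have dw : d <= modc (w - a) by apply: dP; exists e.
have nz := modc_sub_neq0 d0 dz; have nw := modc_sub_neq0 d0 dw.
rewrite [X in mu X](_ : _ = - ((w - a) * (z - a) ^+ 2)^-1 * (w - z) ^+ 2); last first.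
  rewrite -[_ *: _]/(_ * _).
  by field; rewrite nz nw.
rewrite /= modcM modcN modcX ler_wpM2r ?sqr_ge0 // modcV modcM modcX.
have h : d ^+ 3 <= modc (w - a) * modc (z - a) ^+ 2.
  rewrite exprS ler_pM ?exprn_ge0 ?(ltW d0) //.
  by rewrite lerXn2r ?nnegrE ?modc_ge0 ?(ltW d0).
by rewrite lef_pV2 ?posrE ?exprn_gt0 // (lt_le_trans _ h) ?exprn_gt0.
Qed.

(* The integral depends quadratically on the pole, as the linear term is the
   integral of [(z - a)^-2], which has a primitive. *)
Lemma edge_int_inv_const G a b (d : R) : 0 < d ->
  (forall (s : R) z, 0 <= s <= 1 -> on_edges (contour_edges G) z ->
     d <= modc (z - (a + s%:C * (b - a)))) ->
  edge_int (fun z => (z - a)^-1 : C) (contour_edges G) =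
  edge_int (fun z => (z - b)^-1 : C) (contour_edges G).
Proof.
move=> d0 dP; set es := contour_edges G in dP *.
pose y (s : R) := a + s%:C * (b - a).
pose f s : C := edge_int (fun z => (z - y s)^-1 : C) es.
suff -> : edge_int (fun z => (z - a)^-1 : C) es = f 0.
  rewrite -(@const_of_quadratic R C mu f (edge_length es * (d ^- 3 * modc (b - a) ^+ 2))).
    by apply: eq_edge_int => z _; rewrite /y mul1r (addrC a) subrK.
  move=> s t s01 t01.
  have ls := lip_edges_inv d0 (fun z => dP s z s01).
  have lt := lip_edges_inv d0 (fun z => dP t z t01).
  have lt2 : lip_edges mu (fun z => (z - y t)^-1 ^+ 2) es := lip_edges_scale lt lt.
  have z0 := contour_inv_sqr d0 (fun z => dP t z t01).
  have -> : f s - f t = edge_int (fun z =>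
    ((z - y s)^-1 - (z - y t)^-1) - (y s - y t) *: (z - y t)^-1 ^+ 2 : C) es.
    rewrite (edge_intB (lip_edgesB ls lt) (lip_edgesZ (y s - y t) lt2)).
    rewrite (edge_intB ls lt) (edge_intZ (y s - y t) lt2).
    by rewrite -/es in z0; rewrite z0 scaler0 subr0.
  rewrite -mulrA; apply: (edge_int_bound (nu := mu)).
    exact: (lip_edgesB (lip_edgesB ls lt) (lip_edgesZ (y s - y t) lt2)).
  move=> z oz; have dz := dP s z s01 oz; have dw := dP t z t01 oz.
  have nz := modc_sub_neq0 d0 dz; have nw := modc_sub_neq0 d0 dw.
  rewrite [X in mu X](_ : _ = ((z - y s) * (z - y t) ^+ 2)^-1 * (y s - y t) ^+ 2); last first.
    by rewrite -[_ *: _]/(_ * _); field; rewrite nz nw.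
  have -> : y s - y t = (s - t)%:C * (b - a) by rewrite /y rmorphB; ring.
  rewrite /= modcM modcX modcM modcR exprMn real_normK ?num_real // mulrA mulrAC.
  rewrite ler_wpM2r ?sqr_ge0 //  ler_wpM2r ?sqr_ge0 // modcV modcM modcX.
  have h : d ^+ 3 <= modc (z - y s) * modc (z - y t) ^+ 2.
    rewrite exprS ler_pM ?exprn_ge0 ?(ltW d0) //.
    by rewrite lerXn2r ?nnegrE ?modc_ge0 ?(ltW d0).
  by rewrite lef_pV2 ?posrE ?exprn_gt0 // (lt_le_trans _ h) ?exprn_gt0.
by apply: eq_edge_int => z _; rewrite /y mul0r addr0.
Qed.

(** The sphere of radius r about c for [norm1]. Seen from c, every edge is a complex multiple of the
    segment from (1 - i) / 2 to (1 + i) / 2, which stays away from the cut of [clog]. *)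
Definition diamond (c : C) (r : R) : contour R :=
  [:: [:: c + r%:C; c + r%:C * 'i%C; c - r%:C; c - r%:C * 'i%C]].

Definition norm1 z : R := `|complex.Re z| + `|complex.Im z|.

Lemma norm1_le z : norm1 z <= 2 * modc z.
Proof. by have := Re_le_modc z; have := Im_le_modc z; rewrite /norm1; lra. Qed.

Lemma modc_le_norm1 z : modc z <= norm1 z.
Proof. by case: z => a b; exact: modc_le_ReIm. Qed.

Lemma norm1D z w : norm1 (z + w) <= norm1 z + norm1 w.
Proof.
by case: z w => [a b] [c d]; rewrite /norm1 /= addrACA lerD // ler_normD.
Qed.

Lemma diamond_norm1 c (r : R) z : 0 <= r -> on_edges (contour_edges (diamond c r)) z ->
  norm1 (z - c) = r.
Proof.
move=> r0 [e]; rewrite /contour_edges /= !inE.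
have key (t x y : R) : 0 <= t <= 1 -> `|x| = r -> `|y| = r ->
    `|(1 - t) * x| + `|t * y| = r.
  move=> /andP[t0 t1] xr yr; rewrite !normrM xr yr (ger0_norm t0) ger0_norm ?subr_ge0 //; ring.
have rr : `|r| = r by rewrite ger0_norm.
have rN : `|- r| = r by rewrite normrN.
move=> /or4P[] /eqP -> [t t01 ->] /=.
- rewrite (_ : _ - c = ((1 - t) * r) +i* (t * r)); first exact: key.
  by case: c => x y; apply: complex_ext => /=; ring.
- rewrite (_ : _ - c = (t * - r) +i* ((1 - t) * r)); first by rewrite /norm1 /= addrC; exact: key.
  by case: c => x y; apply: complex_ext => /=; ring.
- rewrite (_ : _ - c = ((1 - t) * - r) +i* (t * - r)); first exact: key.
  by case: c => x y; apply: complex_ext => /=; ring.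
- rewrite (_ : _ - c = (t * r) +i* ((1 - t) * - r)); first by rewrite /norm1 /= addrC; exact: key.
  by case: c => x y; apply: complex_ext => /=; ring.
Qed.

Lemma diamond_dist c (r : R) z a : 0 <= r -> on_edges (contour_edges (diamond c r)) z ->
  (r - norm1 (a - c)) / 2 <= modc (z - a).
Proof.
move=> r0 /(diamond_norm1 r0) zr; have := norm1D (z - a) (a - c).
by rewrite addrA subrK zr; have := norm1_le (z - a); lra.
Qed.

(** The two points are conjugate, so that the moduli cancel and the arguments add up. By [cexp_clog]
    the argument [th] of the first has equal sine and cosine, and 0 < q < 1 puts it between 0 and pi
    / 2, whence pi / 4. *)
Lemma clog_diag : clog ((1 / 2) +i* (1 / 2)) - clog ((1 / 2) +i* (- (1 / 2))) =
  0 +i* (pi / 2) :> C.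
Proof.
set z : C := (1 / 2) +i* (1 / 2); set w : C := (1 / 2) +i* (- (1 / 2)).
have mwz : modc w = modc z by rewrite !modcE sqrrN.
have m0 := modc_ge0 z.
have s0 : 0 < slit z by rewrite /slit /=; lra.
have := cexp_clog s0; have := modc_sqr z; rewrite clogE clogE mwz.
rewrite (_ : slit w = slit z) ?/slit ?mwz //= mulNr atanN mulrN.
set r := modc z in m0 s0 *; move=> rr.
set q := 1 / 2 / _; set th := 2 * atan q; rewrite /cexp /=.
have r1 : 1 / 2 < r.
  by rewrite -(ltr_pXn2r (ltn0Sn 1)) ?nnegrE //; lra.
rewrite lnK ?posrE; last lra.
move=> /eqP; rewrite eq_complex /= => /andP[/eqP hc /eqP hs].
have q0 : 0 < q by rewrite divr_gt0 //; lra.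
have q1 : q < 1 by rewrite ltr_pdivrMr; lra.
have := @lt_atan R _ _ q0; rewrite atan0 => a0.
have := @lt_atan R _ _ q1; rewrite atan1 => a1.
have := pi_gt0 R => p0.
rewrite mul0r ?subr0 in hc; rewrite mul0r ?addr0 in hs.
have r2 : r != 0 by rewrite gt_eqF //; lra.
have sc : sin th = cos th by apply: (mulfI r2); rewrite hs hc.
have c0 : cos th != 0 by apply/eqP => h; rewrite h mulr0 in hc; lra.
have tan1 : tan th = 1 by rewrite /tan sc divff.
have thE : th = pi / 4.
  rewrite -[LHS]tanK ?tan1 ?atan1 // in_itv /=; apply/andP; rewrite /th; split; lra.
rewrite thE; apply/eqP; rewrite eq_complex /= subrr opprK eqxx /=; apply/eqP; lra.
Qed.

(** The function clog ((z - c) / k) is a primitive, as (z - c) / k has real part 1 / 2 on the edge.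
    One computation thus serves the four edges, with k one of +-r +- i r. *)
Lemma diamond_edge c (k : C) : k != 0 ->
  segment_integral (fun z => (z - c)^-1 : C) (c + k * ((1 / 2) +i* (- (1 / 2))))
    (c + k * ((1 / 2) +i* (1 / 2))) = 0 +i* (pi / 2).
Proof.
move=> k0; pose F z : C := clog ((z - c) / k).
have Fk x : F (c + k * x) = clog x by rewrite /F addrC addKr mulrC mulKf.
rewrite -clog_diag -Fk -[X in _ - X]Fk.
have [K hK] := @clog_taylor R (1 / 2) 1 ltac:(lra).
apply: (segment_integral_rate (nu := mu)).
apply: (@rsum_ftc _ _ mu F _ _ _ (K / modc k ^+ 2)) => z w.
have seg x : onseg (c + k * (1 / 2 +i* - (1 / 2))) (c + k * (1 / 2 +i* (1 / 2))) x ->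
    [/\ 1 / 2 <= slit ((x - c) / k) , modc ((x - c) / k) <= 1 & (x - c) / k != 0].
  move=> [t /andP[t0 t1] ->].
  have -> : (c + k * (1 / 2 +i* - (1 / 2)) + t%:C * (c + k * (1 / 2 +i* (1 / 2)) - (c
    + k * (1 / 2 +i* - (1 / 2)))) - c) / k =
     (1 / 2) +i* (t - 1 / 2).
    have -> : (1 / 2) +i* (t - 1 / 2) = (1 / 2 +i* - (1 / 2)) + t%:C * 'i%C :> C.
      by apply: complex_ext => /=; ring.
    have -> : (1 / 2 +i* (1 / 2)) = (1 / 2 +i* - (1 / 2)) + 'i%C :> C.
      by apply: complex_ext => /=; lra.
    by field.
  split; first by rewrite /slit /=; have := modc_ge0 ((1 / 2) +i* (t - 1 / 2)); lra.
    rewrite (le_trans (modc_le_ReIm _ _)) //.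
    rewrite ger0_norm; last lra.
    have : `|t - 1 / 2| <= 1 / 2 by rewrite ler_norml; apply/andP; split; lra.
    lra.
  by rewrite eq_complex /=; apply/nandP; left; lra.
move=> /seg[sz zM zn] /seg[sw wM wn].
have := hK _ _ sz sw zM wM; rewrite /F.
have zc : z - c != 0 by apply: contraNneq zn => ->; rewrite mul0r.
have -> : ((w - c) / k - (z - c) / k) / ((z - c) / k) = (w - z) / (z - c).
  by field; rewrite k0 zc.
have -> : (w - c) / k - (z - c) / k = (w - z) / k by field.
by rewrite modcM modcV exprMn exprVn mulrA mulrAC.
Qed.

Lemma diamond_center c (r : R) : 0 < r ->
  edge_int (fun z => (z - c)^-1 : C) (contour_edges (diamond c r)) = two_pi_i R.
Proof.
move=> r0; rewrite /edge_int /contour_edges /= !big_cons big_nil /=.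
have edge (x y : R) (p q : C) : (x != 0) -> p = c + (x +i* y) * ((1 / 2) +i* (- (1 / 2))) ->
    q = c + (x +i* y) * ((1 / 2) +i* (1 / 2)) ->
    segment_integral (fun z => (z - c)^-1 : C) p q = 0 +i* (pi / 2).
  by move=> x0 -> ->; apply: diamond_edge; rewrite eq_complex /= negb_and x0.
have r1 : r != 0 by rewrite gt_eqF.
have rN : - r != 0 by rewrite oppr_eq0.
have e1 : segment_integral (fun z => (z - c)^-1 : C) (c + r%:C) (c + r%:C * 'i%C) = 0 +i* (pi / 2).
  by apply: (edge r r) => //; case: (c) => x y; apply: complex_ext => /=; field.
have e2 : segment_integral (fun z => (z - c)^-1 : C) (c + r%:C * 'i%C) (c - r%:C) = 0 +i* (pi / 2).
  by apply: (edge (- r) r) => //; case: (c) => x y; apply: complex_ext => /=; field.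
have e3 : segment_integral (fun z => (z - c)^-1 : C) (c - r%:C) (c - r%:C * 'i%C) = 0 +i* (pi / 2).
  by apply: (edge (- r) (- r)) => //; case: (c) => x y; apply: complex_ext => /=; field.
have e4 : segment_integral (fun z => (z - c)^-1 : C) (c - r%:C * 'i%C) (c + r%:C) = 0 +i* (pi / 2).
  by apply: (edge r (- r)) => //; case: (c) => x y; apply: complex_ext => /=; field.
by rewrite e1 e2 e3 e4; apply: complex_ext => /=; field.
Qed.

Lemma diamond_winding c a (r : R) : norm1 (a - c) < r ->
  edge_int (fun z => (z - a)^-1 : C) (contour_edges (diamond c r)) = two_pi_i R.
Proof.
move=> ar; have n0 : 0 <= norm1 (a - c) by rewrite addr_ge0.
rewrite -(@diamond_center c r); last lra.
symmetry; apply: (@edge_int_inv_const _ _ _ ((r - norm1 (a - c)) / 2)); first by lra.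
move=> s z /andP[s0 s1] oz.
have r0 : 0 <= r by lra.
apply: le_trans (diamond_dist _ r0 oz).
rewrite ler_wpM2r // lerD2l lerN2 (addrC c) addrK /norm1.
case: (a - c) => x y /=; rewrite !mul0r subr0 addr0 !normrM (ger0_norm s0).
by rewrite -mulrDr ler_piMl // addr_ge0.
Qed.

(** On the diamond Re z >= c - r > 0 >= Re a, so clog (z - a) is a primitive. This gives winding
    number 0 outside the right half-plane. *)
Lemma diamond_exterior (c r : R) a : 0 <= r < c -> complex.Re a <= 0 ->
  edge_int (fun z => (z - a)^-1 : C) (contour_edges (diamond c%:C r)) = 0.
Proof.
move=> /andP[r0 rc] a0; pose F z : C := clog (z - a).
have cr : 0 < c - r by lra.
have [K hK] := @clog_taylor R (c - r) (r + modc (c%:C - a)) cr.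
rewrite (@edge_int_ftc _ _ mu F _ _ K); first exact: (contour_closed F).
have side z : on_edges (contour_edges (diamond c%:C r)) z ->
    [/\ c - r <= slit (z - a), modc (z - a) <= r + modc (c%:C - a) & z - a != 0].
  move=> /(diamond_norm1 r0) zr.
  have re : c - r <= complex.Re (z - a).
    move: zr; case: (z) a0 => x y; case: (a) => u v /= u0; rewrite /norm1 /= => zr.
    by have := ler_norm (- (x - c)); rewrite normrN; have := normr_ge0 (y - 0); lra.
  have m0 := modc_ge0 (z - a); split.
  - by rewrite /slit; lra.
  - have := modcD (z - c%:C) (c%:C - a); rewrite addrA subrK.
    by have := modc_le_norm1 (z - c%:C); lra.
  - by apply: contraTneq re => ->; rewrite /= -ltNge.
move=> e ees z w ez ew.
have [sz zM zn] := side z (ex_intro2 _ _ e ees ez).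
have [sw wM _] := side w (ex_intro2 _ _ e ees ew).
by have := hK _ _ sz sw zM wM; rewrite opprB addrA subrK.
Qed.

End Winding.

(** * Liouville's theorem and the resolvent *)

Section Liouville.
Variables (R : realType) (B : topAlgType R[i]) (nu : bnorm B).
Local Notation C := R[i].
Local Open Scope complex_scope.
Local Notation mu := (modc_bnorm R).
Implicit Types (z w l m : C).

(** Complex differentiability with bounds and a quadratic remainder uniform in both l and m near
    each point: the form that compactness carries over to squares. *)
Definition locally_holomorphic (F : C -> B) := forall l0, exists M, exists2 d : R, 0 < d &
  forall l, modc (l - l0) < d -> nu (F l) <= M /\
    exists2 D, nu D <= M & forall m, modc (m - l0) < d ->
      nu (F m - F l - (m - l) *: D) <= M * modc (m - l) ^+ 2.

Lemma square_derivative (F : C -> B) (S : R) : 0 < S -> locally_holomorphic F ->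
  exists K, exists2 D : C -> B, 0 <= K & forall l, norm1 l <= S ->
    [/\ nu (F l) <= K, nu (D l) <= K & forall m, norm1 m <= S ->
      nu (F m - F l - (m - l) *: D l) <= K * modc (m - l) ^+ 2].
Proof.
move=> S0 Fl.
(* One growing parameter bounds all constants and, as M^-1, the radius on which the estimate
   holds. *)
pose P M l := 0 < M /\ nu (F l) <= M /\ exists2 D, nu D <= M & forall m,
  modc (m - l) < M^-1 -> nu (F m - F l - (m - l) *: D) <= M * modc (m - l) ^+ 2.
pose g (s t : R) : C := (- S + 2 * S * s) +i* (- S + 2 * S * t).
have [s t s' t' _ _ _ _|M M' z [M0 [h1 [D h2 h3]]] MM'|s t _ _|K hK] := @compact_unif R g (2 * S) P.
- have -> : g s t - g s' t' = (2 * S * (s - s')) +i* (2 * S * (t - t')).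
    by apply: complex_ext => /=; ring.
  rewrite (le_trans (modc_le_ReIm _ _)) // !(normrM (2 * S)) -mulrDr.
  by rewrite (ger0_norm (_ : 0 <= 2 * S)) // mulr_ge0 // ltW.
- have M'0 := lt_le_trans M0 MM'; split=> //; split; first exact: le_trans MM'.
  exists D => [|m mz]; first exact: le_trans MM'.
  rewrite (le_trans (h3 m _)) ?ler_wpM2r ?sqr_ge0 //.
  by rewrite (lt_le_trans mz) // lef_pV2.
- have [M [d d0 dP]] := Fl (g s t).
  pose M' := Num.max M (2 / d).
  have MM' : M <= M' by rewrite le_max lexx.
  have dM' : 2 / d <= M' by rewrite le_max lexx orbT.
  have M'0 : 0 < M' by rewrite (lt_le_trans _ dM') // divr_gt0.
  have M'd : M'^-1 <= d / 2 by rewrite -(invf_div 2 d) lef_pV2 ?posrE // divr_gt0.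
  exists M', (d / 2) => [|w wz]; first by rewrite divr_gt0.
  have [|h1 [D h2 h3]] := dP w; first by lra.
  split=> //; split; first exact: le_trans MM'.
  exists D => [|m mw]; first exact: le_trans MM'.
  rewrite (le_trans (h3 m _)) ?ler_wpM2r ?sqr_ge0 //.
  by have := modcD (m - w) (w - g s t); rewrite addrA subrK; lra.
have sq l : norm1 l <= S -> P K l.
  move=> lS; case: l lS => x y; rewrite /norm1 /= => lS.
  have hx := ler_norm x; have hx' := ler_norm (- x); rewrite normrN in hx'.
  have hy := ler_norm y; have hy' := ler_norm (- y); rewrite normrN in hy'.
  have i01 (r : R) : - S <= r <= S -> 0 <= (r + S) / (2 * S) <= 1.
    move=> /andP[r0 r1]; apply/andP; split; first by rewrite divr_ge0 //; lra.
    by rewrite ler_pdivrMr; lra.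
  have := hK ((x + S) / (2 * S)) ((y + S) / (2 * S)).
  have -> : g ((x + S) / (2 * S)) ((y + S) / (2 * S)) = x +i* y.
    by apply: complex_ext => /=; field; lra.
  by apply; apply: i01; apply/andP; split; lra.
have K0 : 0 < K by case: (sq 0); rewrite // /norm1 /= normr0 addr0 ltW.
have /choice[D hD] : forall l, exists D, norm1 l <= S -> nu (F l) <= K /\ nu D <= K /\ forall m,
  modc (m - l) < K^-1 -> nu (F m - F l - (m - l) *: D) <= K * modc (m - l) ^+ 2.
  move=> l; case: (pselect (norm1 l <= S)) => [/sq[_ [h1 [D h2 h3]]]|]; first by exists D.
  by exists 0.
exists (K + (2 * K * K ^+ 2 + K * K)), D => [|l lS].
  by rewrite !addr_ge0 ?mulr_ge0 ?sqr_ge0 ?ltW.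
have [h1 [h2 h3]] := hD l lS.
have e0 : 0 <= 2 * K * K ^+ 2 + K * K by rewrite !addr_ge0 ?mulr_ge0 ?sqr_ge0 ?ltW.
split; [by rewrite (le_trans h1) // lerDl|by rewrite (le_trans h2) // lerDl|move=> m mS].
have [h4 _] := hD m mS.
have n0 := modc_ge0 (m - l).
(* For distant points the trivial bound 2 K + K |m - l| suffices, since 1 <= K |m - l| makes it
   quadratic. Hence the additional terms in the constant. *)
have [ml|ml] := ltP (modc (m - l)) K^-1.
  by rewrite (le_trans (h3 _ ml)) // ler_wpM2r ?sqr_ge0 // lerDl.
have Km : 1 <= K * modc (m - l) by rewrite -ler_pdivrMl // mulr1.
have := nrmD nu (F m - F l) (- ((m - l) *: D l)).
have := nrmD nu (F m) (- F l); rewrite !nuN nrmZ => h5 h6.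
have h7 : modc (m - l) * nu (D l) <= modc (m - l) * K by rewrite ler_wpM2l.
apply: (@le_trans _ _ (K + K + modc (m - l) * K)); first by lra.
move: (modc (m - l)) n0 Km => x x0 Kx.
have x1 : 1 <= (K * x) ^+ 2 by rewrite exprn_ege1.
have : 2 * K * 1 <= 2 * K * (K * x) ^+ 2 by rewrite ler_wpM2l //; lra.
have : x * K * 1 <= x * K * (K * x) by rewrite ler_wpM2l // mulr_ge0 // ltW.
have : 0 <= K * x ^+ 2 by rewrite mulr_ge0 ?sqr_ge0 // ltW.
rewrite exprMn expr2 mulrDl; lra.
Qed.

(* The integral of [F (s z) / z] over a large diamond does not depend on [s] in
   [0, 1]: it is [2 pi i F 0] for [s = 0] and small for [s = 1]. *)
Lemma liouville (F : C -> B) : locally_holomorphic F ->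
  (forall e : R, 0 < e -> exists S, forall l, S <= modc l -> nu (F l) <= e) ->
  F 0 = 0.
Proof.
move=> Fl Fdec.
have p0 := modc_gt0 (two_pi_i_neq0 R).
suff key e : 0 < e -> modc (two_pi_i R) * nu (F 0) <= 16 * e.
  apply: (nrm_eq0 (b := nu)); apply/eqP; rewrite eq_le nu_ge0 andbT leNgt; apply/negP => h.
  have hp : 0 < modc (two_pi_i R) * nu (F 0) by rewrite mulr_gt0.
  have := key (modc (two_pi_i R) * nu (F 0) / 32) ltac:(lra); lra.
move=> e0; have [S1 hS1] := Fdec e e0.
(* Points of the diamond have modulus at least S / 2 >= S1, where nu (F z) <= e. *)
pose S := Num.max 1 (2 * S1).
have S1' : 1 <= S by rewrite le_max lexx.
have SS1 : 2 * S1 <= S by rewrite le_max lexx orbT.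
have S0 : 0 < S by lra.
have [K [D K0 hD]] := square_derivative S0 Fl.
pose G := diamond (0 : C) S; set es := contour_edges G.
have oz z : on_edges es z -> norm1 z = S.
  by move=> /(diamond_norm1 (ltW S0)); rewrite subr0.
have dz z : on_edges es z -> S / 2 <= modc (z - 0).
  by move=> /oz zS; rewrite subr0; have := norm1_le z; lra.
have mz z : on_edges es z -> modc z <= S by move=> /oz <-; exact: modc_le_norm1.
have sq (s : R) z : 0 <= s <= 1 -> on_edges es z -> norm1 (s%:C * z) <= S.
  move=> /andP[s0 s1] /oz <-; case: z => x y; rewrite /norm1 /= !mul0r subr0 addr0.
  by rewrite !normrM (ger0_norm s0) -mulrDr ler_piMl // addr_ge0.
have Fq (s t : R) z w : 0 <= s <= 1 -> 0 <= t <= 1 -> on_edges es z -> on_edges es w ->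
   nu (F (s%:C * w) - F (t%:C * z) - (s%:C * w - t%:C * z) *: D (t%:C * z)) <=
   K * modc (s%:C * w - t%:C * z) ^+ 2.
  by move=> s01 t01 ez ew; have [_ _] := hD _ (sq t z t01 ez); apply; exact: sq.
have S20 : 0 < S / 2 by rewrite divr_gt0.
have linv : lip_edges mu (fun z => z^-1) es.
  have := lip_edges_inv S20 dz.
  by have -> : (fun z => (z - 0)^-1) = (fun z => z^-1 : C) by apply/funext => z; rewrite subr0.
have sD (s : R) z w : s%:C * z - s%:C * w = s%:C * (z - w) by rewrite mulrBr.
have smod (s : R) z : 0 <= s <= 1 -> modc (s%:C * z) <= modc z.
  by move=> /andP[s0 s1]; rewrite modcM modcR ger0_norm // ler_piMl ?modc_ge0.
(* Adding the Taylor estimates from z to w and from w to z eliminates [F] and leaves the variation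
   of [D]. *)
have lD (s : R) : 0 <= s <= 1 -> lip_edges nu (fun z => D (s%:C * z)) es.
  move=> s01; exists (K + K) => f fes z w fz fw.
  have ez : on_edges es z by exists f.
  have ew : on_edges es w by exists f.
  have h1 := Fq s s z w s01 s01 ez ew; have h2 := Fq s s w z s01 s01 ew ez.
  have [zw|zw] := eqVneq (s%:C * z) (s%:C * w).
    by rewrite zw subrr nu0 mulr_ge0 ?addr_ge0 ?modc_ge0.
  have d0 : 0 < modc (s%:C * z - s%:C * w) by apply: modc_gt0; rewrite subr_eq0.
  apply: (@le_trans _ _ ((K + K) * modc (s%:C * z - s%:C * w))); last first.
    by rewrite ler_wpM2l ?addr_ge0 // sD smod.
  rewrite -(ler_pM2l d0) -nrmZ.
  have -> : (s%:C * z - s%:C * w) *: (D (s%:C * z) - D (s%:C * w)) =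
    (F (s%:C * w) - F (s%:C * z) - (s%:C * w - s%:C * z) *: D (s%:C * z)) +
    (F (s%:C * z) - F (s%:C * w) - (s%:C * z - s%:C * w) *: D (s%:C * w)).
    rewrite scalerBr -[s%:C * w - s%:C * z]opprB scaleNr opprK.
    by rewrite addrACA [X in _ = X + _]addrA subrK subrr add0r.
  rewrite (le_trans (nrmD _ _ _)) // mulrCA -expr2 mulrDl.
  by rewrite lerD // (le_trans h1) // modcB.
have lF (s : R) : 0 <= s <= 1 -> lip_edges nu (fun z => F (s%:C * z)) es.
  move=> s01; exists (K + K * (2 * S)) => f fes z w fz fw.
  have ez : on_edges es z by exists f.
  have ew : on_edges es w by exists f.
  have [_ h1 _] := hD _ (sq s w s01 ew).
  have h2 := Fq s s w z s01 s01 ew ez; rewrite sD in h2.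
  have h3 := smod s (z - w) s01.
  have h4 : modc (z - w) <= 2 * S.
    by have := modcD z (- w); rewrite modcN; have := mz z ez; have := mz w ew; lra.
  rewrite -[F (s%:C * z) - _](subrK ((s%:C * (z - w)) *: D (s%:C * w))).
  rewrite (le_trans (nrmD _ _ _)) // nrmZ addrC mulrDl lerD //.
    by rewrite mulrC ler_pM ?nu_ge0 ?modc_ge0.
  rewrite (le_trans h2) // -mulrA ler_wpM2l // expr2 ler_pM ?modc_ge0 //.
  exact: le_trans h4.
pose I s : B := edge_int (fun z => z^-1 *: F (s%:C * z)) es.
have lI s : 0 <= s <= 1 -> lip_edges nu (fun z => z^-1 *: F (s%:C * z)) es.
  by move=> s01; exact: (lip_edges_scale linv (lF s s01)).
(* The derivative of [I] at t: z^-1 cancels the inner derivative z. A primitive is t^-1 F (t z), or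
   z D 0 when t = 0. *)
have iD (t : R) : 0 <= t <= 1 -> edge_int (fun z => D (t%:C * z)) es = 0.
  move=> t01; have /andP[t0 t1] := t01.
  have [t00|tn] := eqVneq t 0.
    rewrite (@edge_int_ftc _ _ nu (fun z => z *: D 0) _ _ 0).
      exact: (contour_closed (fun z => z *: D 0)).
    by move=> f fes z w _ _; rewrite t00 mul0r -scalerBl subrr nu0 mul0r.
  have tC : t%:C != 0 :> C by rewrite eq_complex /= negb_and tn.
  rewrite (@edge_int_ftc _ _ nu (fun z => t%:C^-1 *: F (t%:C * z)) _ _ (K * t^-1)).
    exact: (contour_closed (fun z => t%:C^-1 *: F (t%:C * z))).
  move=> f fes z w fz fw.
  have ez : on_edges es z by exists f.
  have ew : on_edges es w by exists f.
  have := Fq t t z w t01 t01 ez ew; rewrite sD => h.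
  have -> : t%:C^-1 *: F (t%:C * w) - t%:C^-1 *: F (t%:C * z) - (w - z) *: D (t%:C * z) =
    t%:C^-1 *: (F (t%:C * w) - F (t%:C * z) - (t%:C * (w - z)) *: D (t%:C * z)).
    by rewrite !scalerBr scalerA mulKf.
  rewrite nrmZ modcV modcR (ger0_norm t0) mulrC ler_pdivrMr ?lt_def ?tn // (le_trans h) //.
  rewrite [leRHS](_ : _ = K * modc (w - z) ^+ 2); last by field.
  rewrite ler_wpM2l // modcM modcR (ger0_norm t0) exprMn.
  by rewrite ler_piMl ?sqr_ge0 // exprn_ile1.
have I10 : I 1 = I 0.
  apply: (@const_of_quadratic R B nu I (edge_length es * (2 / S * (K * S ^+ 2)))).
  move=> s t s01 t01.
  have -> : I s - I t = edge_int (fun z => (z^-1 *: F (s%:C * z) - z^-1 *: F (t%:C * z)) -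
     (s%:C - t%:C) *: D (t%:C * z)) es.
    rewrite (edge_intB (lip_edgesB (lI s s01) (lI t t01)) (lip_edgesZ _ (lD t t01))).
    by rewrite (edge_intB (lI s s01) (lI t t01)) (edge_intZ _ (lD t t01)) iD // scaler0 subr0.
  rewrite -mulrA; apply: (edge_int_bound (nu := nu)).
    exact: (lip_edgesB (lip_edgesB (lI s s01) (lI t t01)) (lip_edgesZ _ (lD t t01))).
  move=> z ez; have zd := dz z ez; rewrite subr0 in zd.
  have zn : z != 0 by apply: contraTneq zd => ->; rewrite modc0 -ltNge.
  have -> : z^-1 *: F (s%:C * z) - z^-1 *: F (t%:C * z) - (s%:C - t%:C) *: D (t%:C * z) =
     z^-1 *: (F (s%:C * z) - F (t%:C * z) - (s%:C * z - t%:C * z) *: D (t%:C * z)).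
    by rewrite !scalerBr scalerA -mulrBl mulrCA mulVf // mulr1.
  have := Fq s t z z s01 t01 ez ez;
    rewrite -mulrBl -rmorphB modcM modcR exprMn real_normK ?num_real //.
  rewrite nrmZ modcV => h; rewrite -[leRHS]mulrA; apply: ler_pM;
    rewrite ?nu_ge0 ?invr_ge0 ?modc_ge0 //.
    by rewrite -(invf_div S 2) lef_pV2 ?posrE // (lt_le_trans S20).
  rewrite (le_trans h) // -[leRHS]mulrA ler_wpM2l // mulrC ler_wpM2r ?sqr_ge0 //.
  by rewrite lerXn2r ?nnegrE ?modc_ge0 ?mz // ltW.
have I0 : I 0 = two_pi_i R *: F 0.
  rewrite -(@diamond_winding R 0 0 S); last by rewrite subr0 /norm1 /= normr0 addr0.
  rewrite -/es -(edge_int_scalar nu (F 0) (lip_edges_inv S20 dz)).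
  by apply: eq_edge_int => z _; rewrite mul0r subr0.
rewrite -nrmZ -I0 -I10.
(* Four edges of length at most 2 S, on which nu (z^-1 F z) <= 2 e / S, give the final bound 16
   e. *)
have len : edge_length es <= 8 * S.
  have h (x y : R) (p : C) : p = x +i* y -> `|x| = S -> `|y| = S -> modc p <= 2 * S.
    by move=> -> xS yS; have := modc_le_norm1 (x +i* y); rewrite /norm1 /= xS yS; lra.
  have aS : `|S| = S by rewrite ger0_norm ?ltW.
  have aN : `|- S| = S by rewrite normrN.
  have e1 : modc (0 + S%:C * 'i - (0 + S%:C)) <= 2 * S.
    by apply: (h (- S) S) => //; apply: complex_ext => /=; ring.
  have e2 : modc (0 - S%:C - (0 + S%:C * 'i)) <= 2 * S.
    by apply: (h (- S) (- S)) => //; apply: complex_ext => /=; ring.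
  have e3 : modc (0 - S%:C * 'i - (0 - S%:C)) <= 2 * S.
    by apply: (h S (- S)) => //; apply: complex_ext => /=; ring.
  have e4 : modc (0 + S%:C - (0 - S%:C * 'i)) <= 2 * S.
    by apply: (h S S) => //; apply: complex_ext => /=; ring.
  by rewrite /edge_length /es /contour_edges /= !big_cons big_nil /=; lra.
apply: (@le_trans _ _ (8 * S * (2 / S * e))); last first.
  by rewrite (_ : _ * (_ * e) = 16 * e) //; field; lra.
apply: (@le_trans _ _ (edge_length es * (2 / S * e))); last first.
  by rewrite ler_wpM2r // mulr_ge0 ?divr_ge0 ?ltW.
apply: (edge_int_bound (nu := nu)); first by apply: lI; rewrite lexx ler01.
move=> z ez; have zd := dz z ez; rewrite subr0 in zd.
rewrite nrmZ modcV mul1r; apply: ler_pM; rewrite ?nu_ge0 ?invr_ge0 ?modc_ge0 //.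
  by rewrite -(invf_div S 2) lef_pV2 ?posrE // (lt_le_trans S20).
by apply: hS1; lra.
Qed.

End Liouville.

Section ResolventIntegral.
Variables (R : realType) (B : topAlgType R[i]) (nu : bnorm B).
Local Notation C := R[i].
Implicit Types (z w l m : C).

(* The difference [N] of the two sides equals [(b - l) F l] for an entire function
   [F]: the integral of [(z - l)^-1 (z - b)^-1] where the contour winds once around
   [l], and [- (l - b)^-1 N] off the spectrum. As [F] vanishes at infinity,
   Liouville's theorem gives [F = 0]. *)
Lemma edge_int_resolvent (G : contour R) (b : B) :
  (forall z, on_edges (contour_edges G) z -> ~ spectrum b z) ->
  (forall z, spectrum b z ->
     edge_int (fun w => (w - z)^-1 : C) (contour_edges G) = two_pi_i R) ->
  edge_int (resolvent b) (contour_edges G) = (two_pi_i R)%:A.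
Proof.
set es := contour_edges G; move=> sG wG.
have lR := lip_edges_resolvent nu sG.
pose N := edge_int (resolvent b) es - (two_pi_i R)%:A.
suff N0 : N = 0 by apply/eqP; rewrite -subr_eq0 -/N N0.
pose good l := ~ on_edges es l /\ edge_int (fun w => (w - l)^-1 : C) es = two_pi_i R.
pose Fg l : B := edge_int (fun z => (z - l)^-1 *: resolvent b z) es.
pose F l : B := if `[< good l >] then Fg l else - (resolvent b l * N).
have sgood l : spectrum b l -> good l.
  by move=> sl; split; [move=> /sG | exact: wG].
have lg l d : 0 < d -> (forall z, on_edges es z -> d <= modc (z - l)) ->
    lip_edges nu (fun z => (z - l)^-1 *: resolvent b z) es.
  by move=> d0 dP; exact: (lip_edges_scale (lip_edges_inv d0 dP) lR).
(* Under the integral, (b - l) (z - l)^-1 (z - b)^-1 = (z - b)^-1 - (z - l)^-1, and the last term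
   integrates to 2 pi i for good l. *)
have Fg_eq l : good l -> (b - l%:A) * Fg l = N.
  move=> [/edges_dist[d d0 dP] wl]; rewrite /Fg.
  rewrite -(edge_int_mull (b - l%:A) (lg l d d0 dP)) /N -wl.
  rewrite -(edge_int_scalar nu 1 (lip_edges_inv d0 dP)).
  rewrite -(edge_intB lR (lip_edges_scalar nu 1 (lip_edges_inv d0 dP))).
  apply: eq_edge_int => z ez; have [rz _] := resolventP (sG z ez).
  have zl : z - l != 0 by apply: (@modc_sub_neq0 _ d) => //; exact: dP.
  have -> : b - l%:A = (z - l)%:A - (z%:A - b).
    by rewrite scalerBl opprB (addrC (_ - _)) addrA subrK.
  by rewrite -scalerAr mulrBl rz -scalerAl mul1r scalerBr scalerA mulVf // scale1r.
have F_off l : ~ spectrum b l -> F l = - (resolvent b l * N).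
  move=> sl; rewrite /F; case: asboolP => // /Fg_eq <-.
  have [_ rl] := resolventP sl.
  have -> : b - l%:A = - (l%:A - b) by rewrite opprB.
  by rewrite mulNr mulrN opprK mulrA rl mul1r.
have F_eq l : (b - l%:A) * F l = N.
  rewrite /F; case: asboolP => [/Fg_eq//|gl].
  have sl : ~ spectrum b l by move=> /sgood.
  have [rl _] := resolventP sl.
  by rewrite mulrN -mulNr opprB mulrA rl mul1r.
have [MR hMR] := lip_edges_bounded lR.
suff F0 : F 0 = 0 by rewrite -(F_eq 0) F0 mulr0.
apply: (liouville (nu := nu)); last first.
  move=> e e0; exists (2 * nu b + 1 + 2 * nu 1 ^+ 2 * nu N / e) => l hl.
  have nb := nu_ge0 nu b; have nN := nu_ge0 nu N.
  have h0 : 0 <= 2 * nu 1 ^+ 2 * nu N / e by apply: divr_ge0; [apply: mulr_ge0 => //;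
    apply: mulr_ge0 => //; exact: sqr_ge0|exact: ltW].
  have l0 : 0 < modc l by lra.
  have bl : 2 * nu b <= modc l by lra.
  have [sl rl] := resolvent_large l0 bl.
  rewrite F_off // nuN (le_trans (nrmM _ _ _)) //.
  rewrite (le_trans (ler_wpM2r nN rl)) // mulrAC ler_pdivrMr // -ler_pdivrMl // mulrC; lra.
(* Near a good point all points are good and [F] is [Fg]. Any other point lies off the spectrum, and
   near it [F_off] applies, whichever branch defines [F]. *)
move=> l0; case: (pselect (good l0)) => gl0.
  have [d0 d00 dP] := edges_dist gl0.1.
  pose d := d0 / 2; have d_gt0 : 0 < d by rewrite divr_gt0.
  have dl l : modc (l - l0) < d -> forall z, on_edges es z -> d <= modc (z - l).
    move=> ll z ez; have := dP z ez; have := modcD (z - l) (l - l0).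
    by rewrite addrA subrK; move: ll; rewrite /d; lra.
  have gd l : modc (l - l0) < d -> good l.
    move=> ll; split.
      by move=> /(dl l ll); rewrite subrr modc0 leNgt d_gt0.
    rewrite -gl0.2; symmetry; apply: (@edge_int_inv_const R G l0 l d d_gt0).
    move=> s z /andP[s0 s1] ez; apply: dl ez.
    rewrite addrC addKr modcM modcR ger0_norm // (le_lt_trans _ ll) //.
    by rewrite ler_piMl ?modc_ge0.
  have Fgd l : modc (l - l0) < d -> F l = Fg l.
    by move=> /gd gl; rewrite /F; case: asboolP.
  have dn : 0 <= d^-1 by rewrite invr_ge0 ltW.
  have inv_le l z : modc (l - l0) < d -> on_edges es z -> modc (z - l)^-1 <= d^-1.
    by move=> ll ez; rewrite modcV lef_pV2 ?posrE ?dl // (lt_le_trans d_gt0) ?dl.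
  pose L := edge_length es.
  have L0 : 0 <= L by apply: sumr_ge0 => e _; exact: modc_ge0.
  (* The terms bound [F], its derivative, which is the integral of (z - l)^-2 (z - b)^-1, and the
     Taylor remainder, whose integrand contains (z - m)^-1 (z - l)^-2. *)
  pose M := L * (d^-1 * `|MR|) + L * (d^-1 ^+ 2 * `|MR|) + L * (d^-1 ^+ 3 * `|MR|).
  have M1 : L * (d^-1 * `|MR|) <= M by rewrite /M -addrA lerDl addr_ge0 // !mulr_ge0 ?exprn_ge0.
  have M2 : L * (d^-1 ^+ 2 * `|MR|)
    <= M by rewrite /M addrAC lerDr addr_ge0 // !mulr_ge0 ?exprn_ge0.
  have M3 : L * (d^-1 ^+ 3 * `|MR|) <= M by rewrite /M lerDr addr_ge0 // !mulr_ge0 ?exprn_ge0.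
  have hR z : on_edges es z -> nu (resolvent b z) <= `|MR|.
    by move=> ez; rewrite (le_trans (hMR z ez)) // ler_norm.
  exists M, d => // l ll; have ld := dl l ll.
  have li := lip_edges_inv d_gt0 ld.
  have l2 : lip_edges nu (fun z => (z - l)^-1 *: ((z - l)^-1 *: resolvent b z)) es.
    exact: (lip_edges_scale li (lg l d d_gt0 ld)).
  split.
    rewrite Fgd // (le_trans _ M1) //; apply: (edge_int_bound (lg l d d_gt0 ld)) => z ez.
    by rewrite nrmZ ler_pM ?modc_ge0 ?nu_ge0 ?inv_le ?hR.
  exists (edge_int (fun z => (z - l)^-1 *: ((z - l)^-1 *: resolvent b z)) es) => [|m mm].
    rewrite (le_trans _ M2) //; apply: (edge_int_bound l2) => z ez.
    by rewrite scalerA nrmZ modcM -expr2 ler_pM ?exprn_ge0 ?modc_ge0 ?nu_ge0 ?hR //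
      lerXn2r ?nnegrE ?modc_ge0 ?inv_le.
  have md := dl m mm.
  rewrite !Fgd // -(edge_intB (lg m d d_gt0 md) (lg l d d_gt0 ld)).
  rewrite -(edge_intZ (m - l) l2).
  rewrite -(edge_intB (lip_edgesB (lg m d d_gt0 md) (lg l d d_gt0 ld)) (lip_edgesZ (m - l) l2)).
  rewrite (@le_trans _ _ (L * (d^-1 ^+ 3 * `|MR| * modc (m - l) ^+ 2))) //; last first.
    by rewrite mulrA ler_wpM2r ?sqr_ge0.
  apply: (edge_int_bound (lip_edgesB (lip_edgesB (lg m d d_gt0 md) (lg l d d_gt0 ld))
    (lip_edgesZ (m - l) l2))) => z ez.
  have zl : z - l != 0 by apply: (@modc_sub_neq0 _ d) => //; exact: ld.
  have zm : z - m != 0 by apply: (@modc_sub_neq0 _ d) => //; exact: md.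
  have -> : (z - m)^-1 *: resolvent b z - (z - l)^-1 *: resolvent b z -
     (m - l) *: ((z - l)^-1 *: ((z - l)^-1 *: resolvent b z)) =
     ((m - l) ^+ 2 * ((z - m)^-1 * ((z - l)^-1 * (z - l)^-1))) *: resolvent b z.
    by rewrite !scalerA -!scalerBl; congr (_ *: _); field; rewrite zl zm.
  rewrite nrmZ modcM modcX -mulrA [leRHS]mulrC ler_wpM2l ?sqr_ge0 // !modcM !exprS expr0 mulr1.
  by rewrite ?ler_pM ?mulr_ge0 ?modc_ge0 ?nu_ge0 ?hR ?inv_le.
have sl0 : ~ spectrum b l0 by move=> /sgood.
have [M0 [d d0 dP]] := resolvent_local nu sl0.
pose M := `|M0|.
have dR l : modc (l - l0) < d -> nu (resolvent b l) <= M.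
  by move=> /dP[_ h]; rewrite (le_trans h) // ler_norm.
have dS l : modc (l - l0) < d -> ~ spectrum b l by move=> /dP[].
have Mg : 0 <= M by exact: normr_ge0.
have nN := nu_ge0 nu N.
pose K := M * nu N + M * M * nu N + M * M * M * nu N.
have K1 : M * nu N <= K by rewrite /K -addrA lerDl addr_ge0 // !mulr_ge0.
have K2 : M * M * nu N <= K by rewrite /K addrAC lerDr addr_ge0 // !mulr_ge0.
have K3 : M * M * M * nu N <= K by rewrite /K lerDr addr_ge0 // !mulr_ge0.
exists K, d => // l ll; split.
  rewrite F_off; last exact: dS.
  rewrite nuN (le_trans (nrmM _ _ _)) // (le_trans _ K1) // ler_wpM2r //.
  exact: dR.
exists (resolvent b l * resolvent b l * N) => [|m mm].
  rewrite (le_trans (nrmM _ _ _)) // (le_trans _ K2) // ler_wpM2r //.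
  by rewrite (le_trans (nrmM _ _ _)) // ler_pM ?nu_ge0 ?dR.
rewrite !F_off; [|exact: dS|exact: dS].
have -> : - (resolvent b m * N) - - (resolvent b l * N) - (m - l) *: (resolvent b l *
  resolvent b l * N) =
   ((m - l) * (l - m)) *: (resolvent b m * resolvent b l * resolvent b l * N).
  have e := resolvent_identity (dS m mm) (dS l ll).
  rewrite -opprD -mulrBl e -scalerAl -scaleNr opprB -scalerBr -!mulrBl e.
  by rewrite -!scalerAl scalerA.
rewrite nrmZ modcM modcB -expr2 mulrC ler_wpM2r ?sqr_ge0 // (le_trans _ K3) //.
rewrite (le_trans (nrmM _ _ _)) // ler_wpM2r //.
rewrite (le_trans (nrmM _ _ _)) // ler_pM ?nu_ge0 ?dR //.
by rewrite (le_trans (nrmM _ _ _)) // ler_pM ?nu_ge0 ?dR.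
Qed.

End ResolventIntegral.

(** * The exponential in the holomorphic calculus *)

Section HolomorphicExp.
Variables (R : realType) (B : topAlgType R[i]) (nu : bnorm B).
Local Notation C := R[i].
Local Notation mu := (modc_bnorm R).
Implicit Types (z w : C) (x y b : B) (G : contour R).

Lemma surrounds_off G b U : surrounds G (spectrum b) U ->
  forall z, on_edges (contour_edges G) z -> ~ spectrum b z.
Proof. by move=> [GU _ _] z /GU[]. Qed.

Lemma surrounds_on G b U : surrounds G (spectrum b) U ->
  forall z, on_edges (contour_edges G) z -> U z.
Proof. by move=> [GU _ _] z /GU[]. Qed.

Lemma surrounds_winding G b U : surrounds G (spectrum b) U -> forall z, spectrum b z ->
  edge_int (fun w => (w - z)^-1 : C) (contour_edges G) = two_pi_i R.
Proof.
move=> [_ G1 _] z /G1; rewrite /winding => e.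
by rewrite -[RHS]mulr1 -e mulrA divff ?mul1r ?two_pi_i_neq0.
Qed.

Lemma surrounds_exterior G b U : surrounds G (spectrum b) U -> forall z, ~ U z ->
  edge_int (fun w => (w - z)^-1 : C) (contour_edges G) = 0.
Proof.
move=> [_ _ G0] z /G0 /eqP; rewrite mulf_eq0 invr_eq0 (negPf (two_pi_i_neq0 R)) /=.
by move=> /eqP.
Qed.

Lemma expr_taylor n (M : R) : exists K : R, forall x y : C, modc x <= M -> modc y <= M ->
  modc (x ^+ n.+1 - y ^+ n.+1 - n.+1%:R * (x - y) * y ^+ n) <= K * modc (x - y) ^+ 2.
Proof.
elim: n => [|n [K hK]].
  by exists 0 => x y _ _; rewrite !expr1 expr0 mulr1 mul1r subrr modc0 mul0r.
exists (M * K + n.+1%:R * M ^+ n) => x y xM yM.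
have M0 := le_trans (modc_ge0 _) xM.
have -> : x ^+ n.+2 - y ^+ n.+2 - n.+2%:R * (x - y) * y ^+ n.+1 =
  x * (x ^+ n.+1 - y ^+ n.+1 - n.+1%:R * (x - y) * y ^+ n) + n.+1%:R * y ^+ n * (x - y) ^+ 2.
  by rewrite -(natr1 n.+1) (exprS x n.+1) (exprS y n.+1) (exprS y n); ring.
rewrite (le_trans (modcD _ _)) // mulrDl lerD //.
  by rewrite modcM -[leRHS]mulrA ler_pM ?modc_ge0 // hK.
rewrite !modcM modc_nat !modcX ler_wpM2r ?sqr_ge0 // ler_wpM2l //.
by rewrite lerXn2r ?nnegrE ?modc_ge0.
Qed.

Definition affine (a z : C) : C := 1 + a * z.

Lemma lip_edges_affine a es : lip_edges mu (affine a) es.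
Proof. exact: (lip_edgesD (lip_edges_cst _ 1 es) (lip_edgesZ a (lip_edges_id es))). Qed.

Lemma lip_edges_affineX a n es : lip_edges mu (fun z => affine a z ^+ n) es.
Proof.
elim: n => [|n IH]; first exact: (lip_edges_cst _ 1 es).
have := lip_edges_scale (lip_edges_affine a es) IH.
by congr (lip_edges mu _ es); apply/funext => z; rewrite exprS.
Qed.

Lemma contour_int_affineX G (a : C) n :
  edge_int (fun z => affine a z ^+ n * a : C) (contour_edges G) = 0.
Proof.
have [M hM] := lip_edges_bounded (lip_edges_affine a (contour_edges G)).
have [K hK] := expr_taylor n M.
pose F z : C := n.+1%:R^-1 * affine a z ^+ n.+1.
rewrite (@edge_int_ftc _ _ mu F _ _ (K * modc a ^+ 2)); first exact: (contour_closed F).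
move=> e ees z w ez ew.
have hz : modc (affine a z) <= M by apply: hM; exists e.
have hw : modc (affine a w) <= M by apply: hM; exists e.
have n0 : n.+1%:R != 0 :> C by rewrite pnatr_eq0.
have d : affine a w - affine a z = a * (w - z) by rewrite /affine; ring.
rewrite [X in mu X](_ : _ = n.+1%:R^-1 * (affine a w ^+ n.+1 - affine a z ^+ n.+1 -
    n.+1%:R * (affine a w - affine a z) * affine a z ^+ n)); last first.
  by rewrite d /F -[_ *: _]/(_ * _); move: n0; move: (n.+1%:R : C) => k k0; field.
rewrite /= modcM modcV modc_nat ler_pdivrMl ?ltr0n //.
rewrite (le_trans (hK _ _ hw hz)) // d modcM exprMn mulrA ler_peMl ?ler1n //.
by rewrite -mulrA -exprMn -modcM -d (le_trans _ (hK _ _ hw hz)) ?modc_ge0.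
Qed.

(** From z (z - b)^-1 = 1 + b (z - b)^-1 one gets (1 + a z) (z - b)^-1 = a + (1 + a b) (z - b)^-1.
    Each induction step thus extracts a factor 1 + a b, and the scalar part integrates to 0. *)
Lemma contour_int_power G b (a : C) n :
  (forall z, on_edges (contour_edges G) z -> ~ spectrum b z) ->
  (forall z, spectrum b z ->
     edge_int (fun w => (w - z)^-1 : C) (contour_edges G) = two_pi_i R) ->
  edge_int (fun z => affine a z ^+ n *: resolvent b z) (contour_edges G) =
  two_pi_i R *: (1 + a *: b) ^+ n.
Proof.
set es := contour_edges G; move=> sG wG.
have lR := lip_edges_resolvent nu sG.
have l1 k : lip_edges nu (fun z => affine a z ^+ k *: resolvent b z) es.
  exact: (lip_edges_scale (lip_edges_affineX a k es) lR).
have l2 k : lip_edges mu (fun z => affine a z ^+ k * a) es.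
  exact: (lip_edges_scale (lip_edges_affineX a k es) (lip_edges_cst _ a es)).
elim: n => [|n IH].
  rewrite expr0 -(edge_int_resolvent nu sG wG).
  by apply: eq_edge_int => z _; rewrite expr0 scale1r.
transitivity (edge_int (fun z => (affine a z ^+ n * a) *: (1 : B) +
    (1 + a *: b) * (affine a z ^+ n *: resolvent b z)) es).
  apply: eq_edge_int => z ez; have [rz _] := resolventP (sG z ez).
  rewrite exprSr -!scalerA -scalerAr -scalerDr; congr (_ *: _).
  rewrite -{1}rz [a *: (_ * _)]scalerAl -mulrDl scalerBr scalerA addrCA subrK.
  by rewrite /affine scalerDl scale1r mulrDl mul1r -scalerAl mul1r.
rewrite (edge_intD (lip_edges_scalar nu 1 (l2 n)) (lip_edges_mull (1 + a *: b) (l1 n))).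
rewrite (edge_int_scalar nu 1 (l2 n)) contour_int_affineX scale0r add0r.
by rewrite (edge_int_mull _ (l1 n)) IH -scalerAr exprS.
Qed.

Lemma lip_edges_cexp es : lip_edges mu (@cexp R) es.
Proof.
have [M hM] := lip_edges_bounded (lip_edges_id es).
exists (expR M * (1 + 4 * (2 * M) * expR (2 * M))) => e ees z w ez ew.
have hz : modc z <= M by apply: hM; exists e.
have hw : modc w <= M by apply: hM; exists e.
have -> : cexp z - cexp w = cexp w * (cexp (z - w) - 1).
  by rewrite mulrBr mulr1 -cexpD (addrC w) subrK.
have d2 : modc (z - w) <= 2 * M.
  by have := modcD z (- w); rewrite modcN; lra.
have d0 := modc_ge0 (z - w).
rewrite /= modcM -mulrA; apply: ler_pM; rewrite ?modc_ge0 //.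
  by rewrite (le_trans (modc_cexp_le _)) // ler_expR.
rewrite -[cexp _ - 1](subrK (z - w)) (le_trans (modcD _ _)) // addrC mulrDl mul1r lerD2l.
rewrite (le_trans (modc_cexpB1B_le _)) // expr2 !mulrA mulrAC ler_wpM2r //.
rewrite -!mulrA ler_wpM2l // mulrA; apply: ler_pM; rewrite ?expR_ge0 ?ler_expR //.
Qed.

(* For [(1 + z/n)^n] the calculus reduces to [edge_int_resolvent], and such powers
   approximate the exponential uniformly on the contour. *)
Definition compound b n : B := (1 + n.+1%:R^-1 *: b) ^+ n.+1.

(** The sequence does not mention the contour, so all admissible contours yield the same value and
    the choice made by [hfc] is harmless. *)
Lemma is_hfc_exp_rate b c : is_hfc (@cexp R) b c -> rate nu (compound b) c.
Proof.
move=> [U [G [_ _ sG ->]]].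
have hs := surrounds_off sG; have hw := surrounds_winding sG.
set es := contour_edges G.
have lR : lip_edges nu (resolvent b) es := lip_edges_resolvent nu hs.
have [MR hMR] := lip_edges_bounded lR.
have [M hM] := lip_edges_bounded (lip_edges_id es).
have le : lip_edges nu (fun z => cexp z *: resolvent b z) es.
  exact: (lip_edges_scale (lip_edges_cexp es) lR).
pose t := modc (two_pi_i R)^-1.
exists (t * (edge_length es * (4 * M ^+ 2 * expR (2 * M) * `|MR|))) => n.
have lp : lip_edges nu (fun z => affine n.+1%:R^-1 z ^+ n.+1 *: resolvent b z) es.
  exact: (lip_edges_scale (lip_edges_affineX _ _ es) lR).
have -> : compound b n = (two_pi_i R)^-1 *: edge_int (fun z =>
  affine n.+1%:R^-1 z ^+ n.+1 *: resolvent b z) es.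
  by rewrite contour_int_power // scalerA mulVf ?scale1r ?two_pi_i_neq0.
rewrite -[contour_integral _ _]/(edge_int (fun z => cexp z *: resolvent b z) es).
rewrite -scalerBr -(edge_intB lp le) nrmZ -[leRHS]mulrA ler_wpM2l ?modc_ge0 //.
rewrite -mulrA mulrAC; apply: (edge_int_bound (lip_edgesB lp le)) => z ez.
rewrite -scalerBl nrmZ; apply: ler_pM; rewrite ?modc_ge0 ?nu_ge0 //.
  by rewrite /affine cexp_compound //; exact: hM.
by rewrite (le_trans (hMR z ez)) // ler_norm.
Qed.

Lemma hfc_exp_ex b : exists c, is_hfc (@cexp R) b c.
Proof.
(* On the diamond the modulus is at least r / 2 = 2 nu b + 1, beyond the spectrum, while [norm1] is
   below r on the spectrum. *)
pose r := 4 * nu b + 2; have nb := nu_ge0 nu b.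
have r0 : 0 <= r by rewrite /r; lra.
exists ((two_pi_i R)^-1 *: contour_integral (diamond 0 r) (fun z => cexp z *: resolvent b z)).
exists setT, (diamond 0 r); split=> //.
  by split; [exact: openT | move=> z _; exact: derivable_cexp].
split=> //.
  move=> z hz; split=> //.
  have zr := diamond_norm1 r0 hz; rewrite subr0 in zr.
  have := norm1_le z; rewrite zr /r => h.
  have z1 : 0 < modc z by lra.
  have z2 : 2 * nu b <= modc z by lra.
  by have [] := resolvent_large z1 z2.
move=> z sz; rewrite /winding -[contour_integral _ _]/(edge_int (fun w =>
  (w - z)^-1 : C) (contour_edges (diamond 0 r))).
rewrite diamond_winding ?mulVf ?two_pi_i_neq0 // subr0.
have := norm1_le z; have := modc_ge0 z => z0 n2.
have [zb|zb] := ltP (modc z) (2 * nu b + 1); first by rewrite /r; lra.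
have z1 : 0 < modc z by lra.
have z2 : 2 * nu b <= modc z by lra.
  by have [h _] := resolvent_large z1 z2; case: (h sz).
by move=> z [].
Qed.

Definition bexp b : B := hfc (@cexp R) b.

Lemma bexp_rate b : rate nu (compound b) (bexp b).
Proof.
rewrite /bexp /hfc; case: xgetP => [c _ |h]; first exact: is_hfc_exp_rate.
by have [c hc] := hfc_exp_ex b; case: (h c).
Qed.

End HolomorphicExp.

Section BanachExp.
Variables (R : realType) (B : topAlgType R[i]) (nu : bnorm B).
Local Notation C := R[i].
Local Open Scope complex_scope.
Implicit Types (x y a b : B).

(** Bounding the action on y, rather than the power itself, keeps the factor [nu 1] from being
    raised to the power n. *)
Lemma pow1D_bound x y n : nu ((1 + x) ^+ n * y) <= (1 + nu x) ^+ n * nu y.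
Proof.
elim: n => [|n IH]; first by rewrite !expr0 !mul1r.
rewrite !exprS -!mulrA mulrDl mul1r (le_trans (nrmD _ _ _)) // mulrDl mul1r lerD //.
by rewrite (le_trans (nrmM _ _ _)) // ler_wpM2l ?nu_ge0.
Qed.

Lemma pow1D_sub x y n (e : R) : nu x <= e -> nu y <= e ->
  nu ((1 + x) ^+ n - (1 + y) ^+ n) <= n%:R * (1 + e) ^+ n * nu 1 * nu (x - y).
Proof.
move=> xe ye; have e0 := le_trans (nu_ge0 nu x) xe; have n1 := nu_ge0 nu 1.
have nxy := nu_ge0 nu (x - y).
elim: n => [|n IH]; first by rewrite !expr0 subrr nu0 !mul0r.
have -> : (1 + x) ^+ n.+1 - (1 + y) ^+ n.+1 =
    (1 + x) * ((1 + x) ^+ n - (1 + y) ^+ n) + (x - y) * ((1 + y) ^+ n * 1).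
  have -> : x - y = (1 + x) - (1 + y) by rewrite opprD addrACA subrr add0r.
  by rewrite mulr1 mulrBr mulrBl -!exprS addrA subrK.
rewrite (le_trans (nrmD _ _ _)) //.
pose T := (1 + e) ^+ n; have T0 : 0 <= T by rewrite exprn_ge0 // addr_ge0.
have h1 : nu ((1 + x) * ((1 + x) ^+ n - (1 + y) ^+ n)) <= (1 + e) * (n%:R * T * nu 1 * nu (x - y)).
  have := pow1D_bound x ((1 + x) ^+ n - (1 + y) ^+ n) 1; rewrite !expr1 => /le_trans; apply.
  by apply: ler_pM; rewrite ?nu_ge0 ?lerD2l ?addr_ge0 ?nu_ge0.
have h2 : nu ((x - y) * ((1 + y) ^+ n * 1)) <= nu (x - y) * (T * nu 1).
  rewrite (le_trans (nrmM _ _ _)) // ler_wpM2l // (le_trans (pow1D_bound _ _ _)) //.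
  by rewrite ler_wpM2r // lerXn2r ?nnegrE ?addr_ge0 ?nu_ge0 // lerD2l.
have h3 : nu (x - y) * (T * nu 1) <= (1 + e) * (T * nu 1 * nu (x - y)).
  rewrite mulrC ler_peMl ?mulr_ge0 //; lra.
have -> : n.+1%:R * (1 + e) ^+ n.+1 * nu 1 * nu (x - y) =
  (1 + e) * (n%:R * T * nu 1 * nu (x - y)) + (1 + e) * (T * nu 1 * nu (x - y)).
  by rewrite -(natr1 n) exprS /T; ring.
lra.
Qed.

Lemma pow1D_expR (K : R) n : 0 <= K -> (1 + K / n.+1%:R) ^+ n.+1 <= expR K.
Proof.
move=> K0; rewrite -[X in expR X](_ : n.+1%:R * (K / n.+1%:R) = K); last first.
  by rewrite mulrCA divff ?mulr1 ?pnatr_eq0.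
rewrite expRM_natl lerXn2r ?nnegrE ?expR_ge0 ?expR_ge1Dx //.
by rewrite addr_ge0 ?divr_ge0.
Qed.

Lemma nu_invn x n : nu (n.+1%:R^-1 *: x) = nu x / n.+1%:R.
Proof. by rewrite nrmZ modcV modc_nat mulrC. Qed.

Lemma compound_bound x n : nu (compound x n) <= expR (nu x) * nu 1.
Proof.
rewrite /compound -[_ ^+ _]mulr1 (le_trans (pow1D_bound _ _ _)) //.
by rewrite ler_wpM2r ?nu_ge0 // nu_invn pow1D_expR ?nu_ge0.
Qed.

Lemma rate_bound (u : nat -> B) v (M : R) : rate nu u v -> (forall n, nu (u n) <= M) -> nu v <= M.
Proof.
move=> [K uK] uM; rewrite -subr_le0; apply: (@le0_of_rate _ _ K) => n.
have := nu_subD nu v (u n) 0; rewrite !subr0 (nuB nu v (u n)).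
by have := uK n; have := uM n; move: (K / _) => k; lra.
Qed.

Lemma bexp_bound x : nu (bexp x) <= expR (nu x) * nu 1.
Proof. exact: (rate_bound (bexp_rate nu x) (compound_bound x)). Qed.

Lemma rateM (u u' : nat -> B) v v' (M : R) : rate nu u v -> rate nu u' v' ->
  (forall n, nu (u n) <= M) -> rate nu (fun n => u n * u' n) (v * v').
Proof.
move=> [K uK] [K' uK'] uM; exists (M * K' + K * nu v') => n.
have -> : u n * u' n - v * v' = u n * (u' n - v') + (u n - v) * v'.
  by rewrite mulrBr mulrBl addrA subrK.
rewrite (le_trans (nrmD _ _ _)) // [leRHS]mulrDl lerD // (le_trans (nrmM _ _ _)) //.
  by rewrite -[leRHS]mulrA ler_pM ?nu_ge0.
by rewrite mulrAC ler_wpM2r ?nu_ge0.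
Qed.

Lemma rate_perturb (u u' : nat -> B) v (K : R) : rate nu u v ->
  (forall n, nu (u' n - u n) <= K / n.+1%:R) -> rate nu u' v.
Proof.
move=> [L uL] hK; exists (K + L) => n.
by rewrite mulrDl (le_trans (nu_subD nu _ (u n) _)) // lerD.
Qed.

Lemma bexp_commute x c : c * x = x * c -> c * bexp x = bexp x * c.
Proof.
move=> cx; have h := bexp_rate nu x.
have cn n : c * compound x n = compound x n * c.
  apply: commrX; rewrite /GRing.comm mulrDr mulrDl mulr1 mul1r; congr (_ + _).
  by rewrite -scalerAr cx scalerAl.
have h1 := rateM (rate_const nu c) h (fun n => lexx _).
have h2 := rateM h (rate_const nu c) (compound_bound x).
apply: (rate_unique h1); have -> // : (fun n => c * compound x n) = (fun n => compound x n * c).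
by apply/funext.
Qed.

(** With m = n + 1, the product of the two powers is that of 1 + (x + y) / m + x y / m^2. Its base
    differs by O(1 / m^2) from that of [compound (x + y) n], hence the powers differ by O(1 / m). *)
Lemma bexpD x y : x * y = y * x -> bexp (x + y) = bexp x * bexp y.
Proof.
move=> xy; have hx := bexp_rate nu x; have hy := bexp_rate nu y.
have hxy := rateM hx hy (compound_bound x).
apply: (rate_unique (bexp_rate nu (x + y))).
pose E := nu x + nu y + nu x * nu y.
have nx := nu_ge0 nu x; have ny := nu_ge0 nu y; have n1 := nu_ge0 nu 1.
have E0 : 0 <= E by rewrite !addr_ge0 ?mulr_ge0.
apply: (rate_perturb hxy (K := expR E * nu 1 * (nu x * nu y))) => n; move: n.
suff h n : nu (compound (x + y) n - compound x n * compound y n) <=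
    expR E * nu 1 * (nu x * nu y) / n.+1%:R by exact: h.
pose k : C := n.+1%:R^-1.
have -> : compound x n * compound y n = (1 + ((k *: x + k *: y) + (k *: x) * (k *: y))) ^+ n.+1.
  rewrite /compound -exprMn_comm.
    by congr (_ ^+ _); rewrite -/k mulrDl mul1r mulrDr mulr1 addrACA -!addrA (addrC (k *: x)).
  rewrite /GRing.comm !mulrDl !mulrDr !mul1r !mulr1 -!addrA; congr (_ + _).
  rewrite addrCA; congr (_ + (_ + _)).
  by rewrite -!scalerAr -!scalerAl xy !scalerA mulrC.
have n0 : 0 < n.+1%:R :> R by [].
have inv1 : n.+1%:R^-1 <= 1 :> R by rewrite invf_le1 // ler1n.
have e1 : nu (k *: x) = nu x / n.+1%:R := nu_invn x n.
have e2 : nu (k *: y) = nu y / n.+1%:R := nu_invn y n.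
have b3 : nu ((k *: x) * (k *: y)) <= nu x * nu y / n.+1%:R ^+ 2.
  rewrite (le_trans (nrmM _ _ _)) // e1 e2 mulrACA expr2 invfM; exact: lexx.
have b4 : nu x * nu y / n.+1%:R ^+ 2 <= nu x * nu y / n.+1%:R.
  by rewrite ler_wpM2l ?mulr_ge0 // expr2 invfM ler_piMl.
have b1 : nu (n.+1%:R^-1 *: (x + y)) <= E / n.+1%:R.
  rewrite nu_invn ler_wpM2r // (le_trans (nrmD _ _ _)) // lerDl mulr_ge0 //.
have b2 : nu (k *: x + k *: y + k *: x * (k *: y)) <= E / n.+1%:R.
  rewrite (le_trans (nrmD _ _ _)) // [leRHS]mulrDl lerD //; last exact: le_trans b4.
  by rewrite -scalerDr nu_invn ler_wpM2r // nrmD.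
rewrite (le_trans (pow1D_sub _ b1 b2)) // scalerDr opprD addrA subrr add0r nuN.
have := pow1D_expR n E0 => pe.
have p0 : 0 <= (1 + E / n.+1%:R) ^+ n.+1 by rewrite exprn_ge0 // addr_ge0 // mulr_ge0.
apply: (@le_trans _ _ (n.+1%:R * expR E * nu 1 * (nu x * nu y / n.+1%:R ^+ 2))).
  apply: ler_pM; rewrite ?nu_ge0 ?mulr_ge0 //.
  by rewrite ler_wpM2r // ler_wpM2l.
rewrite le_eqVlt; apply/orP; left; apply/eqP.
by move: n0; clear; move: (n.+1%:R : R) => m m0; field; lra.
Qed.

Lemma bexp0 : bexp 0 = 1 :> B.
Proof.
apply: (rate_unique (bexp_rate nu 0)); have := rate_const nu (1 : B).
congr (rate nu _ 1); apply/funext => n.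
by rewrite /compound scaler0 addr0 expr1n.
Qed.

Lemma bexpN x : bexp x * bexp (- x) = 1.
Proof. by rewrite -bexpD ?subrr ?bexp0 // mulrN mulNr. Qed.

Lemma pow1D_taylor x n (e : R) : nu x <= e ->
  nu ((1 + x) ^+ n - 1 - x *+ n) <= n%:R ^+ 2 * (1 + e) ^+ n * nu 1 * e ^+ 2.
Proof.
move=> xe; have e0 := le_trans (nu_ge0 nu x) xe; have n1 := nu_ge0 nu 1.
elim: n => [|n IH]; first by rewrite expr0 mulr0n subrr subr0 nu0 expr0n !mul0r.
have -> : (1 + x) ^+ n.+1 - 1 - x *+ n.+1 =
    ((1 + x) ^+ n - 1 - x *+ n) + x * ((1 + x) ^+ n - (1 + 0) ^+ n).
  rewrite addr0 expr1n mulrBr mulr1 exprS mulrDl mul1r mulrSr opprD.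
  rewrite !addrA [(1 + x) ^+ n + _ - 1]addrAC.
  by congr (_ - _); rewrite addrAC.
have ye : nu (0 : B) <= e by rewrite nu0.
have := pow1D_sub n xe ye; rewrite subr0 => h.
rewrite (le_trans (nrmD _ _ _)) //.
pose T := (1 + e) ^+ n; have T0 : 0 <= T by rewrite exprn_ge0 // addr_ge0.
have h1 : nu (x * ((1 + x) ^+ n - (1 + 0) ^+ n)) <= e * (n%:R * T * nu 1 * e).
  rewrite (le_trans (nrmM _ _ _)) //; apply: ler_pM; rewrite ?nu_ge0 //.
  by rewrite (le_trans h) // ler_wpM2l // !mulr_ge0.
apply: le_trans (lerD IH h1) _; rewrite -/T.
have -> : n%:R ^+ 2 * T * nu 1 * e ^+ 2 + e * (n%:R * T * nu 1 * e) =
  (n%:R ^+ 2 + n%:R) * (T * nu 1 * e ^+ 2) by ring.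
have -> : n.+1%:R ^+ 2 * (1 + e) ^+ n.+1 * nu 1 * e ^+ 2 =
   (n.+1%:R ^+ 2 * (1 + e)) * (T * nu 1 * e ^+ 2).
  by rewrite (exprS (1 + e) n) /T; ring.
have W0 : 0 <= T * nu 1 * e ^+ 2 by rewrite !mulr_ge0.
apply: ler_wpM2r => //; rewrite -natr1.
have : 0 <= n%:R :> R by [].
by move: (n%:R : R) => m m0; nra.
Qed.

Lemma bexp_taylor x : nu (bexp x - 1 - x) <= expR (nu x) * nu 1 * nu x ^+ 2.
Proof.
have n1 := nu_ge0 nu 1; have nx := nu_ge0 nu x.
have h : rate nu (fun n => compound x n + (- 1 - x)) (bexp x + (- 1 - x)).
  exact: (rateD (bexp_rate nu x) (rate_const nu _)).
rewrite addrA in h; apply: (rate_bound h) => n; rewrite addrA.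
have := @pow1D_taylor (n.+1%:R^-1 *: x) n.+1 (nu x / n.+1%:R).
rewrite nu_invn => /(_ (lexx _)).
have -> : (n.+1%:R^-1 *: x) *+ n.+1 = x.
  by rewrite -scaler_nat scalerA mulfV ?scale1r ?pnatr_eq0.
move=> h2; apply: (le_trans h2).
apply: (@le_trans _ _ (n.+1%:R ^+ 2 * expR (nu x) * nu 1 * (nu x / n.+1%:R) ^+ 2)).
  rewrite ler_wpM2r ?exprn_ge0 ?divr_ge0 // ler_wpM2r // ler_wpM2l ?exprn_ge0 //.
  exact: pow1D_expR.
have n0 : 0 < n.+1%:R :> R by [].
rewrite le_eqVlt; apply/orP; left; apply/eqP.
by move: n0; clear; move: (n.+1%:R : R) => m m0; field; lra.
Qed.

(* [D' = D X] and [L' = X] in integrated form; [D t * bexp (- L t)] is constant. *)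
Lemma ode_exp (D L X : R -> B) (K : R) : D 0 = 1 -> L 0 = 0 ->
  (forall t, 0 <= t <= 1 -> [/\ nu (D t) <= K, nu (L t) <= K & nu (X t) <= K]) ->
  (forall s t, 0 <= s <= 1 -> 0 <= t <= 1 ->
     nu (D s - D t * (1 + (s - t)%:C *: X t)) <= K * (s - t) ^+ 2) ->
  (forall s t, 0 <= s <= 1 -> 0 <= t <= 1 ->
     nu (L s - L t - (s - t)%:C *: X t) <= K * (s - t) ^+ 2) ->
  (forall s t, 0 <= s <= 1 -> 0 <= t <= 1 -> L s * L t = L t * L s) ->
  D 1 = bexp (L 1).
Proof.
move=> D0 L0 bd hD hL cL.
have i0 : 0 <= (0 : R) <= 1 by rewrite lexx ler01.
have K0 : 0 <= K by have [h _ _] := bd 0 i0; exact: le_trans (nu_ge0 _ _) h.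
have n1 := nu_ge0 nu 1.
pose E t := D t * bexp (- L t).
suff E10 : E 1 = E 0.
  rewrite -[D 1]mulr1 -(bexpN (- L 1)) opprK mulrA -/(E 1) E10 /E D0 L0 oppr0.
  by rewrite bexp0 !mul1r.
pose c1 := expR (K + K) * nu 1.
pose M := (K * c1 + K * ((nu 1 + K) * (c1 * (K + K) ^+ 2 + K)) + K * K ^+ 2) * c1.
apply: (@const_of_quadratic R B nu E M) => s t s01 t01.
have [Dt Lt Xt] := bd t t01; have [Ds Ls Xs] := bd s s01.
pose d := s - t; pose dl := L s - L t; pose e := bexp (- dl).
have d1 : d ^+ 2 <= `|d|.
  rewrite -real_normK ?num_real // expr2 ler_piMl //.
  by rewrite /d ler_norml; lra.
have d0 : 0 <= d ^+ 2 by exact: sqr_ge0.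
have dd1 : `|d| <= 1 by rewrite /d ler_norml; lra.
have ndl : nu dl <= (K + K) * `|d|.
  rewrite -[dl](subrK (d%:C *: X t)) (le_trans (nrmD _ _ _)) // mulrDl lerD //.
    by rewrite (le_trans (hL s t s01 t01)) // ler_wpM2l.
  by rewrite nrmZ modcR mulrC ler_wpM2r.
have ndl1 : nu dl <= K + K by rewrite (le_trans ndl) // ler_piMr // addr_ge0.
have ec1 : nu e <= c1.
  by rewrite (le_trans (bexp_bound _)) // nuN ler_wpM2r // ler_expR.
have etc1 : nu (bexp (- L t)) <= c1.
  rewrite (le_trans (bexp_bound _)) // nuN ler_wpM2r // ler_expR.
  by rewrite (le_trans Lt) // lerDl.
(* As [L s] and [L t] commute, bexp (- L s) = e * bexp (- L t). *)
have -> : E s - E t = (D s * e - D t) * bexp (- L t).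
  rewrite mulrBl; congr (_ - _); rewrite /E -mulrA -bexpD.
    by rewrite -opprD subrK.
  by rewrite mulNr mulrN mulNr mulrN /dl mulrBl mulrBr (cL s t).
rewrite (le_trans (nrmM _ _ _)) // /M mulrAC; apply: ler_pM; rewrite ?nu_ge0 //.
pose P := D s - D t * (1 + d%:C *: X t).
pose Q := e - (1 - d%:C *: X t).
have nP : nu P <= K * d ^+ 2 by exact: hD.
have nQ : nu Q <= (c1 * (K + K) ^+ 2 + K) * d ^+ 2.
  have -> : Q = (e - 1 - - dl) - (dl - d%:C *: X t).
    rewrite /Q; move: (e) (dl) (d%:C *: X t) => x y z.
    by rewrite opprK !opprD !opprK !addrA addrK.
  rewrite (le_trans (nrmD _ _ _)) // nuN [leRHS]mulrDl lerD //; last exact: hL.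
  rewrite (le_trans (bexp_taylor _)) // nuN -[leRHS]mulrA.
  apply: ler_pM; rewrite ?exprn_ge0 ?mulr_ge0 ?expR_ge0 ?nu_ge0 //.
    by rewrite ler_wpM2r // ler_expR.
  rewrite -(real_normK (num_real d)) -exprMn lerXn2r ?nnegrE ?nu_ge0 //.
  by rewrite mulr_ge0 ?addr_ge0.
(* Three errors of second order: in the equation for [D], in the expansion of [e], and in (1 + d X)
   (1 - d X) = 1 - (d X)^2. They are the three summands of [M]. *)
have -> : D s * e - D t = P * e + D t * ((1 + d%:C *: X t) * Q) - D t * ((d%:C *: X t) ^+ 2).
  rewrite /P /Q; move: (d%:C *: X t) (D t) (D s) => x y z.
  have h : (1 + x) * (1 - x) = 1 - x ^+ 2.
    by rewrite mulrDl mul1r mulrBr mulr1 addrA subrK expr2.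
  rewrite (mulrBr (1 + x)) h mulrBl (mulrBr y) -[y * (1 + x) * e]mulrA addrA subrK.
  by rewrite mulrBr mulr1 opprB addrA -[RHS]addrA (addrC (- y)) addrA addrK.
rewrite (le_trans (nrmD _ _ _)) // nuN [leRHS]mulrDl [X in _ <= X + _]mulrDl; apply: lerD.
  rewrite (le_trans (nrmD _ _ _)) //; apply: lerD.
    by rewrite (le_trans (nrmM _ _ _)) // mulrAC; apply: ler_pM; rewrite ?nu_ge0.
  rewrite (le_trans (nrmM _ _ _)) // -[leRHS]mulrA -[X in K * X]mulrA.
  apply: ler_pM; rewrite ?nu_ge0 //.
  rewrite (le_trans (nrmM _ _ _)) //; apply: ler_pM; rewrite ?nu_ge0 //.
    rewrite (le_trans (nrmD _ _ _)) // lerD2l nrmZ modcR.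
    by rewrite (le_trans _ Xt) // ler_piMl ?nu_ge0.
rewrite (le_trans (nrmM _ _ _)) // -mulrA; apply: ler_pM; rewrite ?nu_ge0 //.
rewrite expr2 (le_trans (nrmM _ _ _)) // !nrmZ !modcR mulrACA -expr2 real_normK ?num_real //.
by rewrite mulrC ler_wpM2r // expr2 ler_pM ?nu_ge0.
Qed.

End BanachExp.

(** * The logarithm in the holomorphic calculus *)

Section LogPath.
Variables (R : realType) (B : topAlgType R[i]) (nu : bnorm B).
Local Notation C := R[i].
Local Open Scope complex_scope.
Local Notation mu := (modc_bnorm R).
Implicit Types (z w : C) (x y b h : B) (G : contour R).

Lemma slit_near z : 0 < slit z -> forall w, modc (w - z) < slit z / 4 ->
  slit z / 2 <= slit w.
Proof. by move=> z0 w wz; have := slit_lip w z; rewrite ler_norml; lra. Qed.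

Definition toward1 (t : R) z : C := 1 + t%:C * (z - 1).

Lemma slit_eq0 z : slit z = 0 -> complex.Im z = 0 /\ complex.Re z <= 0.
Proof.
move=> s0; have mz : modc z = - complex.Re z by apply/eqP; rewrite -addr_eq0 -[_ + _]/(slit z) s0.
have m0 := modc_ge0 z; split; last by lra.
have := modc_sqr z; rewrite mz sqrrN => /eqP.
by rewrite addrC -subr_eq subrr eq_sym sqrf_eq0 => /eqP.
Qed.

(** The plane without the cut is star-shaped about 1. *)
Lemma slit_toward1 t z : 0 < slit z -> 0 <= t <= 1 -> 0 < slit (toward1 t z).
Proof.
move=> z0 /andP[t0 t1]; rewrite lt_def slit_ge0 andbT; apply/eqP => /slit_eq0.
case: z z0 => x y; rewrite /toward1 /= => z0 [].
have [->|tn] := eqVneq t 0; first by move=> _; rewrite !mul0r; lra.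
move=> /eqP; rewrite subr0 mul0r addr0 add0r mulf_eq0 (negPf tn) /= => /eqP y0.
rewrite y0 mul0r subr0 => h.
have x0 : 0 < x.
  rewrite ltNge; apply/negP => x0; move: z0; rewrite y0 /slit /= modcE expr0n addr0 sqrtr_sqr.
  by rewrite ler0_norm // addNr ltxx.
have : 0 < 1 - t + t * x; last lra.
have [->|t1'] := eqVneq t 1; first by lra.
have t2 : t < 1 by rewrite lt_neqAle t1'.
by rewrite ltr_pwDl ?subr_gt0 // mulr_ge0 // ltW.
Qed.

Lemma toward1_lip t z w : 0 <= t <= 1 -> modc (toward1 t z - toward1 t w) <= modc (z - w).
Proof.
move=> /andP[t0 t1]; have -> : toward1 t z - toward1 t w = t%:C * (z - w) by rewrite /toward1; ring.
by rewrite modcM modcR ger0_norm // ler_piMl ?modc_ge0.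
Qed.

(** Compactness is used twice: in t for fixed z, then in z along the edges. Moving z by less than 1
    / (4 M) costs at most half of the bound 1 / M, as [slit] is 2-Lipschitz. *)
Lemma slit_toward1_unif es : (forall z, on_edges es z -> 0 < slit z) ->
  exists2 c : R, 0 < c & forall t z, 0 <= t <= 1 -> on_edges es z -> c <= slit (toward1 t z).
Proof.
move=> es0.
pose P M z := 0 < M /\ forall t, 0 <= t <= 1 -> M^-1 <= slit (toward1 t z).
have [|z /es0 z0|M hM] := @edges_unif R es P.
- move=> M M' z [M0 h] MM'; have M'0 := lt_le_trans M0 MM'; split=> // t t01.
  by rewrite (le_trans _ (h t t01)) // lef_pV2.
- have [||s t s01 t01|M hM] := @compact_unif R (fun t _ => toward1 t z) (modc (z - 1))
      (fun M w => 0 < M /\ M^-1 <= slit w).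
  + move=> s t s' t' _ _ _ _; rewrite /toward1 opprD addrACA subrr add0r -mulrBl -rmorphB.
    by rewrite modcM modcR mulrC ler_wpM2l ?modc_ge0 // lerDl.
  + move=> M M' w [M0 h] MM'; have M'0 := lt_le_trans M0 MM'; split=> //.
    by rewrite (le_trans _ h) // lef_pV2.
  + have sz := slit_toward1 z0 s01.
    exists (2 / slit (toward1 s z)), (slit (toward1 s z) / 4) => [|w hw].
      by rewrite divr_gt0.
    by split; [rewrite divr_gt0|rewrite invf_div; exact: slit_near].
  have i0 : 0 <= (0 : R) <= 1 by rewrite lexx ler01.
  have M0 : 0 < M by case: (hM 0 0 i0 i0).
  exists (2 * M), ((4 * M)^-1) => [|w wz]; first by rewrite invr_gt0 mulr_gt0.
  split; first by rewrite mulr_gt0.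
  move=> t t01; have [_ h] := hM t 0 t01 i0.
  have := slit_lip (toward1 t w) (toward1 t z); have := toward1_lip w z t01.
  rewrite ler_norml => h1 /andP[h2 _].
  have e1 : (2 * M)^-1 = M^-1 - 2 * (4 * M)^-1 by field; lra.
  by rewrite e1; lra.
case: (pselect (exists z, on_edges es z)) => [[z0 /hM[M0 _]]|ne].
  by exists M^-1 => [|t z t01 /hM[_]]; [rewrite invr_gt0|apply].
by exists 1 => // t z _ ez; case: ne; exists z.
Qed.

Lemma edge_int_mulr x (g : C -> B) es : lip_edges nu g es ->
  edge_int (fun z => g z * x) es = edge_int g es * x.
Proof.
apply: (@edge_int_map _ _ _ nu nu (fun y => y * x) (nu x)) => [y z|d y|y].
- exact: mulrDl.
- by rewrite scalerAl.
- by rewrite mulrC nrmM.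
Qed.

Lemma lip_edges_mulr x (g : C -> B) es : lip_edges nu g es ->
  lip_edges nu (fun z => g z * x) es.
Proof.
apply: (@lip_edges_map _ _ _ nu nu (fun y => y * x) (nu x)) => [y z|d y|y].
- exact: mulrDl.
- by rewrite scalerAl.
- by rewrite mulrC nrmM.
Qed.

Lemma contour_int_cst G : edge_int (fun=> 1 : C) (contour_edges G) = 0.
Proof.
rewrite (@edge_int_ftc _ _ mu id _ _ 0); first exact: (contour_closed id).
by move=> e _ z w _ _; rewrite -[_ *: _]/(_ * _) mulr1 subrr nu0 mul0r.
Qed.

(* [L t] is the logarithm of [1 + t (h - 1)] and [X] is its derivative. *)
Definition is_log_path h (L X : R -> B) (K : R) := [/\ L 0 = 0,
  forall t, 0 <= t <= 1 -> nu (L t) <= K /\ nu (X t) <= K,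
  forall t, 0 <= t <= 1 -> X t * (1 + t%:C *: (h - 1)) = h - 1 /\
    (1 + t%:C *: (h - 1)) * X t = h - 1 &
  forall s t, 0 <= s <= 1 -> 0 <= t <= 1 ->
    nu (L s - L t - (s - t)%:C *: X t) <= K * (s - t) ^+ 2].

Lemma is_hfc_log_path h c : is_hfc (@clog R) h c ->
  exists L X K, is_log_path h L X K /\ L 1 = c.
Proof.
move=> [U [G [[_ Uhol] _ sG ->]]].
have hs := surrounds_off sG; have hw := surrounds_winding sG.
have hU := surrounds_on sG; have hx := surrounds_exterior sG.
set es := contour_edges G in hs hw hU hx *.
have Uslit z : U z -> 0 < slit z by move=> /Uhol /slit_derivable_clog.
have lR : lip_edges nu (resolvent h) es := lip_edges_resolvent nu hs.
have [MR0 hMR0] := lip_edges_bounded lR.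
pose MR := `|MR0|; have hMR z : on_edges es z -> nu (resolvent h z) <= MR.
  by move=> ez; rewrite (le_trans (hMR0 z ez)) // ler_norm.
have [M hM] := lip_edges_bounded (lip_edges_id es).
have [d d0 dP] := slit_toward1_unif (fun z ez => Uslit z (hU z ez)).
have dmod t z : 0 <= t <= 1 -> on_edges es z -> d / 2 <= modc (toward1 t z).
  by move=> t01 ez; have := dP t z t01 ez; have := slit_le (toward1 t z); lra.
have d20 : 0 < d / 2 by rewrite divr_gt0.
have n0 t z : 0 <= t <= 1 -> on_edges es z -> toward1 t z != 0.
  by move=> t01 ez; apply: contraTneq (dmod t z t01 ez) => ->; rewrite modc0 -ltNge.
have z1M z : on_edges es z -> modc (z - 1) <= `|M| + 1.
  move=> ez; have := modcD z (- 1); rewrite modcN modc1; have := hM z ez.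
  by rewrite /= ; have := ler_norm M; lra.
have Mt t z : 0 <= t <= 1 -> on_edges es z -> modc (toward1 t z) <= `|M| + 2.
  move=> /andP[t0 t1] ez; rewrite (le_trans (modcD _ _)) // modc1 modcM modcR ger0_norm //.
  have : t * modc (z - 1) <= modc (z - 1) by rewrite ler_piMl ?modc_ge0.
  by have := z1M z ez; lra.
have [K0 hK0] := @clog_taylor R d (`|M| + 2) d0.
have lt1 t : lip_edges mu (toward1 t) es.
  exact: (lip_edgesD (lip_edges_cst _ 1 es) (lip_edgesZ t%:C (lip_edgesB (lip_edges_id es)
    (lip_edges_cst _ 1 es)))).
have llog t : 0 <= t <= 1 -> lip_edges mu (fun z => clog (toward1 t z)) es.
  move=> t01; eexists => e ees z w ez ew.
  have ez' : on_edges es z by exists e.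
  have ew' : on_edges es w by exists e.
  have := clog_lip d0 (dP t z t01 ez') (dP t w t01 ew') (Mt t z t01 ez') (Mt t w t01 ew').
  move=> /le_trans; apply; apply: ler_wpM2l; last exact: toward1_lip.
  by rewrite !addr_ge0 ?divr_ge0 ?mulr_ge0 ?addr_ge0 ?sqr_ge0 // ltW.
have linv t : 0 <= t <= 1 -> lip_edges mu (fun z => (toward1 t z)^-1) es.
  by move=> t01; exact: (lip_edges_invf d20 (fun z => dmod t z t01) (lt1 t)).
have lq t : 0 <= t <= 1 -> lip_edges mu (fun z => (z - 1) * (toward1 t z)^-1) es.
  move=> t01; exact: (lip_edges_scale (lip_edgesB (lip_edges_id es) (lip_edges_cst _ 1 es))
    (linv t t01)).
pose gL t z := clog (toward1 t z) *: resolvent h z.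
pose gX t z := ((z - 1) * (toward1 t z)^-1) *: resolvent h z.
have lgL t : 0 <= t <= 1 -> lip_edges nu (gL t) es.
  by move=> t01; exact: (lip_edges_scale (llog t t01) lR).
have lgX t : 0 <= t <= 1 -> lip_edges nu (gX t) es.
  by move=> t01; exact: (lip_edges_scale (lq t t01) lR).
pose p := (two_pi_i R)^-1.
pose L t : B := p *: edge_int (gL t) es.
pose X t : B := p *: edge_int (gX t) es.
pose len := edge_length es.
have len0 : 0 <= len by apply: sumr_ge0 => e _; exact: modc_ge0.
have i0 : 0 <= (0 : R) <= 1 by rewrite lexx ler01.
have L0 : L 0 = 0.
  rewrite /L (@eq_edge_int _ _ _ (fun z => 0 *: resolvent h z)).
    by rewrite (edge_intZ 0 lR) scale0r scaler0.
  by move=> z _; rewrite /gL /toward1 mul0r addr0 clog1.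
pose KX := modc p * (len * ((`|M| + 1) * (2 / d) * MR)).
have KX0 : 0 <= KX.
  by rewrite !mulr_ge0 ?modc_ge0 ?addr_ge0 ?normr_ge0 ?invr_ge0 // ltW.
have hX t : 0 <= t <= 1 -> nu (X t) <= KX.
  move=> t01; rewrite nrmZ ler_wpM2l ?modc_ge0 //.
  apply: (edge_int_bound (lgX t t01)) => z ez; rewrite nrmZ modcM modcV.
  apply: ler_pM; rewrite ?mulr_ge0 ?invr_ge0 ?modc_ge0 ?nu_ge0 ?hMR //.
  apply: ler_pM; rewrite ?invr_ge0 ?modc_ge0 ?z1M //.
  by rewrite -(invf_div d 2) lef_pV2 ?posrE ?dmod // (lt_le_trans d20) ?dmod.
pose KL := modc p * (len * (`|K0| * (`|M| + 1) ^+ 2 * MR)).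
have KL0 : 0 <= KL.
  by rewrite !mulr_ge0 ?modc_ge0 ?addr_ge0 ?normr_ge0.
have hL s t : 0 <= s <= 1 -> 0 <= t <= 1 ->
    nu (L s - L t - (s - t)%:C *: X t) <= KL * (s - t) ^+ 2.
  move=> s01 t01.
  have lall := lip_edgesB (lip_edgesB (lgL s s01) (lgL t t01)) (lip_edgesZ (s - t)%:C (lgX t t01)).
  have -> : L s - L t - (s - t)%:C *: X t =
     p *: edge_int (fun z => gL s z - gL t z - (s - t)%:C *: gX t z) es.
    rewrite (edge_intB (lip_edgesB (lgL s s01) (lgL t t01)) (lip_edgesZ (s - t)%:C (lgX t t01))).
    rewrite (edge_intB (lgL s s01) (lgL t t01)) (edge_intZ _ (lgX t t01)).
    by rewrite !scalerBr !scalerA (mulrC p (s - t)%:C).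
  rewrite nrmZ /KL -!(mulrA (modc p)) ler_wpM2l ?modc_ge0 // -(mulrA len).
  apply: (edge_int_bound lall) => z ez.
  rewrite /gL /gX scalerA -!scalerBl nrmZ mulrAC.
  apply: ler_pM; rewrite ?modc_ge0 ?nu_ge0 ?hMR //.
  have st : toward1 s z - toward1 t z = (s - t)%:C * (z - 1).
    by rewrite /toward1 rmorphB; ring.
  have := hK0 (toward1 t z) (toward1 s z) (dP t z t01 ez) (dP s z s01 ez) (Mt t z t01 ez) (Mt
    s z s01 ez).
  rewrite st -mulrA => /le_trans; apply.
  rewrite modcM modcR exprMn real_normK ?num_real // (mulrC (_ ^+ 2)) mulrA ler_wpM2r ?sqr_ge0 //.
  rewrite (le_trans (ler_wpM2r (sqr_ge0 _) (ler_norm K0))) // ler_wpM2l //.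
  by rewrite lerXn2r ?nnegrE ?modc_ge0 ?addr_ge0 ?z1M.
exists L, X, (KX + KL); split; last first.
  rewrite /L /p; congr (_ *: _); apply: eq_edge_int => z _.
  by rewrite /gL /toward1 mul1r addrC subrK.
split=> //.
- move=> t t01; have t2 := t01; move/andP: t2 => [t0 t1]; split;
  last by rewrite (le_trans (hX t t01)) // lerDl.
  have := hL t 0 t01 i0; rewrite L0 !subr0 => h1.
  rewrite -[L t](subrK (t%:C *: X 0)) (le_trans (nrmD _ _ _)) // addrC.
  apply: lerD.
    rewrite nrmZ modcR ger0_norm // (le_trans (ler_wpM2l t0 (hX 0 i0))) // ler_piMl //.
  by rewrite (le_trans h1) // ler_piMr // exprn_ile1.
- move=> t t01.
  pose H : B := 1 + t%:C *: (h - 1).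
  (* [H] differs from the scalar 1 + t (z - 1) by a multiple of z - h, which the resolvent
     cancels. *)
  have HE z : H = (toward1 t z)%:A - t%:C *: (z%:A - h).
    rewrite /toward1 scalerDl scale1r -scalerA scalerBl scale1r -addrA -scalerBr opprB.
    by rewrite [z%:A - 1 + _]addrC addrA subrK.
  have RH z : on_edges es z -> resolvent h z * H = toward1 t z *: resolvent h z - t%:C%:A /\
      H * resolvent h z = toward1 t z *: resolvent h z - t%:C%:A.
    move=> /hs /resolventP[rl rr].
    by rewrite (HE z) mulrBr mulrBl -!scalerAr -!scalerAl mul1r mulr1 rl rr.
  (* For t > 0 the pole is q = 1 - 1 / t <= 0. It lies on the cut, hence outside [U], where the
     winding number is 0. *)
  have int0 : edge_int (fun z => (toward1 t z)^-1 : C) es = 0.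
    have [t00|tn] := eqVneq t 0.
      rewrite -(contour_int_cst G); apply: eq_edge_int => z _.
      by rewrite /toward1 t00 mul0r addr0 invr1.
    have tC : t%:C != 0 :> C by rewrite eq_complex /= negb_and tn.
    have /andP[t0 t1] := t01; have tp : 0 < t by rewrite lt_def tn.
    pose q : C := 1 - t%:C^-1.
    have qU : ~ U q.
      have qE : q = (1 - t^-1)%:C by rewrite /q rmorphB fmorphV.
      have q0 : 1 - t^-1 <= 0 by rewrite subr_le0 invf_ge1.
      move=> /Uslit; rewrite qE /slit modcR ler0_norm //= addNr ltxx //.
    have tq z : toward1 t z = t%:C * (z - q) by rewrite /toward1 /q; field.
    have dq z : on_edges es z -> d / 2 <= modc (z - q).
      move=> ez; rewrite (le_trans (dmod t z t01 ez)) // tq modcM modcR ger0_norm //.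
      by rewrite ler_piMl ?modc_ge0.
    rewrite (@eq_edge_int _ _ _ (fun z => t%:C^-1 *: (z - q)^-1)).
      by rewrite (edge_intZ _ (lip_edges_inv d20 dq)) (hx q qU) scaler0.
    by move=> z _; rewrite tq invfM.
  (* Times [H], the integrand becomes (z - h)^-1 (h - 1) + (1 + t (z - 1))^-1. The first term
     integrates to 2 pi i (h - 1) and the second to 0. *)
  have HX : X t * H = h - 1.
    rewrite /X -scalerAl -(edge_int_mulr H (lgX t t01)).
    have -> : h - 1 = p *: (edge_int (fun z => resolvent h z * (h - 1) + (toward1 t z)^-1 *: 1) es).
      rewrite (edge_intD (lip_edges_mulr (h - 1) lR) (lip_edges_scalar nu 1 (linv t t01))).
      rewrite (edge_int_mulr _ lR) (edge_int_scalar nu 1 (linv t t01)) int0 scale0r addr0.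
      rewrite (edge_int_resolvent nu hs hw) -scalerAl mul1r scalerA mulVf ?scale1r //.
      exact: two_pi_i_neq0.
    congr (_ *: _); apply: eq_edge_int => z ez; have [rh _] := RH z ez.
    have [_ rr] := resolventP (hs z ez); have nt := n0 t z t01 ez.
    rewrite /gX -scalerAl rh scalerBr !scalerA divfK //.
    have -> : (z - 1) / toward1 t z * t%:C = 1 - (toward1 t z)^-1.
      by move: nt; rewrite /toward1 => nt; field.
    rewrite [(1 - _) *: 1]scalerBl scale1r opprB addrA addrAC; congr (_ + _).
    have -> : (z - 1) *: resolvent h z = resolvent h z * ((z%:A - h) + (h - 1)).
      by rewrite addrA subrK mulrBr mulr1 -scalerAr mulr1 scalerBl scale1r.
    by rewrite mulrDr rr addrAC subrr add0r.
  split=> //; rewrite -[RHS]HX /X -scalerAr -scalerAl; congr (_ *: _).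
  rewrite -(edge_int_mulr H (lgX t t01)) -(edge_int_mull H (lgX t t01)).
  apply: eq_edge_int => z ez; have [r1 r2] := RH z ez.
  by rewrite /gX -scalerAl -scalerAr r1 r2.
move=> s t s01 t01; rewrite (le_trans (hL s t s01 t01)) // ler_wpM2r ?sqr_ge0 // lerDr //.
Qed.

(** 0 lies off the spectrum, and the resolvent set is open. *)
Lemma pos_spectrum_lower h : (forall z, spectrum h z -> 0 < z) ->
  exists2 a : R, 0 < a & forall z, spectrum h z -> a <= modc z.
Proof.
move=> hp; have [|M [d d0 dP]] := @resolvent_local _ _ nu h 0; first by move=> /hp; rewrite ltxx.
exists d => // z sz; rewrite leNgt; apply/negP => zd.
by have [] := dP z; rewrite ?subr0.
Qed.

Lemma hfc_log_ex h : (forall z, spectrum h z -> 0 < z) -> exists c, is_hfc (@clog R) h c.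
Proof.
move=> hp; have [a a0 aP] := pos_spectrum_lower hp.
have nh := nu_ge0 nu h.
pose b := a + 2 * nu h + 1.
have sp z : spectrum h z -> exists2 x : R, a <= x <= b & z = x%:C.
  move=> sz; have := hp z sz; case: z sz => x y sz; rewrite ltcE /= => /andP[/eqP -> x0].
  have zE : x +i* y = x%:C by have := hp _ sz; rewrite ltcE /= => /andP[/eqP -> _].
  exists x => //; have := aP _ sz; rewrite zE modcR gtr0_norm // => -> /=.
  rewrite leNgt; apply/negP => xb.
  have x1 : 0 < modc (x%:C : C) by rewrite modcR gtr0_norm.
  have x2 : 2 * nu h <= modc (x%:C : C) by rewrite modcR gtr0_norm //; move: xb; rewrite /b; lra.
  by have [nsz _] := resolvent_large x1 x2; apply: nsz; rewrite -zE.
(* The spectrum lies in [a, b], within (b - a) / 2 < r of c, and the leftmost vertex c - r = a / 2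
   is still positive. *)
pose c := (a + b) / 2; pose r := b / 2.
have b0 : 0 < b by rewrite /b; lra.
have r0 : 0 <= r by rewrite /r; lra.
have inside z : spectrum h z -> norm1 (z - c%:C) < r.
  move=> /sp[x /andP[x1 x2] ->]; rewrite /norm1 /= subrr normr0 addr0 ltr_norml /c /r; lra.
pose U : set C := [set z | 0 < complex.Re z].
exists ((two_pi_i R)^-1 *: contour_integral (diamond c%:C r) (fun z => clog z *: resolvent h z)).
exists U, (diamond c%:C r); split=> //.
- split; last by move=> z; exact: derivable_clog.
  rewrite openE => z /= z0; apply/nbhsC_modc; exists (complex.Re z) => // w wz.
  have := Re_le_modc (w - z); have -> : complex.Re (w - z) = complex.Re w - complex.Re z.
    by case: (w); case: (z).
  by rewrite ler_norml /U /=; lra.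
- by move=> z /sp[x /andP[x1 _] ->]; rewrite /U /=; lra.
split.
- move=> z ez; have zr := diamond_norm1 r0 ez; split.
    rewrite /U /=; move: zr; case: (z) => x y; rewrite /norm1 /= => zr.
    have := ler_norm (- (x - c)); rewrite normrN; have := normr_ge0 (y - 0).
    by move: zr; rewrite /c /r; lra.
  by move=> /inside; rewrite zr ltxx.
- move=> z /inside zr; rewrite /winding.
  rewrite -[contour_integral _ _]/(edge_int (fun w =>
    (w - z)^-1 : C) (contour_edges (diamond c%:C r))).
  by rewrite diamond_winding ?mulVf ?two_pi_i_neq0.
move=> z zU; rewrite /winding.
rewrite -[contour_integral _ _]/(edge_int (fun w =>
  (w - z)^-1 : C) (contour_edges (diamond c%:C r))).
rewrite diamond_exterior ?mulr0 //; first by rewrite r0 /r /c; lra.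
by rewrite leNgt; apply/negP.
Qed.

(** The path is built from the very contour behind the value of [hfc], so uniqueness of that value
    is not an issue. *)
Lemma log_path_ex h : (forall z, spectrum h z -> 0 < z) ->
  exists L X K, is_log_path h L X K /\ L 1 = hfc (@clog R) h.
Proof.
move=> /hfc_log_ex[c0 hc0]; apply: is_hfc_log_path.
by rewrite /hfc; case: xgetP => [c _ //|/(_ c0)].
Qed.

Section LogPathTheory.
Variables (h : B) (L X : R -> B) (K : R).
Hypothesis LX : is_log_path h L X K.

Lemma log_path_inverse t : 0 <= t <= 1 ->
  inverse_of (1 + t%:C *: (h - 1)) (1 - t%:C *: X t).
Proof.
move=> t01; have [_ _ /(_ t t01)[h1 h2] _] := LX; split.
  by rewrite mulrBr mulr1 -scalerAr h2 addrK.
by rewrite mulrBl mul1r -scalerAl h1 addrK.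
Qed.

Lemma inverse_commute b b' c : inverse_of b b' -> c * b = b * c -> c * b' = b' * c.
Proof.
move=> [bb' b'b] cb.
by rewrite -[c * b']mul1r -b'b -mulrA (mulrA b) -cb -mulrA bb' mulr1.
Qed.

Lemma log_path_commuteX c t : 0 <= t <= 1 -> c * h = h * c -> c * X t = X t * c.
Proof.
move=> t01 ch; have hi := log_path_inverse t01.
have [_ _ /(_ t t01)[h1 h2] _] := LX.
have ch1 : c * (h - 1) = (h - 1) * c by rewrite mulrBr mulrBl ch mulr1 mul1r.
have cH : c * (1 + t%:C *: (h - 1)) = (1 + t%:C *: (h - 1)) * c.
  by rewrite mulrDr mulrDl mulr1 mul1r -scalerAr -scalerAl ch1.
have cI := inverse_commute hi cH.
have XE : X t = (h - 1) * (1 - t%:C *: X t) by rewrite -h1 -mulrA (proj1 hi) mulr1.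
by rewrite XE mulrA ch1 -mulrA cI mulrA.
Qed.

(** If [phi] kills the derivative [X], then [phi (L t)] is constant, equal to its value 0 at t = 0.
    Homogeneity is asked for real scalars only, so as to cover x -> x^* - x besides commutators. *)
Lemma log_path_map (phi : B -> B) (M : R) : (forall x y, phi (x + y) = phi x + phi y) ->
  (forall (r : R) x, phi (r%:C *: x) = r%:C *: phi x) -> (forall x, nu (phi x) <= M * nu x) ->
  (forall t, 0 <= t <= 1 -> phi (X t) = 0) -> forall t, 0 <= t <= 1 -> phi (L t) = 0.
Proof.
move=> phiD phiZ phiM phiX r /andP[r0 r1]; have [L0 bd _ hL] := LX.
have K0 : 0 <= K by have [|h1 _] := bd 0; rewrite ?lexx ?ler01 // (le_trans _ h1) ?nu_ge0.
have phi0 : phi 0 = 0 by have := phiZ 0 0; rewrite rmorph0 !scale0r.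
have phiB x y : phi (x - y) = phi x - phi y.
  by rewrite phiD; congr (_ + _); have := phiZ (-1) y; rewrite rmorphN1 !scaleN1r.
have e : phi (L (1 * r)) = phi (L (0 * r)); last by move: e; rewrite mul1r mul0r L0 phi0.
apply: (@const_of_quadratic R B nu (fun t => phi (L (t * r))) (`|M| * K)) => s t s01 t01.
have i01 q : 0 <= q <= 1 -> 0 <= q * r <= 1.
  by move=> /andP[q0 q1]; rewrite mulr_ge0 //= mulr_ile1.
have := hL _ _ (i01 s s01) (i01 t t01).
have -> : phi (L (s * r)) - phi (L (t * r)) =
    phi (L (s * r) - L (t * r) - (s * r - t * r)%:C *: X (t * r)).
  by rewrite !phiB phiZ phiX ?i01 // scaler0 subr0.
move=> h1; rewrite (le_trans (phiM _)) // -mulrA.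
rewrite (le_trans (ler_wpM2r (nu_ge0 _ _) (ler_norm M))) // ler_wpM2l // (le_trans h1) //.
by rewrite ler_wpM2l // -mulrBl exprMn ler_piMr ?sqr_ge0 // exprn_ile1.
Qed.

Lemma log_path_commuteL c t : 0 <= t <= 1 -> c * h = h * c -> c * L t = L t * c.
Proof.
move=> t01 ch; apply/eqP; rewrite -subr_eq0; apply/eqP.
apply: (@log_path_map (fun x => c * x - x * c) (nu c + nu c)) => // [x y|r x|x|s s01].
- by rewrite mulrDr mulrDl opprD addrACA.
- by rewrite -scalerAr -scalerAl scalerBr.
- by rewrite (le_trans (nrmD _ _ _)) // nuN mulrDl lerD ?nrmM // mulrC nrmM.
- by rewrite (log_path_commuteX s01 ch) subrr.
Qed.

End LogPathTheory.

(** The path D t = 1 + t (h - 1) itself solves the equation in [ode_exp], exactly: D t X t = h - 1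
    gives D s = D t (1 + (s - t) X t). *)
Lemma bexp_log h : (forall z, spectrum h z -> 0 < z) -> bexp (hfc (@clog R) h) = h.
Proof.
move=> /log_path_ex[L [X [K [LX <-]]]]; have [L0 bd hX hL] := LX.
pose D (t : R) : B := 1 + t%:C *: (h - 1).
have -> : h = D 1 by rewrite /D scale1r addrC subrK.
have K0 : 0 <= K by have [|h1 _] := bd 0; rewrite ?lexx ?ler01 // (le_trans _ h1) ?nu_ge0.
pose K1 := nu 1 + nu (h - 1).
have K10 : 0 <= K1 by rewrite addr_ge0 ?nu_ge0.
symmetry; apply: (@ode_exp R B nu D L X (K1 + K)) => //.
- by rewrite /D scale0r addr0.
- move=> t t01; have [h1 h2] := bd t t01; split; last 2 first.
  + by rewrite (le_trans h1) // lerDr.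
  + by rewrite (le_trans h2) // lerDr.
  have /andP[t0 t1] := t01.
  rewrite (@le_trans _ _ K1) ?lerDl // (le_trans (nrmD _ _ _)) // lerD2l nrmZ modcR.
  by rewrite ger0_norm // ler_piMl ?nu_ge0.
- move=> s t s01 t01; have [_ h2] := hX t t01.
  rewrite mulrDr mulr1 -scalerAr h2 /D rmorphB scalerBl.
  rewrite -[1 + t%:C *: _ + _]addrA (addrC (t%:C *: _)) subrK.
  by rewrite subrr nu0; apply: mulr_ge0; [exact: addr_ge0|exact: sqr_ge0].
- move=> s t s01 t01; rewrite (le_trans (hL s t s01 t01)) // ler_wpM2r ?sqr_ge0 //.
  by rewrite lerDr.
- move=> s t s01 t01; apply: (log_path_commuteL LX t01).
  by symmetry; exact: (log_path_commuteL LX s01).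
Qed.

End LogPath.

(** * Positivity *)

Section CStar.
Variables (R : realType) (A : cstarAlg R).
Local Notation C := R[i].
Local Open Scope complex_scope.
Local Notation nu := (anorm_bnorm A).
Implicit Types (a b c x y s : A).

Lemma starD a b : star (a + b) = star a + star b.
Proof. exact: cstar_starD. Qed.

Lemma starZ (k : C) a : star (k *: a) = k^* *: star a.
Proof. exact: cstar_starZ. Qed.

Lemma starM a b : star (a * b) = star b * star a.
Proof. exact: cstar_starM. Qed.

Lemma starK : involutive (@star R A).
Proof. exact: cstar_starK. Qed.

Lemma star0 : star (0 : A) = 0.
Proof. by apply: (addrI (star 0)); rewrite -starD !addr0. Qed.

Lemma starN a : star (- a) = - star a.
Proof. by apply: (addrI (star a)); rewrite -starD !subrr star0. Qed.

Lemma starB a b : star (a - b) = star a - star b.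
Proof. by rewrite starD starN. Qed.

Lemma star1 : star (1 : A) = 1.
Proof. by have := starM (star 1) 1; rewrite mulr1 starK mulr1. Qed.

Lemma starZR (r : R) a : star (r%:C *: a) = r%:C *: star a.
Proof.
rewrite starZ; congr (_ *: _).
by apply/eqP; rewrite eq_complex /= oppr0 !eqxx.
Qed.

Lemma star_sum I (r : seq I) (P : pred I) (F : I -> A) :
  star (\sum_(i <- r | P i) F i) = \sum_(i <- r | P i) star (F i).
Proof. exact: (big_morph _ starD star0). Qed.

Lemma anorm1 : anorm (1 : A) = 1.
Proof.
have := anorm_star (1 : A); rewrite star1 mulr1 expr2 => /eqP.
rewrite -subr_eq0 -{1}(mulr1 (anorm 1)) -mulrBr mulf_eq0 => /orP[/eqP /anorm_eq0 /eqP|].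
  by rewrite oner_eq0.
by rewrite subr_eq0 => /eqP <-.
Qed.

Lemma anorm_star_eq a : anorm (star a) = anorm a.
Proof.
have h b : anorm b <= anorm (star b).
  have [->|b0] := eqVneq b 0; first by rewrite star0.
  have bp : 0 < anorm b.
    by rewrite lt_def anorm_ge0 andbT; apply: contra_neq b0; exact: anorm_eq0.
  by rewrite -(ler_pM2r bp) -expr2 -anorm_star anormM.
by apply/eqP; rewrite eq_le h -{2}(starK a) h.
Qed.

Lemma nu_contraction0 (d : A) (s : R) : s < 1 -> anorm d <= s * anorm d -> d = 0.
Proof.
move=> s1 h; apply: anorm_eq0; apply/eqP; rewrite eq_le anorm_ge0 andbT.
have := anorm_ge0 d; nra.
Qed.

(* [b = 1 - y], where [y = (a^2 + y^2) / 2] is the fixed point of a contraction. *)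
Lemma sqrt_1Bsqr a : star a = a -> anorm a < 1 -> exists b,
  [/\ star b = b, a * b = b * a & b * b = 1 - a * a].
Proof.
move=> aa a1; pose x := a * a; pose s := anorm x.
have s0 : 0 <= s by exact: anorm_ge0.
have s1 : s < 1.
  rewrite /s /x -{1}aa anorm_star; have := anorm_ge0 a; nra.
have s01 : 0 <= s < 1 by rewrite s0.
pose k : C := (1 / 2 : R)%:C.
have nk y : anorm (k *: y) = 1 / 2 * anorm y by rewrite anormZ modcR ger0_norm.
have nM y z : anorm y <= s -> anorm z <= s -> anorm (y * y - z * z) <= (2 * s) * anorm (y - z).
  move=> ys zs; have -> : y * y - z * z = y * (y - z) + (y - z) * z.
    by rewrite mulrBr mulrBl addrA subrK.
  have n0 := anorm_ge0 (y - z).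
  have -> : 2 * s * anorm (y - z) = s * anorm (y - z) + s * anorm (y - z) by ring.
  rewrite (le_trans (anormD _ _)) // lerD //.
    by rewrite (le_trans (anormM _ _)) // ler_wpM2r.
  by rewrite (le_trans (anormM _ _)) // mulrC ler_wpM2r.
have nP (y z : A) : anorm (y + z) <= anorm y + anorm z by exact: anormD.
have Fs y z : anorm y <= s -> anorm z <= s ->
    anorm (k *: (x + y * y) - k *: (x + z * z)) <= s * anorm (y - z).
  move=> ys zs; rewrite -scalerBr nk opprD addrACA subrr add0r.
  by have := nM y z ys zs; have := anorm_ge0 (y - z); lra.
have [||y ys yE] := @contraction_fixpoint R A nu (fun y => k *: (x + y * y)) s s s0 s01.
- move=> y ys; rewrite /= nk.
  have := nP x (y * y); have := anormM y y; have := anorm_ge0 y; rewrite /= in ys.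
  rewrite -/s => y0 h1 h2.
  have : anorm y * anorm y <= s * 1 by apply: ler_pM => //; exact: le_trans (ltW s1).
  lra.
- exact: Fs.
rewrite /= in ys yE.
have y2 : x + y * y = y + y.
  have kk : k + k = 1 by apply: complex_ext => /=; lra.
  by rewrite -{3 4}yE -scalerDl kk scale1r.
have xx : star x = x by rewrite /x starM aa.
(* [star y] is a fixed point of the same contraction. *)
have yy : star y = y.
  apply/eqP; rewrite -subr_eq0; apply/eqP; apply: (@nu_contraction0 _ s s1).
  have h := Fs (star y) y; rewrite anorm_star_eq in h.
  have e : k *: (x + star y * star y) = star y by rewrite -{3}yE starZR starD xx starM.
  by have := h ys ys; rewrite e yE.
(* As a commutes with x, the commutator d = a y - y a satisfies d = (d y + y d) / 2, so its norm is
   at most s times itself. *)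
have ay : a * y = y * a.
  apply/eqP; rewrite -subr_eq0; apply/eqP; apply: (@nu_contraction0 _ s s1).
  have ax : a * x = x * a by rewrite /x mulrA.
  have e : a * y - y * a = k *: ((a * y - y * a) * y + y * (a * y - y * a)).
    rewrite -{1 2}yE -scalerAr -scalerAl -scalerBr mulrDr mulrDl ax opprD addrACA subrr add0r.
    by rewrite mulrBl mulrBr !mulrA addrA subrK.
  rewrite {1}e nk; set d := _ - _; have d0 := anorm_ge0 d.
  have := nP (d * y) (y * d); have := anormM d y; have := anormM y d => h1 h2 h3.
  have h4 : anorm y * anorm d <= s * anorm d by rewrite ler_wpM2r.
  by rewrite (mulrC (anorm d)) in h2; lra.
exists (1 - y); split.
- by rewrite starB star1 yy.
- by rewrite mulrBr mulrBl mulr1 mul1r ay.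
rewrite mulrBr mulr1 mulrBl mul1r opprB addrACA -opprD -y2 (addrC x) opprD addrA.
by rewrite addrK.
Qed.

(* A convex cone containing the squares of Hermitian elements, which makes sums of
   squares manageable without the spectral theory of C*-algebras. *)
Definition cone s := exists2 M : R, 0 <= M & anorm (M%:C%:A - s) <= M.

Lemma coneD s t : cone s -> cone t -> cone (s + t).
Proof.
move=> [M M0 hM] [N N0 hN]; exists (M + N); first exact: addr_ge0.
by rewrite rmorphD scalerDl opprD addrACA (le_trans (anormD _ _)) // lerD.
Qed.

Lemma cone0 : cone 0.
Proof.
exists 0 => //; rewrite rmorph0 scale0r subrr.
by have := nu0 nu => /= ->.
Qed.

Lemma cone_sum I (r : seq I) (P : pred I) (F : I -> A) :
  (forall i, P i -> cone (F i)) -> cone (\sum_(i <- r | P i) F i).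
Proof. by move=> FP; elim/big_ind: _ => //; [exact: cone0 | exact: coneD]. Qed.

(* After scaling, [1 - a^2 = d^2] and [a + i d] is unitary, so that [|d| <= 1]. *)
Lemma cone_sqr a : star a = a -> cone (a * a).
Proof.
move=> aa; pose m := anorm a + 1; have a0 := anorm_ge0 a.
have m0 : 0 < m by rewrite /m; lra.
have mC : m%:C != 0 :> C by rewrite eq_complex /= negb_and gt_eqF.
pose b := m%:C^-1 *: a.
have bb : star b = b by rewrite /b -fmorphV starZR aa.
have b1 : anorm b < 1.
  by rewrite /b anormZ modcV modcR gtr0_norm // mulrC ltr_pdivrMr // /m; lra.
have bE : (m ^+ 2)%:C *: (b * b) = a * a.
  rewrite /b -scalerAl -scalerAr !scalerA rmorphXn /=.
  by rewrite expr2 mulfK // mulfV // scale1r.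
clearbody b.
have [d [dd bd dE]] := sqrt_1Bsqr bb b1.
pose I : C := 'i%C.
pose c := b + I *: d.
have cc : star c * c = 1.
  have Ic : (I^*)%R = - I by apply/eqP; rewrite eq_complex /= oppr0 !eqxx.
  have II : I * I = -1 by rewrite -expr2 sqr_i.
  rewrite /c starD bb starZ dd Ic scaleNr mulrBl !mulrDr.
  rewrite -!scalerAr -!scalerAl scalerA II scaleN1r -bd opprB addrACA subrr addr0.
  by rewrite dE addrC subrK.
have c1 : anorm c = 1.
  have := anorm_star c; rewrite cc anorm1 => /eqP; rewrite eq_sym sqrf_eq1 => /orP[/eqP //|/eqP h].
  by have := anorm_ge0 c; rewrite h; lra.
have d1 : anorm d <= 1.
  have -> : d = (2 * I)^-1 *: (c - star c).
    have Ic : (I^*)%R = - I by apply/eqP; rewrite eq_complex /= oppr0 !eqxx.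
    have I0 : I + I != 0 by rewrite eq_complex /= negb_and orbC -(natrD _ 1 1) pnatr_eq0.
    rewrite /c starD bb starZ dd Ic scaleNr opprB [I *: d - b]addrC addrACA subrr add0r.
    by rewrite -scalerDl scalerA mulr2n mulrDl mul1r mulVf // scale1r.
  rewrite anormZ modcV modcM modc_nat modcE expr0n expr1n add0r sqrtr1 mulr1.
  have := anormD c (- star c); have -> : anorm (- star c) = 1 by rewrite -c1 -(anorm_star_eq
    c); exact: (nuN nu (star c)).
  by rewrite c1; clear; move: (anorm _) => t; lra.
exists (m ^+ 2); first exact: sqr_ge0.
have -> : (m ^+ 2)%:C%:A - a * a = (m ^+ 2)%:C *: (d * d).
  by rewrite dE scalerBr bE.
rewrite anormZ modcR ger0_norm ?sqr_ge0 // ler_piMr ?sqr_ge0 //.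
by rewrite (le_trans (anormM _ _)) // mulr_ile1 ?anorm_ge0.
Qed.

(** For normal x, x^* x is the sum of the squares of the real and imaginary parts [a] and [b] of
    x. *)
Lemma cone_normal x : star x * x = x * star x -> cone (star x * x).
Proof.
move=> xx; pose k : C := (1 / 2 : R)%:C; pose I : C := 'i%C.
pose a := k *: (x + star x); pose b := k *: (I *: (star x - x)).
have Ic : (I^*)%R = - I by apply/eqP; rewrite eq_complex /= oppr0 !eqxx.
have II : I * I = -1 by rewrite -expr2 sqr_i.
have kk : k * k * 4 = 1 :> C.
  by apply: complex_ext => /=; lra.
have -> : star x * x = a * a + b * b.
  have -> : b * b = - (k * k) *: ((star x - x) * (star x - x)).
    by rewrite /b !scalerA -scalerAl -scalerAr scalerA mulrACA II mulrN1.
  rewrite /a -scalerAl -scalerAr scalerA scaleNr -scalerBr.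
  have -> : (x + star x) * (x + star x) - (star x - x) * (star x - x) = (star x * x) *+ 4.
    have -> : (x + star x) * (x + star x) = x * x + star x * x + (star x * x + star x * star x).
      by rewrite mulrDr !mulrDl -xx.
    have -> : (star x - x) * (star x - x) = star x * star x - star x * x - (star x * x - x * x).
      by rewrite mulrBr !mulrBl -xx.
    move: (x * x) (star x * x) (star x * star x) => p q r.
    have -> : p + q + (q + r) = (p + r) + (q + q) by rewrite (addrC q r) addrACA.
    have -> : r - q - (q - p) = (p + r) - (q + q) by rewrite opprB addrACA -opprD (addrC r).
    by rewrite opprB [q + q - _]addrC addrACA subrr add0r (mulrnDr q 2 2) !mulr2n.
  by rewrite -scaler_nat scalerA kk scale1r.
apply: coneD; apply: cone_sqr.
  by rewrite /a starZR starD starK addrC.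
by rewrite /b starZR starZ starB starK Ic scaleNr -scalerN opprB.
Qed.

(** 1 + s = (1 + M) (1 - (M - s) / (1 + M)), and the norm of M - s is at most M < 1 + M. *)
Lemma cone_inverse s : cone s -> exists y, inverse_of (1 + s) y.
Proof.
move=> [M M0 hM]; pose m : C := (1 + M)%:C.
have m0 : m != 0 by rewrite eq_complex /= negb_and gt_eqF //; lra.
have [|y [h1 h2] _] := @neumann R A nu (m^-1 *: (M%:C%:A - s)).
  rewrite /= anormZ modcV modcR ger0_norm; last lra.
  by rewrite mulrC ltr_pdivrMr; lra.
have e : 1 + s = m *: (1 - m^-1 *: (M%:C%:A - s)).
  rewrite scalerBr scalerA mulfV // scale1r /m rmorphD scalerDl scale1r opprB.
  by rewrite -addrA [_%:A + _]addrC subrK.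
exists (m^-1 *: y); split; rewrite e.
  by rewrite -scalerAl -scalerAr scalerA mulfV // scale1r.
by rewrite -scalerAl -scalerAr scalerA mulVf // scale1r.
Qed.

End CStar.

(** * Bicommutants and Hermitian matrices over them *)

Section Bicommutant.
Variables (R : realType) (A : cstarAlg R).
Local Notation C := R[i].

Definition commutant (X : set A) : set A := [set c | forall y, X y -> c * y = y * c].

Definition bicommutant (X : set A) : set A := commutant (commutant X).

Lemma sub_bicommutant X x : X x -> bicommutant X x.
Proof. by move=> Xx c /(_ x Xx). Qed.

Lemma commutant_add X x y : commutant X x -> commutant X y -> commutant X (x + y).
Proof. by move=> hx hy c Xc; rewrite mulrDl mulrDr hx // hy. Qed.

Lemma commutantM X x y : commutant X x -> commutant X y -> commutant X (x * y).
Proof. by move=> hx hy c Xc; rewrite -mulrA hy // mulrA hx // mulrA. Qed.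

Lemma commutantZ X (k : C) x : commutant X x -> commutant X (k *: x).
Proof. by move=> hx c Xc; rewrite -scalerAl -scalerAr hx. Qed.

Lemma commutant1 X : commutant X 1.
Proof. by move=> c _; rewrite mul1r mulr1. Qed.

Lemma commutant0 X : commutant X 0.
Proof. by move=> c _; rewrite mul0r mulr0. Qed.

Lemma commutantN X x : commutant X x -> commutant X (- x).
Proof. by move=> hx c Xc; rewrite mulNr mulrN hx. Qed.

Lemma commutant_inverse X x y : inverse_of x y -> commutant X x -> commutant X y.
Proof. by move=> xy hx c Xc; rewrite -(inverse_commute xy) // -hx. Qed.

Lemma commutant_sum X I (r : seq I) (P : pred I) (F : I -> A) :
  (forall i, P i -> commutant X (F i)) -> commutant X (\sum_(i <- r | P i) F i).
Proof.
by move=> FP; elim/big_ind: _ => //; [exact: commutant0 | exact: commutant_add].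
Qed.

Lemma commutant_star X : (forall x, X x -> X (star x)) ->
  forall c, commutant X c -> commutant X (star c).
Proof.
move=> Xs c hc y /Xs Xy; have := congr1 (@star R A) (hc _ Xy).
by rewrite !starM starK.
Qed.

(** X lies in its commutant, hence so does its bicommutant, which commutes with the commutant. *)
Lemma bicommutant_commute X : (forall x y, X x -> X y -> x * y = y * x) ->
  forall x y, bicommutant X x -> bicommutant X y -> x * y = y * x.
Proof. by move=> Xc x y hx hy; apply: hx => z Xz; apply: hy => t Xt; exact: Xc. Qed.

End Bicommutant.

Section CommutingMatrices.
Variables (R : realType) (A : cstarAlg R) (X : set A).
Local Notation C := R[i].
Local Open Scope complex_scope.
Hypothesis Xcomm : forall x y, X x -> X y -> x * y = y * x.
Hypothesis Xstar : forall x, X x -> X (star x).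
Local Notation S := (bicommutant X).

Let Scomm := bicommutant_commute Xcomm.

Let Sstar x : S x -> S (star x).
Proof. by apply: commutant_star; exact: commutant_star. Qed.

Definition over p q (w : 'M[A]_(p, q)) := forall i j, S (w i j).

Lemma overM p q r (u : 'M[A]_(p, q)) (v : 'M[A]_(q, r)) : over u -> over v -> over (u *m v).
Proof.
by move=> hu hv i j; rewrite mxE; apply: commutant_sum => k _; apply: commutantM;
  [exact: hu | exact: hv].
Qed.

Lemma overD p q (u v : 'M[A]_(p, q)) : over u -> over v -> over (u + v).
Proof. by move=> hu hv i j; rewrite mxE; apply: commutant_add; [exact: hu | exact: hv]. Qed.

Lemma overN p q (u : 'M[A]_(p, q)) : over u -> over (- u).
Proof. by move=> hu i j; rewrite mxE; apply: commutantN; exact: hu. Qed.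

Lemma over_scalar p (x : A) : S x -> over (x%:M : 'M[A]_p).
Proof. by move=> hx i j; rewrite mxE; case: eqP => _; [exact: hx | exact: commutant0]. Qed.

Definition herm p q (w : 'M[A]_(p, q)) : 'M[A]_(q, p) := \matrix_(i, j) star (w j i).

Lemma hermK p q (w : 'M[A]_(p, q)) : herm (herm w) = w.
Proof. by apply/matrixP => i j; rewrite !mxE starK. Qed.

Lemma hermM p q r (u : 'M[A]_(p, q)) (v : 'M[A]_(q, r)) : herm (u *m v) = herm v *m herm u.
Proof.
apply/matrixP => i j; rewrite !mxE star_sum; apply: eq_bigr => k _.
by rewrite starM !mxE.
Qed.

Lemma hermD p q (u v : 'M[A]_(p, q)) : herm (u + v) = herm u + herm v.
Proof. by apply/matrixP => i j; rewrite !mxE starD. Qed.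

Lemma herm_sum p q I (r : seq I) (F : I -> 'M[A]_(p, q)) :
  herm (\sum_(i <- r) F i) = \sum_(i <- r) herm (F i).
Proof.
by apply: (big_morph _ (@hermD p q)); apply/matrixP => i j; rewrite !mxE star0.
Qed.

Lemma herm1 p : herm (1%:M : 'M[A]_p) = 1%:M.
Proof. by apply/matrixP => i j; rewrite !mxE eq_sym; case: eqP; rewrite ?star1 ?star0. Qed.

Lemma over_herm p q (w : 'M[A]_(p, q)) : over w -> over (herm w).
Proof. by move=> hw i j; rewrite mxE; apply: Sstar; exact: hw. Qed.

(** The Sherman-Morrison formula, valid without commutativity when written with a two-sided inverse
    [D] of 1 + V Q U. *)
Lemma rank_one_inverse m (P Q : 'M[A]_m) (U : 'M[A]_(m, 1)) (V : 'M[A]_(1, m)) (D : 'M[A]_1) :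
  P *m Q = 1%:M -> Q *m P = 1%:M ->
  (1%:M + V *m Q *m U) *m D = 1%:M -> D *m (1%:M + V *m Q *m U) = 1%:M ->
  (P + U *m V) *m (Q - Q *m U *m D *m V *m Q) = 1%:M /\
  (Q - Q *m U *m D *m V *m Q) *m (P + U *m V) = 1%:M.
Proof.
move=> PQ QP GD DG; split.
  have h : (P + U *m V) *m Q *m U = U *m (1%:M + V *m Q *m U).
    by rewrite !mulmxDl mulmxDr PQ mul1mx mulmx1 !mulmxA.
  rewrite mulmxBr !mulmxA h -(mulmxA U) GD mulmx1 mulmxDl PQ.
  by rewrite addrK.
have h : V *m Q *m (P + U *m V) = (1%:M + V *m Q *m U) *m V.
  by rewrite mulmxDr mulmxDl mul1mx -(mulmxA V) QP mulmx1 !mulmxA.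
rewrite mulmxBl -!mulmxA (mulmxA V) h !mulmxA -(mulmxA (Q *m U)) DG mulmx1 mulmxDr QP.
by rewrite mulmxA addrK.
Qed.

(** This is 1 + w^* w for the matrix w with rows [rs]; the list allows induction on the rows. *)
Definition gram m (rs : seq 'rV[A]_m) : 'M[A]_m := 1%:M + \sum_(r <- rs) herm r *m r.

Lemma cone_row m (y : 'rV[A]_m) : over y -> cone ((y *m herm y) 0 0).
Proof.
move=> hy; rewrite mxE; apply: cone_sum => j _; rewrite mxE.
have := @cone_normal R A (star (y 0 j)); rewrite starK; apply.
by apply: Scomm => //; exact: Sstar.
Qed.

(* Each summand is a rank one update, whose inverse needs only that [1 + g] is
   invertible for one element [g] of the cone. *)
Lemma gram_inverse m (rs : seq 'rV[A]_m) : (forall r, r \in rs -> over r) ->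
  exists Q, [/\ gram rs *m Q = 1%:M, Q *m gram rs = 1%:M & over Q].
Proof.
elim: rs => [|r rs IH] hrs.
  exists 1%:M; rewrite /gram big_nil addr0 mulmx1; split=> //.
  by apply: over_scalar; exact: commutant1.
have [|Q [PQ QP oQ]] := IH; first by move=> s hs; apply: hrs; rewrite inE hs orbT.
have or : over r by apply: hrs; exact: mem_head.
have hP : herm (gram rs) = gram rs.
  rewrite /gram hermD herm1 herm_sum; congr (_ + _).
  by apply: eq_bigr => s _; rewrite hermM hermK.
have hQ : herm Q = Q.
  have h := congr1 (@herm m m) PQ; rewrite hermM hP herm1 in h.
  by rewrite -[herm Q]mulmx1 -PQ mulmxA h mul1mx.
pose y := r *m Q; have oy : over y by exact: overM.
pose g := (r *m Q *m herm r) 0 0.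
have hy : herm y = Q *m herm r by rewrite hermM hQ.
have gE : r *m Q *m herm r = y *m gram rs *m herm y.
  by rewrite hy /y !mulmxA -[r *m Q *m gram rs]mulmxA QP mulmx1.
have cg : cone g.
  rewrite /g gE /gram mulmxDr mulmxDl mulmx1 mxE; apply: coneD; first exact: cone_row.
  rewrite mulmx_sumr mulmx_suml summxE big_seq; apply: cone_sum => s hs.
  have -> : y *m (herm s *m s) *m herm y = (y *m herm s) *m herm (y *m herm s).
    by rewrite [herm (y *m herm s)]hermM hermK !mulmxA.
  apply: cone_row; apply: overM => //; apply: over_herm; apply: hrs.
  by rewrite inE hs orbT.
have og : S g by apply: overM; [exact: overM | exact: over_herm].
have [d [gd dg]] := cone_inverse cg.
have od : S d.
  by apply: (commutant_inverse (conj gd dg)); apply: commutant_add; [exact: commutant1 | exact: og].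
have G1 : 1%:M + r *m Q *m herm r = (1 + g)%:M :> 'M[A]_1.
  by rewrite [r *m Q *m herm r]mx11_scalar raddfD.
have [||h1 h2] := @rank_one_inverse m (gram rs) Q (herm r) r d%:M PQ QP.
- by rewrite G1 -scalar_mxM gd.
- by rewrite G1 -scalar_mxM dg.
exists (Q - Q *m herm r *m d%:M *m r *m Q).
have -> : gram (r :: rs) = gram rs + herm r *m r.
  by rewrite /gram big_cons [herm r *m r + _]addrC addrA.
split=> //; apply: overD => //; apply: overN; apply: overM => //; apply: overM => //.
by apply: overM; [apply: overM => //; exact: over_herm | exact: over_scalar].
Qed.

Variable n : nat.
Local Notation M := (mxalg A n).
Implicit Types (u v w s h : M).

Lemma mxstarM u v : mxstar (u * v) = mxstar v * mxstar u.
Proof. exact: hermM. Qed.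

Lemma mxstarK u : mxstar (mxstar u) = u.
Proof. exact: hermK. Qed.

Lemma mxstarD u v : mxstar (u + v) = mxstar u + mxstar v.
Proof. exact: hermD. Qed.

Lemma mxstarZR (r : R) u : mxstar (r%:C *: u) = r%:C *: mxstar u.
Proof. by apply/matrixP => i j; rewrite !mxE starZR. Qed.

Lemma mxstar1 : mxstar (1 : M) = 1.
Proof. exact: herm1. Qed.

Lemma mxstarB u v : mxstar (u - v) = mxstar u - mxstar v.
Proof. by apply/matrixP => i j; rewrite !mxE starB. Qed.

Lemma mxnorm_star u : mxnorm (mxstar u) = mxnorm u.
Proof.
rewrite /mxnorm exchange_big; apply: eq_bigr => i _; apply: eq_bigr => j _.
by rewrite mxE anorm_star_eq.
Qed.

Lemma overZ (k : C) u : over u -> over (k *: u).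
Proof. by move=> hu i j; rewrite mxE; apply: commutantZ; exact: hu. Qed.

Lemma over1 : over (1 : M).
Proof. apply: over_scalar; exact: commutant1. Qed.

Lemma gram_mx_inverse w : over w -> exists Q, inverse_of (1 + mxstar w * w) Q.
Proof.
move=> hw; have [|Q [h1 h2 _]] := @gram_inverse n.+1 [seq row i w | i <- enum 'I_n.+1].
  by move=> r /mapP[i _ ->] a b; rewrite mxE.
exists Q; have e : gram [seq row i w | i <- enum 'I_n.+1] = 1 + mxstar w * w.
  rewrite /gram; congr (_ + _); apply/matrixP => i j; rewrite summxE big_map mxE big_enum.
  by apply: eq_bigr => k _; rewrite mxE big_ord1 !mxE.
by rewrite e in h1 h2; split; [exact: h1 | exact: h2].
Qed.

(** Turns a condition on entries into commutation in the matrix algebra, where the results on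
    logarithms and exponentials apply. *)
Lemma scalar_mx_commP w : over w <->
  forall c, commutant X c -> (c%:M : M) * w = w * (c%:M : M).
Proof.
have el c i j : ((c%:M : M) * w) i j = c * w i j.
  rewrite mxE (bigD1 i) //= mxE eqxx mulr1n big1 ?addr0 // => k ki.
  by rewrite mxE eq_sym (negPf ki) mulr0n mul0r.
have er c i j : (w * (c%:M : M)) i j = w i j * c.
  rewrite mxE (bigD1 j) //= mxE eqxx mulr1n big1 ?addr0 // => k ki.
  by rewrite mxE (negPf ki) mulr0n mulr0.
split=> [ow c hc|hw i j c hc]; first by apply/matrixP => i j; rewrite el er ow.
by rewrite -el -er hw.
Qed.

Lemma inverse_of_mul (a b N : M) : a * b = b * a -> inverse_of (a * b) N ->
  exists c, inverse_of a c.
Proof.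
move=> ab [h1 h2]; exists (b * N); split; first by rewrite mulrA.
have h3 : N * b * a = 1 by rewrite -mulrA -ab.
have h4 : a * (b * N) = 1 by rewrite mulrA.
by rewrite -(mul1r (b * N)) -h3 -[N * b * a * _]mulrA h4 mulr1.
Qed.

(** For z = x + i y with y <> 0 and u = x - s, (u + i y) (u - i y) = u^2 + y^2 = y^2 (1 + T^2) with
    T = u / y Hermitian, which [gram_mx_inverse] inverts. *)
Lemma spectrum_hermitian s : over s -> mxstar s = s ->
  forall z, spectrum s z -> complex.Im z = 0.
Proof.
move=> os ss z sz; apply/eqP; apply: contra_notT sz => y0.
case: z y0 => x y /= y0; pose u : M := x%:C%:A - s.
have ou : over u by apply: overD; [apply: overZ; exact: over1 | exact: overN].
have uu : mxstar u = u by rewrite mxstarB mxstarZR mxstar1 ss.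
have yC : y%:C != 0 :> C by rewrite eq_complex /= negb_and y0.
pose T : M := y%:C^-1 *: u.
have TT : mxstar T = T by rewrite /T -fmorphV mxstarZR uu.
have [|Q [Q1 Q2]] := @gram_mx_inverse T; first exact: overZ.
rewrite TT in Q1 Q2.
pose I : C := 'i%C.
have II : I * I = -1 by rewrite -expr2 sqr_i.
pose v : M := (I * y%:C)%:A.
have uv : u * v = v * u by rewrite /v -scalerAr -scalerAl mulr1 mul1r.
have zE : (x +i* y)%:A - s = u + v.
  rewrite /u /v addrAC -scalerDl; congr (_ *: _ - _).
  by apply: complex_ext => /=; ring.
have u2 : u * u = y%:C ^+ 2 *: (T * T).
  by rewrite /T -scalerAl -scalerAr !scalerA expr2 mulfK // mulfV // scale1r.
have v2 : v * v = - (y%:C ^+ 2)%:A.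
  by rewrite /v -scalerAl mul1r scalerA mulrACA II mulN1r scaleNr -expr2.
rewrite zE; clearbody T v u.
have e1 : (u + v) * (u - v) = u * u - v * v.
  by rewrite mulrDl !mulrBr -uv addrA subrK.
have e2 : (u - v) * (u + v) = u * u - v * v.
  by rewrite mulrBl !mulrDr -uv opprD addrA addrK.
apply: (@inverse_of_mul _ (u - v) (y%:C^-1 ^+ 2 *: Q)); first by rewrite e1 e2.
have e : (u + v) * (u - v) = y%:C ^+ 2 *: (1 + T * T).
  by rewrite e1 u2 v2 opprK addrC scalerDr.
rewrite e; split.
  by rewrite -scalerAl -scalerAr Q1 scalerA exprVn mulfV ?scale1r ?expf_neq0.
by rewrite -scalerAl -scalerAr Q2 scalerA exprVn mulVf ?scale1r ?expf_neq0.
Qed.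

(** The spectrum is real. It misses 0 because w^* w is invertible, and a negative x because x - w^*
    w = x (1 + T^* T) for T = w / sqrt (- x). *)
Lemma spectrum_gram w v : over w -> inverse_of w v ->
  forall z, spectrum (mxstar w * w) z -> 0 < z.
Proof.
move=> ow [wv vw] z sz.
have os : over (mxstar w * w) by apply: overM => //; exact: over_herm.
have ss : mxstar (mxstar w * w) = mxstar w * w by rewrite mxstarM mxstarK.
have := spectrum_hermitian os ss sz; case: z sz => x y sz /= y0.
rewrite y0 in sz *; rewrite ltcE /= eqxx /= ltNge; apply/negP => x0; apply: sz.
have [x00|xn] := eqVneq x 0.
  exists (- (v * mxstar v)); rewrite x00 scale0r sub0r; split; rewrite mulrNN.
    by rewrite -mulrA (mulrA w) wv mul1r -mxstarM vw mxstar1.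
  by rewrite -mulrA (mulrA (mxstar v)) -mxstarM wv mxstar1 mul1r.
pose q := Num.sqrt (- x).
have xp : 0 < - x by rewrite oppr_gt0 lt_neqAle xn.
have q0 : 0 < q by rewrite sqrtr_gt0.
have qC : q%:C != 0 :> C by rewrite eq_complex /= negb_and gt_eqF.
have qq : q%:C * q%:C = - x%:C by rewrite -rmorphM -expr2 sqr_sqrtr ?rmorphN // ltW.
pose T : M := q%:C^-1 *: w.
have [|Q [Q1 Q2]] := @gram_mx_inverse T; first exact: overZ.
have e : x%:C%:A - mxstar w * w = x%:C *: (1 + mxstar T * T).
  rewrite scalerDr; congr (_ + _); rewrite /T -fmorphV mxstarZR -scalerAl -scalerAr !scalerA.
  rewrite fmorphV -[x%:C]opprK -qq -[LHS]scaleN1r; congr (_ *: _).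
  by field.
have xC : x%:C != 0 :> C by rewrite eq_complex /= negb_and xn.
exists (x%:C^-1 *: Q); rewrite e; split.
  by rewrite -scalerAl -scalerAr Q1 scalerA mulfV ?scale1r.
by rewrite -scalerAl -scalerAr Q2 scalerA mulVf ?scale1r.
Qed.

End CommutingMatrices.

(** * Logarithms and square roots of positive matrices *)

Section MatrixLog.
Variables (R : realType) (A : cstarAlg R) (n : nat) (X : set A).
Local Notation C := R[i].
Local Open Scope complex_scope.
Local Notation M := (mxalg A n).
Local Notation nu := (mxnorm_bnorm A n).
Hypothesis Xcomm : forall x y, X x -> X y -> x * y = y * x.
Hypothesis Xstar : forall x, X x -> X (star x).
Implicit Types (h u w T : M).

Lemma mxstar_bexp T : mxstar (bexp T) = bexp (mxstar T).
Proof.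
have [K hK] := bexp_rate nu T.
apply: (rate_unique (nu := nu) (u := compound (mxstar T))); last exact: bexp_rate.
have nuE (x : M) : nu x = mxnorm x by [].
exists K => k; rewrite nuE.
suff -> : compound (mxstar T) k = mxstar (compound T k).
  by rewrite -mxstarB mxnorm_star -nuE; exact: hK.
have kC : k.+1%:R^-1 = (k.+1%:R^-1)%:C :> C by rewrite natrC fmorphV.
have pw (x : M) m : (mxstar x) ^+ m = mxstar (x ^+ m).
  by elim: m => [|m IH]; rewrite ?expr0 ?mxstar1 // exprS exprSr IH mxstarM.
by rewrite /compound -pw mxstarD mxstar1 kC mxstarZR.
Qed.

Lemma over_log h : (forall z, spectrum h z -> 0 < z) -> over X h ->
  over X (hfc (@clog R) h).
Proof.
move=> /(log_path_ex nu)[L [Y [K [LX <-]]]] /scalar_mx_commP oh.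
apply/scalar_mx_commP => c hc; apply: (log_path_commuteL LX); last exact: oh.
by rewrite ler01 lexx.
Qed.

Lemma over_bexp T : over X T -> over X (bexp T).
Proof.
move=> /scalar_mx_commP oT; apply/scalar_mx_commP => c hc.
by apply: (bexp_commute nu); exact: oT.
Qed.

Lemma mxstar_log h : (forall z, spectrum h z -> 0 < z) -> mxstar h = h ->
  mxstar (hfc (@clog R) h) = hfc (@clog R) h.
Proof.
move=> /(log_path_ex nu)[L [Y [K [LX <-]]]] hh.
apply/eqP; rewrite -subr_eq0; apply/eqP.
apply: (@log_path_map _ _ nu h L Y K LX (fun x => mxstar x - x) (1 + 1)) => [x y|r x|x|t t01|].
- by rewrite mxstarD opprD addrACA.
- by rewrite mxstarZR scalerBr.
- rewrite (le_trans (nrmD _ _ _)) // nuN mulrDl mul1r lerD2r.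
  by rewrite (_ : nu (mxstar x) = nu x) //; exact: mxnorm_star.
(* From Y t H = h - 1 = H Y t with [H] and [h] Hermitian, the adjoint of [Y t] solves the same
   equation, and [H] is invertible. *)
- have [i1 i2] := log_path_inverse LX t01.
  have [_ _ /(_ t t01)[h1 h2] _] := LX.
  set H := 1 + t%:C *: (h - 1) in h1 h2 i1 i2.
  have HH : mxstar H = H by rewrite /H mxstarD mxstar1 mxstarZR mxstarB hh mxstar1.
  have := congr1 (@mxstar R A n) h1; rewrite mxstarM HH mxstarB hh mxstar1 -h2 => h3.
  apply/eqP; rewrite subr_eq0; apply/eqP.
  by rewrite -[LHS]mul1r -i2 -mulrA h3 mulrA i2 mul1r.
by rewrite ler01 lexx.
Qed.

Lemma mx_sqrt h : (forall z, spectrum h z -> 0 < z) -> over X h -> mxstar h = h ->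
  exists k k' : M, [/\ over X k, mxstar k = k, k * k = h & inverse_of k k'].
Proof.
move=> hp oh hh; pose L := hfc (@clog R) h.
pose T := (1 / 2 : R)%:C *: L.
exists (bexp T), (bexp (- T)); split.
- by apply: over_bexp; apply: overZ; exact: over_log.
- by rewrite mxstar_bexp /T mxstarZR mxstar_log.
- rewrite -(bexpD nu) //.
  have -> : T + T = L.
    rewrite /T -scalerDl -rmorphD.
    have -> : 1 / 2 + 1 / 2 = 1 :> R by lra.
    by rewrite scale1r.
  exact: (bexp_log nu hp).
split; first exact: (bexpN nu).
by have := bexpN nu (- T); rewrite opprK.
Qed.

Lemma spectrum_congr h u v : (forall z, spectrum h z -> 0 < z) -> mxstar h = h ->
  over X h -> over X u -> inverse_of u v ->
  forall z, spectrum (mxstar u * h * u) z -> 0 < z.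
Proof.
move=> hp hh oh ou [uv vu].
have [k [k' [ok kk kkh [k1 k2]]]] := mx_sqrt hp oh hh.
have -> : mxstar u * h * u = mxstar (k * u) * (k * u).
  by rewrite mxstarM kk -kkh !mulrA.
apply: (spectrum_gram Xcomm Xstar (v := v * k')); first exact: overM.
split; first by rewrite -mulrA (mulrA u) uv mul1r.
by rewrite -mulrA (mulrA k') k2 mul1r.
Qed.

End MatrixLog.

(** * The determinant over a commutative subring *)

Section ProductTaylor.
Variables (R : realType) (A : cstarAlg R).
Local Notation C := R[i].
Local Open Scope complex_scope.

Lemma anorm0 : anorm (0 : A) = 0.
Proof. exact: (nu0 (anorm_bnorm A)). Qed.

Lemma anorm_prod I (r : seq I) (F : I -> A) (c : I -> R) :
  (forall i, anorm (F i) <= c i) -> anorm (\prod_(i <- r) F i) <= \prod_(i <- r) c i.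
Proof.
move=> Fc; elim: r => [|i r IH]; first by rewrite !big_nil anorm1.
rewrite !big_cons (le_trans (anormM _ _)) //; apply: ler_pM => //; exact: anorm_ge0.
Qed.

Lemma prod_taylor I (r : seq I) (K : R) : 0 <= K -> exists2 c, 0 <= c &
  forall (w : I -> A) (d : R), `|d| <= 1 -> (forall i, anorm (w i) <= K) ->
  anorm (\prod_(i <- r) (1 + d%:C *: w i) - 1 - d%:C *: \sum_(i <- r) w i) <= c * d ^+ 2.
Proof.
move=> K0; elim: r => [|i r [c c0 hc]].
  by exists 0 => // w d _ _; rewrite !big_nil scaler0 subr0 subrr anorm0 mul0r.
exists ((1 + K) * c + K * ((size r)%:R * K)) => [|w d d1 wK].
  by rewrite addr_ge0 // ?mulr_ge0 ?addr_ge0.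
rewrite !big_cons; set P := \prod_(j <- r) _; set T := \sum_(j <- r) _; set v := w i.
have -> : (1 + d%:C *: v) * P - 1 - d%:C *: (v + T) =
    (1 + d%:C *: v) * (P - 1 - d%:C *: T) + (d ^+ 2)%:C *: (v * T).
  have -> : (d ^+ 2)%:C *: (v * T) = (d%:C *: v) * (d%:C *: T).
    by rewrite -scalerAl -scalerAr scalerA -rmorphM -expr2.
  move: (d%:C *: T) (scalerDr d%:C v T) => t ->; move: (d%:C *: v) => x.
  by rewrite !mulrBr mulr1 [(1 + x) * t]mulrDl mul1r !opprD !addrA subrK.
have h := hc w d d1 wK.
have nT : anorm T <= (size r)%:R * K.
  rewrite (le_trans (anorm_sum _ _ _)) // (@le_trans _ _ (\sum_(j <- r) K)) //.
    exact: ler_sum.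
  by rewrite big_const_seq count_predT iter_addr_0 mulr_natl.
have d20 : 0 <= d ^+ 2 by exact: sqr_ge0.
rewrite (le_trans (anormD _ _)) // [leRHS]mulrDl lerD //.
  rewrite (le_trans (anormM _ _)) // -mulrA; apply: ler_pM; rewrite ?anorm_ge0 //.
  rewrite (le_trans (anormD _ _)) // anorm1 lerD2l anormZ modcR.
  by rewrite (le_trans (ler_piMl (anorm_ge0 _) d1)) // wK.
rewrite anormZ modcR ger0_norm // mulrC ler_wpM2r // (le_trans (anormM _ _)) //.
by rewrite ler_pM ?anorm_ge0 ?wK.
Qed.

(** A permutation that moves i also moves s i, so at least two factors are O(d). *)
Lemma prod_nonfixed n (s : 'S_n) (K d : R) (F : 'I_n -> A) : 0 <= K -> s != 1%g ->
  `|d| <= 1 -> (forall i, anorm (F i) <= (1 + K) * (if s i == i then 1 else `|d|)) ->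
  anorm (\prod_i F i) <= (1 + K) ^+ n * d ^+ 2.
Proof.
move=> K0 s1 d1 hF; apply: (le_trans (anorm_prod _ hF)).
rewrite big_split prodr_const card_ord ler_wpM2l ?exprn_ge0 ?addr_ge0 //.
have [i si] : exists i, s i != i.
  apply: contrapT => h; move/negP: s1; apply; apply/eqP/permP => i; rewrite perm1.
  by apply/eqP; apply: contrapT => /negP hi; apply: h; exists i.
have ssi : s (s i) != s i by rewrite (inj_eq perm_inj).
rewrite (bigD1 i) //= (bigD1 (s i)) //= (negPf si) (negPf ssi) mulrA -expr2 real_normK ?num_real //.
have /andP[_ h] : 0 <= \prod_(j | (j != i) && (j != s i)) (if s j == j then 1 else `|d|) <= 1.
  elim/big_rec: _ => [|j x _ /andP[x0 x1]]; first by rewrite ler01 lexx.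
  by case: ifP => _; rewrite ?mul1r ?x0 // mulr_ge0 //= mulr_ile1.
by rewrite ler_piMr ?sqr_ge0.
Qed.

End ProductTaylor.

Section CommutingDeterminant.
Variables (R : realType) (A : cstarAlg R) (n : nat) (X : set A).
Local Notation C := R[i].
Local Open Scope complex_scope.
Local Notation M := (mxalg A n).
Hypothesis Xcomm : forall x y, X x -> X y -> x * y = y * x.
Hypothesis Xstar : forall x, X x -> X (star x).

(** Packaging the bicommutant as a commutative ring makes [\det] and its multiplicativity
    available. *)
Definition bicom : pred A := fun x => `[< bicommutant X x >].

Lemma bicom_subring : subring_closed bicom.
Proof.
split; rewrite /in_mem /=.
- by apply/asboolP; exact: commutant1.
- move=> x y /asboolP hx /asboolP hy; apply/asboolP.
  by apply: commutant_add => //; exact: commutantN.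
- by move=> x y /asboolP hx /asboolP hy; apply/asboolP; exact: commutantM.
Qed.

HB.instance Definition _ := GRing.isSubringClosed.Build A bicom bicom_subring.

Record bicomType := Bicom {bicom_val :> A; _ : bicom_val \in bicom}.

HB.instance Definition _ := [isSub for bicom_val].
HB.instance Definition _ := [Choice of bicomType by <:].
HB.instance Definition _ := [SubChoice_isSubNzRing of bicomType by <:].

Lemma bicom_mulC (x y : bicomType) : x * y = y * x.
Proof.
apply: val_inj; rewrite !rmorphM /=; apply: (bicommutant_commute Xcomm).
  by have := valP x => /asboolP.
by have := valP y => /asboolP.
Qed.

HB.instance Definition _ := GRing.PzRing_hasCommutativeMul.Build bicomType bicom_mulC.

Local Notation cB := bicomType.
HB.instance Definition _ := GRing.RMorphism.copy bicom_val (\val : cB -> A).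
Local Notation valA := bicom_val.

Lemma valA_bicom (x : cB) : bicommutant X (valA x).
Proof. by have := valP x => /asboolP. Qed.

Lemma valA_inj : injective valA.
Proof. exact: val_inj. Qed.

Lemma bicommutant_in x : bicommutant X x -> x \in bicom.
Proof. by move=> hx; apply/asboolP. Qed.

Definition mxval (W : 'M[cB]_n.+1) : M := map_mx valA W.

Lemma mxval_lift (w : M) : over X w -> exists W, mxval W = w.
Proof.
move=> ow; exists (\matrix_(i, j) Bicom (bicommutant_in (ow i j))).
by apply/matrixP => i j; rewrite !mxE.
Qed.

Lemma mxval_inj : injective mxval.
Proof.
by move=> U W /matrixP h; apply/matrixP => i j; apply: valA_inj; have := h i j; rewrite !mxE.
Qed.

Lemma mxvalM (U W : 'M[cB]_n.+1) : mxval (U *m W) = mxval U * mxval W.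
Proof. exact: map_mxM. Qed.

Lemma mxval1 : mxval 1%:M = 1.
Proof. exact: map_mx1. Qed.

(** In the Leibniz expansion the identity contributes 1 + d Tr W up to O(d^2), and by
    [prod_nonfixed] every other permutation is O(d^2). The relation between [V] and [W] goes through
    [mxval] because the complex scalars act on A, not on the subring. *)
Lemma det_taylor (K : R) : 0 <= K -> exists2 c, 0 <= c &
  forall (W V : 'M[cB]_n.+1) (d : R), `|d| <= 1 -> (forall i j, anorm (valA (W i j)) <= K) ->
  mxval V = 1 + d%:C *: mxval W ->
  anorm (valA (\det V) - 1 - d%:C *: \tr (mxval W)) <= c * d ^+ 2.
Proof.
move=> K0; have [c c0 hc] := @prod_taylor R A _ (index_enum 'I_n.+1) K K0.
exists (c + (\sum_(s : 'S_n.+1 | s != 1%g) (1 + K) ^+ n.+1)) => [|W V d d1 WK VE].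
  by rewrite addr_ge0 // sumr_ge0 // => s _; rewrite exprn_ge0 ?addr_ge0.
have VW i j : valA (V i j) = (i == j)%:R + d%:C *: valA (W i j).
  by have := congr1 (fun m : M => m i j) VE; rewrite !mxE.
have e1 : valA (\prod_i V i ((1%g : 'S_n.+1) i)) = \prod_i (1 + d%:C *: valA (W i i)).
  rewrite rmorph_prod; apply: eq_bigr => i _; rewrite perm1.
  by have := VW i i; rewrite eqxx.
have e2 : \tr (mxval W) = \sum_i valA (W i i) by apply: eq_bigr => i _; rewrite mxE.
pose T : cB := \sum_(s : 'S_n.+1 | s != 1%g) (-1) ^+ s * \prod_i V i (s i).
have e3 : valA (\det V) = valA (\prod_i V i ((1%g : 'S_n.+1) i)) + valA T.
  by rewrite /determinant (bigD1 1%g) //= odd_perm1 expr0 mul1r -rmorphD.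
have nT : anorm (valA T) <= (\sum_(s : 'S_n.+1 | s != 1%g) (1 + K) ^+ n.+1) * d ^+ 2.
  rewrite rmorph_sum (le_trans (anorm_sum _ _ _)) // mulr_suml; apply: ler_sum => s s1.
  rewrite rmorphM rmorph_sign rmorph_prod.
  have -> : anorm ((-1) ^+ s * \prod_i valA (V i (s i))) = anorm (\prod_i valA (V i (s i))).
    by case: (odd_perm s); rewrite ?mul1r // mulN1r; exact: (nuN (anorm_bnorm A)).
  apply: (prod_nonfixed K0 s1 d1) => i; rewrite VW; case: (eqVneq (s i) i) => [->|si].
    rewrite mulr1 (le_trans (anormD _ _)) // anorm1 lerD2l anormZ modcR.
    by rewrite (le_trans (ler_piMl (anorm_ge0 _) d1)).
  rewrite add0r anormZ modcR mulrC ler_wpM2r //.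
  by rewrite (le_trans (WK _ _)) // lerDr.
rewrite e3 e1 e2 [_ + _ - 1]addrAC [_ + _ - d%:C *: _]addrAC (le_trans (anormD _ _)) //.
by rewrite [leRHS]mulrDl lerD // hc.
Qed.

(* Along [h_t = 1 + t (h - 1)], the determinant solves [D' = D tr (X t)]. *)
Lemma mxdet_det (h : M) (H : 'M[cB]_n.+1) : mxval H = h ->
  (forall z, spectrum h z -> 0 < z) -> mxdet h = valA (\det H).
Proof.
move=> Hh hp; have [L [Y [K [LX L1]]]] := log_path_ex (mxnorm_bnorm A n) hp.
have oh : over X h by move=> i j; rewrite -Hh mxE; exact: valA_bicom.
rewrite /mxdet -L1 -[hfc _ _]/(bexp (\tr (L 1))).
have [L0 bd hY hL] := LX.
have oY t : 0 <= t <= 1 -> over X (Y t).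
  move=> t01; apply/scalar_mx_commP => c hc; apply: (log_path_commuteX LX t01).
  by move/scalar_mx_commP: oh; apply.
have oL t : 0 <= t <= 1 -> over X (L t).
  move=> t01; apply/scalar_mx_commP => c hc; apply: (log_path_commuteL LX t01).
  by move/scalar_mx_commP: oh; apply.
pose Ht (t : R) : M := 1 + t%:C *: (h - 1).
have oHt t : over X (Ht t).
  apply: overD; first exact: over1.
  by apply: overZ; apply: overD => //; apply: overN; exact: over1.
have /choice[HB HBE] t : exists W, mxval W = Ht t := mxval_lift (oHt t).
pose D t : A := valA (\det (HB t)).
have K0 : 0 <= K.
  by have [|h1 _] := bd 0; rewrite ?lexx ?ler01 // (le_trans _ h1) ?nu_ge0.
have [c c0 hc] := det_taylor K0.
have trD (a b : M) : \tr (a + b) = \tr a + \tr b by rewrite /mxtrace -big_split;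
  apply: eq_bigr => i _; rewrite mxE.
have trZ (k : C) (a : M) : \tr (k *: a) = k *: \tr a by rewrite /mxtrace scaler_sumr;
  apply: eq_bigr => i _; rewrite mxE.
have trB (a b : M) : \tr (a - b) = \tr a - \tr b by rewrite trD -scaleN1r trZ scaleN1r.
have trN (a : M) : anorm (\tr a) <= mxnorm a.
  rewrite (le_trans (anorm_sum _ _ _)) //; apply: ler_sum => i _.
  rewrite (bigD1 i) //= lerDl sumr_ge0 // => j _; exact: anorm_ge0.
(* Since h_s = h_t (1 + (s - t) Y t), the factor is the determinant of 1 + (s - t) Y t, expanded by
   [det_taylor]. *)
have Dstep s t : 0 <= s <= 1 -> 0 <= t <= 1 -> exists2 E, D s = D t * E &
    anorm (E - 1 - (s - t)%:C *: \tr (Y t)) <= c * (s - t) ^+ 2.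
  move=> s01 t01; have [W WE] := mxval_lift (oY t t01).
  have oV : over X (1 + (s - t)%:C *: Y t).
    by apply: overD; [exact: over1 | apply: overZ; exact: oY].
  have [V VE] := mxval_lift oV.
  exists (valA (\det V)).
    rewrite /D -rmorphM -det_mulmx; congr (valA (\det _)); apply: mxval_inj.
    have [_ h2] := hY t t01.
    rewrite mxvalM !HBE VE mulrDr mulr1 -scalerAr /Ht h2 -addrA -scalerDl -rmorphD.
    by rewrite (addrC t) subrK.
  rewrite -WE; apply: hc; last by rewrite WE.
    by rewrite ler_norml; lra.
  move=> i j; have [_ h2] := bd t t01; rewrite (le_trans _ h2) // -WE.
  by rewrite (le_trans _ (mxnorm_entry _ i j)) // mxE.
have D0 : D 0 = 1.
  rewrite /D; have -> : HB 0 = 1%:M.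
    by apply: mxval_inj; rewrite HBE mxval1 /Ht rmorph0 scale0r addr0.
  by rewrite det1 rmorph1.
have D1 : D 1 = valA (\det H).
  rewrite /D; congr (valA (\det _)); apply: mxval_inj.
  by rewrite HBE Hh /Ht rmorph1 scale1r addrC subrK.
have i0 : 0 <= (0 : R) <= 1 by rewrite lexx ler01.
(* The single step from 0 to t already bounds [D t], as [D 0 = 1]. *)
pose KD := 1 + K + c.
have Dbd t : 0 <= t <= 1 -> anorm (D t) <= KD.
  move=> t01; have /andP[t0 t1] := t01; have [E -> hE] := Dstep t 0 t01 i0.
  rewrite D0 mul1r; rewrite subr0 in hE.
  have -> : E = (E - 1 - t%:C *: \tr (Y 0)) + (1 + t%:C *: \tr (Y 0)).
    by rewrite -[_ - _ - _]addrA -opprD subrK.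
  rewrite (le_trans (anormD _ _)) // /KD addrC lerD //.
    rewrite (le_trans (anormD _ _)) // anorm1 lerD2l anormZ modcR ger0_norm //.
    have [_ h2] := bd 0 i0.
    by rewrite (le_trans (ler_piMl (anorm_ge0 _) t1)) // (le_trans (trN _)).
  by rewrite (le_trans hE) // ler_piMr // exprn_ile1.
rewrite -D1; symmetry.
have KD0 : 0 <= KD by rewrite !addr_ge0.
apply: (@ode_exp R A (anorm_bnorm A) D (fun t => \tr (L t)) (fun t =>
  \tr (Y t)) (KD * c + KD + K)) => //.
- by rewrite L0 /mxtrace big1 // => i _; rewrite mxE.
- move=> t t01; have [h1 h2] := bd t t01; split.
  + by rewrite (le_trans (Dbd t t01)) // addrAC lerDr addr_ge0 // mulr_ge0.
  + by rewrite (le_trans (trN _)) // (le_trans h1) // lerDr addr_ge0 // mulr_ge0.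
  + by rewrite (le_trans (trN _)) // (le_trans h2) // lerDr addr_ge0 // mulr_ge0.
- move=> s t s01 t01; have [E -> hE] := Dstep s t s01 t01.
  rewrite -mulrBr opprD addrA (le_trans (nrmM _ _ _)) //.
  rewrite (@le_trans _ _ (KD * (c * (s - t) ^+ 2))) //.
    by apply: ler_pM; rewrite ?anorm_ge0 ?Dbd.
  by rewrite mulrA ler_wpM2r ?sqr_ge0 // -addrA lerDl addr_ge0.
- move=> s t s01 t01; rewrite -trZ -!trB (le_trans (trN _)) // (le_trans (hL s t s01 t01)) //.
  by rewrite ler_wpM2r ?sqr_ge0 // lerDr addr_ge0 // mulr_ge0.
move=> s t s01 t01; apply: (bicommutant_commute Xcomm).
  by apply: commutant_sum => i _; exact: oL.
by apply: commutant_sum => i _; exact: oL.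
Qed.

Lemma mxdet_congr (h u v : M) : over X h -> over X u -> inverse_of u v ->
  mxstar h = h -> (forall z, spectrum h z -> 0 < z) ->
  mxdet (mxstar u * h * u) = mxdet (mxstar u * u) * mxdet h.
Proof.
move=> oh ou uv hh hp.
have ous : over X (mxstar u) by exact: over_herm.
have [H HE] := mxval_lift oh; have [U UE] := mxval_lift ou; have [V VE] := mxval_lift ous.
have p1 := spectrum_congr Xcomm Xstar hp hh oh ou uv.
have p2 := spectrum_gram Xcomm Xstar ou uv.
have E1 : mxval (V *m H *m U) = mxstar u * h * u by rewrite !mxvalM HE UE VE.
have E2 : mxval (V *m U) = mxstar u * u by rewrite !mxvalM UE VE.
rewrite (mxdet_det E1 p1) (mxdet_det E2 p2) (mxdet_det HE hp) -rmorphM !det_mulmx.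
by congr (valA _); rewrite mulrAC.
Qed.

End CommutingDeterminant.

(** * The product formula *)

Theorem proposition6p10 (R : realType) (A : cstarAlg R) (S : set A)
    (hS : star_subalgebra S)
    (hfcS : closed_under_hfc S)
    (hfcMS : forall n : nat, closed_under_hfc (@mx_over R A S n.+1))
    (n : nat) (h u : mxalg A n)
    (hh : GLpos S h) (hu : GL S u)
    (hhu : compatible h u) (hhh : compatible h h) (huu : compatible u u)
    (huu' : compatible u (mxstar u)) :
  mxdet (mxstar u * h * u) = mxdet (mxstar u * u) * mxdet h.
Proof.
have [[_ [hv _ [hhv hvh]]] [hherm hpos]] := hh; have [_ [v _ uv]] := hu.
have hE i j : star (h i j) = h j i by rewrite -[in RHS]hherm mxE.
have uu' i j k l : u i j * star (u k l) = star (u k l) * u i j.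
  by have := huu' i j l k; rewrite !mxE.
(* As h is Hermitian, its entries are adjoints of entries of h, so commutation with u passes to
   u^*. *)
have hu' i j k l : h i j * star (u k l) = star (u k l) * h i j.
  by rewrite -hE -!starM hhu.
pose X : set A := [set x | exists i j, [\/ x = h i j, x = u i j | x = star (u i j)]].
have Xcomm x y : X x -> X y -> x * y = y * x.
  move=> [i [j [->|->|->]]] [k [l [->|->|->]]].
  - exact: hhh.
  - exact: hhu.
  - exact: hu'.
  - exact/esym/hhu.
  - exact: huu.
  - exact: uu'.
  - exact/esym/hu'.
  - exact/esym/uu'.
  - by rewrite -[LHS]starM -[RHS]starM huu.
have Xstar x : X x -> X (star x).
  move=> [i [j [->|->|->]]]; first by exists j, i; rewrite hE; constructor 1.
    by exists i, j; constructor 3.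
  by exists i, j; rewrite starK; constructor 2.
apply: (mxdet_congr Xcomm Xstar _ _ uv hherm).
- by move=> i j; apply: sub_bicommutant; exists i, j; constructor 1.
- by move=> i j; apply: sub_bicommutant; exists i, j; constructor 2.
(* Positivity gives only 0 <= z; the value 0 is excluded by the inverse of h. *)
move=> z hz; have := hpos z hz; rewrite /= le_eqVlt => /predU1P[z0|//].
case: hz; exists (- hv); rewrite -z0 scale0r sub0r.
by split; rewrite mulrNN.
Qed.
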